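(* Let $\hat\Omega$ be the minimizer $$\hat\Omega=\arg\min_{\tilde\Omega\in\mathbb S_p^+}\Big[\frac1L\sum_{\ell=1}^L\Big\|y^{(\ell)}y^{(\ell)\top}-\frac1pX^{(\ell)}\tilde\Omega X^{(\ell)\top}-\sigma^2I\Big\|_F^2+\tilde\lambda\sum_{i\ne j}|\tilde\Omega_{ij}|\Big].$$ Suppose that: (b) for all $\ell$, $0<\underline c\le\gamma_\ell\le\overline c<\infty$, and for every dimension $p$, $0<\underline c^{(\ell)}\le\lambda_{\min}(\Sigma^{(\ell)})\le\lambda_{\max}(\Sigma^{(\ell)})\le\bar c^{(\ell)}<\infty$ with $\sup_\ell\bar c^{(\ell)}\le\bar c_{\rm op}$ and $\inf_\ell\underline c^{(\ell)}>\underline c_{\rm op}$, where $\underline c_{\rm op},\bar c_{\rm op}\in(0,\infty)$ are constants; (c) the vectors $\sqrt p\,\bar\beta^{(\ell)}$ are independent, zero mean and sub-Gaussian with parameter $\tau_\beta$, and the vectors $\varepsilon^{(\ell)}$ are independent, zero mean and sub-Gaussian with parameter $\tau_\varepsilon$; (d) the set $S=\{(i,j):\Omega_{ij}\ne0,\ i\ne j\}$ has cardinality at most $s$; (e) for each $\ell$ there is $\kappa_0^{(\ell)}>0$ with $\frac1{p^2}\|(X^{(\ell)}\otimes X^{(\ell)})\operatorname{vec}(\Delta)\|_2^2\ge\kappa_0^{(\ell)}\|\Delta\|_F^2$ for every symmetric $\Delta\in\mathbb R^{p\times p}$, and $\kappa_0^{(\ell)}$ is bounded below uniformly in $\ell$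 by an absolute constant $\kappa_0>0$. If $\tilde\lambda\asymp\sqrt{\frac{\log p}{L}}$, then $$\|\hat\Omega-\Omega\|_F=\mathcal O_P\left(\sqrt{\frac{(p+s)\log p}{L}}\right).$$
   Context: Model: for $\ell=1,\dots,L$, $y^{(\ell)}=X^{(\ell)}\bar\beta^{(\ell)}+\varepsilon^{(\ell)}\in\mathbb R^{n_\ell}$, where the design matrices are of the form $X^{(\ell)}=Z^{(\ell)}(\Sigma^{(\ell)})^{1/2}\in\mathbb R^{n_\ell\times p}$ ($Z^{(\ell)}$ with i.i.d. entries of mean $0$, variance $1$ and uniformly bounded $12$th moments, $\Sigma^{(\ell)}$ deterministic positive definite) and are treated as fixed (fixed design); $\bar\beta^{(\ell)}$ are i.i.d. with mean $0$ and $\mathbb E\bar\beta^{(\ell)}\bar\beta^{(\ell)\top}=\frac1p\Omega$; $\varepsilon^{(\ell)}$ has mean $0$ and covariance $\sigma^2I_{n_\ell}$, $\sigma^2$ known; $\bar\beta^{(\ell)},\varepsilon^{(\ell)}$ are mutually independent and independent of the designs. $\Omega$ is positive definite with $C_0<\lambda_{\min}(\Omega)\le\lambda_{\max}(\Omega)<C_1$ for positive constants not depending on $p$. Asymptotic regime: $L,p,n_\ell\to\infty$ with $p/n_\ell\to\gamma_\ell$. A random vector $x$ with mean $\mu$ is sub-Gaussian with parameter $\tau$ if $\mathbb E\exp(\lambda v^\top(x-\mu))\le\exp(\lambda^2\tau^2/2)$ for all unit vectors $v$ and $\lambda\in\mathbb R$. $\mathbb S_p^+$ is the set of symmetric positive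 definite $p\times p$ matrices, $\|\cdot\|_F$ the Frobenius norm, $\otimes$ the Kronecker product, and $a\asymp b$ means equality up to positive constant factors. $X_n=\mathcal O_P(b_n)$ means $X_n/b_n$ is bounded in probability.
   Formalization: Adds log p = O(L), without which the bound fails (e.g. Ω = I, Gaussian data, L = o(log p)); λ̃ ≍ √(log p/L) is taken with a large enough lower constant, as small constants fail; p/n_ℓ → γ_ℓ is taken uniformly in ℓ; designs are fixed within events of probability tending to 1. *)

(* Defs.v *)
From mathcomp Require Export all_boot all_order all_algebra.
From mathcomp Require Export all_classical all_reals all_analysis.
From mathcomp Require Export mxtens.
Export Order.TTheory GRing.Theory Num.Theory numFieldNormedType.Exports.

Set Implicit Arguments.
Unset Strict Implicit.
Unset Printing Implicit Defensive.

Local Open Scope classical_set_scope.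
Local Open Scope ring_scope.

(** * Linear algebra *)

(* On column vectors this is the Euclidean norm. *)
Definition frob (R : realType) m n (A : 'M[R]_(m, n)) : R :=
  Num.sqrt (\sum_i \sum_j A i j ^+ 2).

Definition posdef (R : realType) n (A : 'M[R]_n) : Prop :=
  A^T = A /\ forall v : 'cV[R]_n, v != 0 -> 0 < (v^T *m A *m v) 0 0.

(* Meaningful for symmetric matrices of positive size, whose set of real
   eigenvalues is finite and nonempty. *)
Definition lambda_min (R : realType) n (A : 'M[R]_n) : R :=
  inf [set a | eigenvalue A a].

Definition lambda_max (R : realType) n (A : 'M[R]_n) : R :=
  sup [set a | eigenvalue A a].

(* Column stacking.  The index convention is that of [tensmx], so that
   (A *t B) *m vec D = vec (B *m D *m A^T). *)
Definition vec (R : realType) m n (D : 'M[R]_(m, n)) : 'cV[R]_(n * m) :=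
  \col_k D (mxtens_unindex k).2 (mxtens_unindex k).1.

Definition restricted_eigenvalue (R : realType) m p (X : 'M[R]_(m, p))
    (kappa : R) : Prop :=
  forall Delta : 'M[R]_p, Delta^T = Delta ->
    kappa * frob Delta ^+ 2
      <= (p%:R ^+ 2)^-1 * frob ((X *t X) *m vec Delta) ^+ 2.

Definition offdiag_support (R : realType) p (W : 'M[R]_p) : {set 'I_p * 'I_p} :=
  [set ij | (W ij.1 ij.2 != 0) && (ij.1 != ij.2)].

(** * Estimator *)

Definition objective (R : realType) (p L : nat) (N : 'I_L -> nat)
    (X : forall l, 'M[R]_(N l, p)) (y : forall l, 'cV[R]_(N l))
    (sigma lam : R) (W : 'M[R]_p) : R :=
  L%:R^-1 * (\sum_(l < L)
      frob (y l *m (y l)^T - p%:R^-1 *: (X l *m W *m (X l)^T)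
            - (sigma ^+ 2)%:M) ^+ 2)
  + lam * (\sum_(i < p) \sum_(j < p | i != j) `|W i j|).

Definition is_minimizer (R : realType) (p L : nat) (N : 'I_L -> nat)
    (X : forall l, 'M[R]_(N l, p)) (y : forall l, 'cV[R]_(N l))
    (sigma lam : R) (W : 'M[R]_p) : Prop :=
  posdef W /\
  forall W' : 'M[R]_p, posdef W' ->
    objective X y sigma lam W <= objective X y sigma lam W'.

(** * Probability *)

Definition mxborel (R : realType) m n : set_system 'M[R]_(m, n) :=
  <<s [set C | exists i j (B : set R),
         measurable B /\ C = [set A : 'M[R]_(m, n) | B (A i j)]] >>.

Definition random_matrix d (T : measurableType d) (R : realType) m n
    (X : T -> 'M[R]_(m, n)) : Prop :=
  forall i j, measurable_fun setT (fun w => X w i j).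

(* Sets of the form X^-1(B) with B in the sigma-algebra G. *)
Definition sigma_of (T U : Type) (G : set_system U) (X : T -> U) : set_system T :=
  [set A | exists2 B, G B & A = X @^-1` B].

(* The F i are sigma-algebras, hence contain setT, so the product rule over all
   of I includes the product rule over every subfamily. *)
Definition mutually_independent d (T : measurableType d) (R : realType)
    (P : probability T R) (I : finType) (F : I -> set_system T) : Prop :=
  forall A : I -> set T, (forall i, F i (A i)) ->
    P (\bigcap_i A i) = (\prod_(i : I) fine (P (A i)))%:E.

Definition same_law d (T : measurableType d) (R : realType)
    (P : probability T R) (U : Type) (G : set_system U) (X Y : T -> U) : Prop :=
  forall B, G B -> P (X @^-1` B) = P (Y @^-1` B).

Definition iid_entries d (T : measurableType d) (R : realType)
    (P : probability T R) m n (Z : T -> 'M[R]_(m, n)) : Prop :=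
  mutually_independent P
    (fun ij : 'I_m * 'I_n =>
       sigma_of (@measurable _ R) (fun w => Z w ij.1 ij.2)) /\
  forall i j i' j', same_law P (@measurable _ R)
    (fun w => Z w i j) (fun w => Z w i' j').

Definition has_mean d (T : measurableType d) (R : realType)
    (P : probability T R) k (x : T -> 'cV[R]_k) (mu : 'cV[R]_k) : Prop :=
  forall i, ('E_P[fun w => x w i 0%R])%E = (mu i 0)%:E.

Definition sub_gaussian d (T : measurableType d) (R : realType)
    (P : probability T R) k (x : T -> 'cV[R]_k) (mu : 'cV[R]_k) (tau : R) : Prop :=
  has_mean P x mu /\
  forall (v : 'cV[R]_k) (t : R), frob v = 1 ->
    ('E_P[fun w => expR (t * (v^T *m (x w - mu)) 0 0)%R]
       <= (expR (t ^+ 2 * tau ^+ 2 / 2))%:E)%E.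

(* X_n = O_P(b_n), for measurable X n. *)
Definition bigOP d (T : measurableType d) (R : realType)
    (P : probability T R) (X : nat -> T -> R) (b : nat -> R) : Prop :=
  forall eta : R, 0 < eta -> exists M : R, \forall n \near \oo,
    (P [set w | (M * b n < `|X n w|)%R] <= eta%:E)%E.

(* Main.v *)
(**
Write [u_l = X_l^T y_l / sqrt p].  The gradient of the quadratic loss at [Omega]
is, up to a factor, the matrix [score = L^-1 sum_l (u_l u_l^T - E u_l u_l^T)].
Comparing the objective at the minimizer and at [Omega] and using the restricted
eigenvalue condition, as soon as all entries of [score] are at most [lambda / 4]
the error is at most [2 lambda sqrt (p + s) / kappa0]: the [l1] norm of the error
on the diagonal and on the support costs [sqrt (p + s)] times its Frobenius norm.

For a fixed design, [u_l] has sub-Gaussian coordinates, with variance proxies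
controlled by [p^-1 |X_l e_a|^2] and [p^-2 |X_l^T X_l e_a|^2].  Products of two
coordinates are therefore sub-exponential, and a Chernoff bound with exponent
proportional to [sqrt (log p / L)] followed by a union bound over the [p^2]
entries bounds the score by a multiple of [sqrt (log p / L)] with probability at
least [1 - 2 / p], provided the squared variance proxies have bounded average over
[l] and no single proxy is too large.

The event [D n] says that the designs have this property.  It is obtained from
moments of order at most eight of the entries of [Z_l]: writing [z_k] for the rows
of [Z_l] and [b_k] for the linear form [z_k . a], the vector
[Z_l^T Z_l a = sum_k b_k z_k] is, after centering, a martingale, and the fourth
moment of the off-diagonal part of its squared norm is bounded recursively by
conditioning on the past.
*)

From HB Require Import structures.
From mathcomp Require Import measurable_realfun ring lra.
Require Import Defs.

Set Implicit Arguments.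
Unset Strict Implicit.
Unset Printing Implicit Defensive.

Local Open Scope classical_set_scope.
Local Open Scope ring_scope.

(** * Independent sigma-algebras *)

(** Nothing bounds [L] in terms of [p], so among many designs some may be atypical, and moment
    bounds on the entries of [Z] need not give proxies bounded uniformly in [l]. The design event
    therefore combines a bound on averages over [l] with a weak individual one, squared proxies of
    order [1 + L / sqrt p]. This is enough because the Chernoff parameter is a multiple of
    [sqrt (ln p / L)]: the product [(ln p / L) * (1 + L / sqrt p)] is bounded, the first term by
    [ln p <= K L] and the second by [ln p <= 2 sqrt p], so every summand stays in the range where
    sub-exponential generating functions are controlled.

    Conditioning is carried out by Fubini: for independent sigma-algebras, the diagonal map into the
    product of the two measurable spaces has a product law, so the past can be frozen while the
    present is integrated. Moments of sums are bounded by adding one variable at a time, with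
    polynomial inequalities that keep the term linear in the new variable exactly, since its
    expectation vanishes. *)

Definition independent_sys d (T : measurableType d) (R : realType)
    (P : probability T R) (G H : set_system T) : Prop :=
  forall C D, G C -> H D -> P (C `&` D) = (P C * P D)%E.

Section independent_sys.
Context d (T : measurableType d) (R : realType) (P : probability T R).

Lemma independent_sysC G H : independent_sys P G H -> independent_sys P H G.
Proof. by move=> GH C D HC GD; rewrite setIC GH// muleC. Qed.

(** Dynkin's argument: for fixed [D] in [H], the measurable sets obeying the product rule with [D]
    form a Dynkin system, and [G] is stable under intersection. *)
Lemma independent_sys_sigmal G H : setI_closed G -> G `<=` measurable ->
  H `<=` measurable -> independent_sys P G H -> independent_sys P <<s G >> H.
Proof.
move=> GI Gm Hm GH C D GC HD; have mD := Hm _ HD.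
have sub : <<s G >> `<=` [set C | measurable C /\ P (C `&` D) = (P C * P D)%E].
  rewrite -setI_closed_g_dynkin_g_sigma_algebra//; apply: smallest_sub.
    split => /=.
    - by split => //; rewrite setTI probability_setT mul1e.
    - move=> E [mE ED]; split; first exact: measurableC.
      rewrite setIC -setDE measureD//; last first.
        exact: (le_lt_trans (probability_le1 P mD) (ltry _)).
      rewrite (setIC D E) [X in (_ - X)%E]ED [in RHS]probability_setC// muleBl ?mul1e//.
      by rewrite fin_num_measure.
    - move=> E tE EP; have mE i : measurable (E i) by have [] := EP i.
      split; first exact: bigcupT_measurable.
      rewrite setI_bigcupl !measure_bigcup//; last 2 first.
      + by move=> i _; exact: measurableI.
      + by apply/trivIset_setIr.
      rewrite muleC -(fineK (fin_num_measure P _ mD)) -nneseriesZl//.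
      apply: eq_eseriesr => i _.
      by rewrite muleC fineK ?fin_num_measure//; exact: (EP i).2.
  by move=> B GB; split; [exact: Gm | exact: GH].
by have [] := sub _ GC.
Qed.

Lemma sigma_sub_measurable (G : set_system T) :
  G `<=` measurable -> <<s G >> `<=` measurable.
Proof. by move=> Gm; apply: smallest_sub => //; exact: sigma_algebra_measurable. Qed.

Lemma independent_sys_sigma G H : setI_closed G -> setI_closed H ->
  G `<=` measurable -> H `<=` measurable ->
  independent_sys P G H -> independent_sys P <<s G >> <<s H >>.
Proof.
move=> GI HI Gm Hm GH; apply: independent_sys_sigmal => //.
  exact: sigma_sub_measurable.
by apply/independent_sysC/independent_sys_sigmal => //; exact: independent_sysC.
Qed.

End independent_sys.

(** * Disjoint blocks of a mutually independent family *)

Section blocks.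
Context d (T : measurableType d) (R : realType) (P : probability T R).
Variables (I : finType) (F : I -> set_system T).

Definition generators (A : {set I}) : set_system T :=
  [set C | exists2 i, i \in A & F i C].

Hypothesis FT : forall i, F i setT.
Hypothesis FI : forall i, setI_closed (F i).
Hypothesis Fm : forall i, F i `<=` measurable.
Hypothesis Find : mutually_independent P F.

Lemma generators_measurable A : generators A `<=` measurable.
Proof. by move=> C [i _]; exact: Fm. Qed.

(** A union of sigma-algebras is not stable under intersection. The boxes are, they contain
    [generators A], and the factor [setT] outside [A] makes them depend on the block only. *)
Let boxes (A : {set I}) : set_system T :=
  [set C | exists2 c : I -> set T,
     forall i, F i (c i) /\ (i \notin A -> c i = setT) & C = \bigcap_i c i].

Let boxesI A : setI_closed (boxes A).
Proof.
move=> _ _ [c cP ->] [e eP ->]; exists (fun i => c i `&` e i).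
  move=> i; split; first by apply: FI; [have [] := cP i | have [] := eP i].
  by move=> iA; rewrite (cP i).2// (eP i).2// setIT.
by rewrite -bigcapI.
Qed.

Let generators_boxes A : generators A `<=` boxes A.
Proof.
move=> C [i iA FC]; exists (fun j => if j == i then C else setT).
  by move=> j; case: eqP => [->|_]; split => //; rewrite iA.
rewrite predeqE => w; split=> [Cw j _|/(_ i Logic.I)]; first by case: eqP.
by rewrite eqxx.
Qed.

Let boxes_measurable A : boxes A `<=` measurable.
Proof.
move=> _ [c cP ->]; apply: fin_bigcap_measurable; first exact: finite_finset.
by move=> i _; apply: (@Fm i); have [] := cP i.
Qed.

(** A box over [A] meets a box over [B] in a box whose factors come from one of the two on each
    index, so the product rule over all of [I] splits. *)
Let boxes_independent (A B : {set I}) : (forall i, i \in A -> i \notin B) ->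
  independent_sys P (boxes A) (boxes B).
Proof.
move=> AB _ _ [c cP ->] [e eP ->]; rewrite -bigcapI !Find; last 3 first.
- by move=> i; have [] := eP i.
- by move=> i; have [] := cP i.
- by move=> i; apply: FI; [have [] := cP i | have [] := eP i].
rewrite -EFinM -big_split/=; congr EFin; apply: eq_bigr => i _.
have [iA|iA] := boolP (i \in A).
  have iB := AB i iA.
  by rewrite (eP i).2// setIT probability_setT mulr1.
by rewrite (cP i).2// setTI probability_setT mul1r.
Qed.

Lemma independent_generators (A B : {set I}) : (forall i, i \in A -> i \notin B) ->
  independent_sys P <<s generators A >> <<s generators B >>.
Proof.
move=> AB C D AC BD.
apply: (independent_sys_sigma (@boxesI A) (@boxesI B)) => //.
- exact: boxes_independent.
- by apply: sub_smallest2r AC; [exact: smallest_sigma_algebra | exact: generators_boxes].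
- by apply: sub_smallest2r BD; [exact: smallest_sigma_algebra | exact: generators_boxes].
Qed.

End blocks.

(** * Fubini for independent sigma-algebras *)

Section decoupling.
Context d (T : measurableType d) (R : realType) (P : probability T R).
Variables G H : set_system T.
Hypothesis Gm : G `<=` measurable.
Hypothesis Hm : H `<=` measurable.
Hypothesis GH : independent_sys P <<s G >> <<s H >>.

Local Notation TG := (g_sigma_algebraType G).
Local Notation TH := (g_sigma_algebraType H).

Lemma measurable_id_sigma (K : set_system T) : K `<=` measurable ->
  measurable_fun setT (fun w : T => w : g_sigma_algebraType K).
Proof. by move=> Km _ B KB; rewrite setTI; exact: sigma_sub_measurable KB. Qed.

Local Open Scope ereal_scope.

Lemma measurable_inner_integral (f : (TG * TH)%type -> \bar R) :
  measurable_fun setT f -> (forall x, 0 <= f x) ->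
  measurable_fun setT (fun w : T => \int[P]_w' f (w, w')).
Proof.
move=> mf f0.
have mG := measurable_id_sigma Gm; have mH := measurable_id_sigma Hm.
pose XH : {mfun T >-> TH} := HB.pack (fun w : T => w : TH) (isMeasurableFun.Build _ _ _ _ _ mH).
pose PH := distribution P XH.
have mF := @measurable_fun_fubini_tonelli_F _ _ TG TH R PH f mf f0.
rewrite [X in measurable_fun _ X](_ : _ = (fun w : T => fubini_F PH f (w : TG))).
  exact: (measurableT_comp mF mG).
apply/funext => w; rewrite /fubini_F ge0_integral_distribution//=.
exact: measurableT_comp.
Qed.

(** The diagonal map pulls a rectangle back to the intersection of its sides, so independence says
    that its law is the product law. Tonelli then separates the two copies of [w]; this plays the
    part of conditioning on [G]. *)
Lemma decoupling (f : (TG * TH)%type -> \bar R) : measurable_fun setT f ->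
  (forall x, 0 <= f x) ->
  \int[P]_w f (w, w) = \int[P]_w \int[P]_w' f (w, w').
Proof.
move=> mf f0.
have mG := measurable_id_sigma Gm; have mH := measurable_id_sigma Hm.
pose XG : {mfun T >-> TG} := HB.pack (fun w : T => w : TG) (isMeasurableFun.Build _ _ _ _ _ mG).
pose XH : {mfun T >-> TH} := HB.pack (fun w : T => w : TH) (isMeasurableFun.Build _ _ _ _ _ mH).
have mD : measurable_fun setT (fun w : T => (w, w) : TG * TH).
  by apply: measurable_fun_pair.
pose XD : {mfun T >-> (TG * TH)%type} := HB.pack (fun w : T => (w, w) : TG * TH) (isMeasurableFun.Build _ _ _ _ _ mD).
pose PG := distribution P XG.
pose PH := distribution P XH.
pose PD := distribution P XD.
have E : forall X : set (TG * TH), measurable X -> (PG \x PH) X = PD X.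
  by apply: product_measure_unique => A B mA mB; exact: GH.
transitivity (\int[PD]_x f x).
  by rewrite ge0_integral_distribution.
transitivity (\int[PG \x PH]_x f x).
  by apply: eq_measure_integral => A mA _; exact: (esym (E _ mA)).
rewrite fubini_tonelli1//.
rewrite ge0_integral_distribution//=; last 2 first.
- exact: measurable_fun_fubini_tonelli_F.
- by move=> x; apply: integral_ge0.
apply: eq_integral => w _ /=; rewrite /fubini_F.
rewrite ge0_integral_distribution//=.
exact: measurableT_comp.
Qed.

End decoupling.

(** * Real-valued expectation *)

Section expectation.
Context d (T : measurableType d) (R : realType) (P : probability T R).
Implicit Types (f g h : T -> R) (c : R).

Definition summable_rv f : Prop := P.-integrable setT (EFin \o f).

(** The real-valued integral carries information only for integrable [f], so moment bounds below are
    stated together with [summable_rv]. *)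
Definition Ex f : R := \int[P]_w f w.

Lemma summable_meas f : summable_rv f -> measurable_fun setT f.
Proof. by move=> /integrableP[/measurable_EFinP]. Qed.

Lemma summable_ext f g : f =1 g -> summable_rv f -> summable_rv g.
Proof. by move=> /funext ->. Qed.

Lemma summable_cst c : summable_rv (fun=> c).
Proof. exact: finite_measure_integrable_cst. Qed.

Lemma summableD f g : summable_rv f -> summable_rv g ->
  summable_rv (fun w => f w + g w).
Proof. exact: integrableD. Qed.

Lemma summableZ c f : summable_rv f -> summable_rv (fun w => c * f w).
Proof. exact: integrableZl. Qed.

Lemma summableN f : summable_rv f -> summable_rv (fun w => - f w).
Proof. by move=> /(summableZ (-1)); apply: summable_ext => w; rewrite mulN1r. Qed.

Lemma summableB f g : summable_rv f -> summable_rv g ->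
  summable_rv (fun w => f w - g w).
Proof. by move=> sf sg; apply: summableD => //; exact: summableN. Qed.

Lemma summable_sum (I : Type) (r : seq I) (Q : pred I) (F : I -> T -> R) :
  (forall i, Q i -> summable_rv (F i)) ->
  summable_rv (fun w => \sum_(i <- r | Q i) F i w).
Proof.
move=> sF; elim: r => [|i r ih].
  by apply: summable_ext (summable_cst 0) => w; rewrite big_nil.
have [Qi|Qi] := boolP (Q i).
  apply: summable_ext (summableD (sF _ Qi) ih) => w.
  by rewrite big_cons Qi.
by apply: summable_ext ih => w; rewrite big_cons (negbTE Qi).
Qed.

Lemma summable_le g f : measurable_fun setT f -> (forall w, `|f w| <= g w) ->
  summable_rv g -> summable_rv f.
Proof.
move=> mf fg; apply: le_integrable => //; first exact/measurable_EFinP.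
by move=> w _; rewrite /= lee_fin (le_trans (fg w))// ler_norm.
Qed.

Lemma summable_norm f : summable_rv f -> summable_rv (fun w => `|f w|).
Proof. exact: integrable_norm. Qed.

Lemma ExE f : summable_rv f -> (\int[P]_w (f w)%:E)%E = (Ex f)%:E.
Proof. by move=> sf; rewrite fineK//; exact: integrable_fin_num. Qed.

Lemma Ex_ext f g : f =1 g -> Ex f = Ex g.
Proof. by move=> /funext ->. Qed.

Lemma Ex_ge0 f : (forall w, 0 <= f w) -> 0 <= Ex f.
Proof. by move=> f0; exact: Rintegral_ge0. Qed.

Lemma Ex_le f g : summable_rv f -> summable_rv g -> (forall w, f w <= g w) ->
  Ex f <= Ex g.
Proof. by move=> sf sg fg; exact: le_Rintegral. Qed.

Lemma ExD f g : summable_rv f -> summable_rv g ->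
  Ex (fun w => f w + g w) = Ex f + Ex g.
Proof. exact: RintegralD. Qed.

Lemma ExB f g : summable_rv f -> summable_rv g ->
  Ex (fun w => f w - g w) = Ex f - Ex g.
Proof. exact: RintegralB. Qed.

Lemma ExZ c f : summable_rv f -> Ex (fun w => c * f w) = c * Ex f.
Proof. exact: RintegralZl. Qed.

Lemma Ex_cst c : Ex (fun=> c) = c.
Proof. by rewrite /Ex Rintegral_cst// [X in fine X](_ : _ = 1%E) ?mulr1//; exact: probability_setT. Qed.

Lemma Ex_sum (I : Type) (r : seq I) (Q : pred I) (F : I -> T -> R) :
  (forall i, Q i -> summable_rv (F i)) ->
  Ex (fun w => \sum_(i <- r | Q i) F i w) = \sum_(i <- r | Q i) Ex (F i).
Proof.
move=> sF; elim: r => [|i r ih].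
  by rewrite big_nil -[RHS](Ex_cst 0); apply: Ex_ext => w; rewrite big_nil.
rewrite big_cons; have [Qi|Qi] := boolP (Q i).
  rewrite -ih -ExD; [|exact: sF|exact: summable_sum].
  by apply: Ex_ext => w; rewrite big_cons Qi.
by rewrite -ih; apply: Ex_ext => w; rewrite big_cons (negbTE Qi).
Qed.

Lemma Ex_norm f : summable_rv f -> `|Ex f| <= Ex (fun w => `|f w|).
Proof. by move=> sf; exact: le_normr_Rintegral. Qed.

Lemma ge0_summable f c : measurable_fun setT f -> (forall w, 0 <= f w) ->
  (\int[P]_w (f w)%:E <= c%:E)%E -> summable_rv f /\ Ex f <= c.
Proof.
move=> mf f0 fc.
have sf : summable_rv f.
  apply/integrableP; split; first exact/measurable_EFinP.
  apply: le_lt_trans (ltry c).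
  by under eq_integral do rewrite /= ger0_norm//.
by split => //; rewrite -lee_fin -ExE.
Qed.

(** Expectation of the tangent-line inequality [2 m f - m ^ 2 <= f ^ 2] at the mean [m]. *)
Lemma Ex_sqr_le f : summable_rv f -> summable_rv (fun w => f w ^+ 2) ->
  Ex f ^+ 2 <= Ex (fun w => f w ^+ 2).
Proof.
move=> sf sf2; set m := Ex f.
have s2 : summable_rv (fun w => 2 * m * f w - m ^+ 2).
  by apply: summableB; [exact: summableZ | exact: summable_cst].
have -> : m ^+ 2 = Ex (fun w => 2 * m * f w - m ^+ 2).
  rewrite ExB; [|exact: summableZ|exact: summable_cst].
  by rewrite ExZ// Ex_cst -/m; ring.
by apply: Ex_le => // w; have := sqr_ge0 (f w - m); lra.
Qed.

End expectation.

Section sub_sigma.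
Context d (T : measurableType d) (R : realType).
Implicit Types (G : set_system T) (f g : T -> R).

(* Wrapped in a record because [g_sigma_algebraType G] is convertible to [T], so
   that unification would lose track of [G] in a bare measurability statement. *)
Record meas_wrt G f : Prop := MeasWrt {
  meas_wrtP : measurable_fun (setT : set (g_sigma_algebraType G)) f }.

Lemma meas_wrt_meas G f : G `<=` measurable -> meas_wrt G f ->
  measurable_fun setT f.
Proof.
by move=> Gm [mf]; apply: (measurableT_comp mf); exact: measurable_id_sigma.
Qed.

Lemma meas_wrt_sub G H f : G `<=` <<s H >> -> meas_wrt G f -> meas_wrt H f.
Proof.
move=> GH [mf]; split=> _ B mB; apply: (smallest_sub _ GH); last exact: mf.
exact: smallest_sigma_algebra.
Qed.

Lemma meas_wrt_ext G f g : f =1 g -> meas_wrt G f -> meas_wrt G g.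
Proof. by move=> /funext ->. Qed.

Lemma meas_wrt_cst G (c : R) : meas_wrt G (fun=> c).
Proof. by split; exact: measurable_cst. Qed.

Lemma meas_wrtD G f g : meas_wrt G f -> meas_wrt G g ->
  meas_wrt G (fun w => f w + g w).
Proof. by move=> [mf] [mg]; split; exact: measurable_funD. Qed.

Lemma meas_wrtB G f g : meas_wrt G f -> meas_wrt G g ->
  meas_wrt G (fun w => f w - g w).
Proof. by move=> [mf] [mg]; split; exact: measurable_funB. Qed.

Lemma meas_wrtM G f g : meas_wrt G f -> meas_wrt G g ->
  meas_wrt G (fun w => f w * g w).
Proof. by move=> [mf] [mg]; split; exact: measurable_funM. Qed.

Lemma meas_wrtX G f n : meas_wrt G f -> meas_wrt G (fun w => f w ^+ n).
Proof. by move=> [mf]; split; exact: measurable_funX. Qed.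

Lemma meas_wrt_comp G f (phi : R -> R) : measurable_fun setT phi ->
  meas_wrt G f -> meas_wrt G (fun w => phi (f w)).
Proof. by move=> mphi [mf]; split; exact: (measurableT_comp mphi mf). Qed.

Lemma meas_wrt_sum G (I : Type) (r : seq I) (Q : pred I) (F : I -> T -> R) :
  (forall i, Q i -> meas_wrt G (F i)) ->
  meas_wrt G (fun w => \sum_(i <- r | Q i) F i w).
Proof.
move=> sF; elim: r => [|i r ih].
  by apply: meas_wrt_ext (meas_wrt_cst G 0) => w; rewrite big_nil.
have [Qi|Qi] := boolP (Q i).
  by apply: meas_wrt_ext (meas_wrtD (sF _ Qi) ih) => w; rewrite big_cons Qi.
by apply: meas_wrt_ext ih => w; rewrite big_cons (negbTE Qi).
Qed.

End sub_sigma.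

(** * Expectations of functions of two independent sigma-algebras *)

Section independence.
Context d (T : measurableType d) (R : realType) (P : probability T R).
Variables G H : set_system T.
Hypothesis Gm : G `<=` measurable.
Hypothesis Hm : H `<=` measurable.
Hypothesis GH : independent_sys P <<s G >> <<s H >>.
Implicit Types f g : T -> R.
Local Notation TG := (g_sigma_algebraType G).
Local Notation TH := (g_sigma_algebraType H).

Lemma meas_wrt_fst f : meas_wrt G f ->
  measurable_fun (setT : set (TG * TH)) (fun x => f x.1).
Proof. by move=> [mf]; exact: (measurableT_comp mf (@measurable_fst _ _ TG TH)). Qed.

Lemma meas_wrt_snd g : meas_wrt H g ->
  measurable_fun (setT : set (TG * TH)) (fun x => g x.2).
Proof. by move=> [mf]; exact: (measurableT_comp mf (@measurable_snd _ _ TG TH)). Qed.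

(** The bound by [b w], with the first argument frozen at [w], is a conditional bound given [G];
    [decoupling] integrates it. *)
Lemma Ex_cond_le (F : TG * TH -> R) (b : T -> R) :
  measurable_fun setT F -> (forall x, 0 <= F x) ->
  (forall w, (\int[P]_w' (F (w, w'))%:E <= (b w)%:E)%E) -> summable_rv P b ->
  summable_rv P (fun w => F (w, w)) /\ Ex P (fun w => F (w, w)) <= Ex P b.
Proof.
move=> mF F0 Fb sb.
have mG := measurable_id_sigma Gm; have mH := measurable_id_sigma Hm.
have b0 w : 0 <= b w.
  by rewrite -lee_fin (le_trans _ (Fb w))// integral_ge0// => w' _; rewrite lee_fin.
apply: ge0_summable.
- apply: (measurableT_comp mF); exact: measurable_fun_pair.
- by move=> w; exact: F0.
rewrite (@decoupling _ _ _ _ _ _ Gm Hm GH (fun x => (F x)%:E)); last 2 first.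
- by apply/measurable_EFinP.
- by move=> x; rewrite lee_fin.
rewrite -ExE//; apply: ge0_le_integral => //.
- by move=> w _; apply: integral_ge0 => w' _; rewrite lee_fin.
- apply: (@measurable_inner_integral _ _ _ _ G H Gm Hm (fun x => (F x)%:E)).
    exact/measurable_EFinP.
  by move=> x; rewrite lee_fin.
- exact/measurable_EFinP/(summable_meas sb).
Qed.

Lemma ge0_ExM f g : meas_wrt G f -> meas_wrt H g ->
  (forall w, 0 <= f w) -> (forall w, 0 <= g w) ->
  summable_rv P f -> summable_rv P g ->
  summable_rv P (fun w => f w * g w) /\ Ex P (fun w => f w * g w) = Ex P f * Ex P g.
Proof.
move=> mf mg f0 g0 sf sg.
have E : (\int[P]_w (f w * g w)%:E = (Ex P f * Ex P g)%:E)%E.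
  rewrite (@decoupling _ _ _ _ _ _ Gm Hm GH (fun x => (f x.1 * g x.2)%:E))/=; last 2 first.
  - by apply/measurable_EFinP/measurable_funM; [exact: meas_wrt_fst|exact: meas_wrt_snd].
  - by move=> x; rewrite lee_fin mulr_ge0.
  under eq_integral => w _.
    under eq_integral do rewrite EFinM.
    rewrite ge0_integralZl_EFin//; last 2 first.
    - by move=> x _; rewrite lee_fin.
    - exact/measurable_EFinP/(summable_meas sg).
    rewrite ExE// muleC.
  over.
  rewrite /= ge0_integralZl_EFin//; last 3 first.
  - by move=> x _; rewrite lee_fin.
  - exact/measurable_EFinP/(summable_meas sf).
  - exact: Ex_ge0.
  by rewrite ExE// -EFinM mulrC.
have [|||s le] := @ge0_summable _ _ _ P (fun w => f w * g w) (Ex P f * Ex P g).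
- by apply: measurable_funM; [exact: (summable_meas sf)|exact: (summable_meas sg)].
- by move=> w; rewrite mulr_ge0.
- by rewrite E.
by split => //; apply: EFin_inj; rewrite -E ExE.
Qed.

Lemma ExM_indep f g : meas_wrt G f -> meas_wrt H g ->
  summable_rv P f -> summable_rv P g ->
  summable_rv P (fun w => f w * g w) /\ Ex P (fun w => f w * g w) = Ex P f * Ex P g.
Proof.
move=> mf mg sf sg.
(* Positive and negative parts are Borel functions of [f] and [g], so they keep the measurability
   with respect to [G] and [H]. *)
pose fp w := Num.max (f w) 0; pose fn w := Num.max (- f w) 0.
pose gp w := Num.max (g w) 0; pose gn w := Num.max (- g w) 0.
have fE w : f w = fp w - fn w.
  by rewrite /fp /fn; case: (leP (f w)); case: (leP (- f w)); lra.
have gE w : g w = gp w - gn w.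
  by rewrite /gp /gn; case: (leP (g w)); case: (leP (- g w)); lra.
have mp : measurable_fun setT (fun x : R => Num.max x 0).
  by apply: measurable_maxr => //; exact: measurable_id.
have mn : measurable_fun setT (fun x : R => Num.max (- x) 0).
  by apply: measurable_maxr => //; exact: measurable_funN.
have mfp := meas_wrt_comp mp mf; have mfn := meas_wrt_comp mn mf.
have mgp := meas_wrt_comp mp mg; have mgn := meas_wrt_comp mn mg.
have ge w (h : T -> R) : 0 <= Num.max (h w) 0 by rewrite le_max lexx orbT.
have sp h : summable_rv P h -> summable_rv P (fun w => Num.max (h w) 0).
  move=> sh; apply: summable_le (summable_norm sh).
    exact: (measurableT_comp mp (summable_meas sh)).
  by move=> w /=; rewrite ger0_norm// ge_max ler_norm normr_ge0.
have sfp := sp _ sf; have sfn := sp _ (summableN sf).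
have sgp := sp _ sg; have sgn := sp _ (summableN sg).
have [s1 e1] := ge0_ExM mfp mgp (ge^~ f) (ge^~ g) sfp sgp.
have [s2 e2] := ge0_ExM mfp mgn (ge^~ f) (ge^~ (fun w => - g w)) sfp sgn.
have [s3 e3] := ge0_ExM mfn mgp (ge^~ (fun w => - f w)) (ge^~ g) sfn sgp.
have [s4 e4] := ge0_ExM mfn mgn (ge^~ (fun w => - f w)) (ge^~ (fun w => - g w)) sfn sgn.
have E : (fun w => f w * g w) =1 (fun w => (fp w * gp w - fp w * gn w) - (fn w * gp w - fn w * gn w)).
  by move=> w; rewrite fE gE; ring.
have Ef : Ex P f = Ex P fp - Ex P fn by rewrite -ExB//; exact: Ex_ext.
have Eg : Ex P g = Ex P gp - Ex P gn by rewrite -ExB//; exact: Ex_ext.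
split; first by apply: (summable_ext (fun w => esym (E w))); apply: summableB; apply: summableB.
rewrite (Ex_ext _ E) ExB; [|exact: summableB|exact: summableB].
by rewrite !ExB// e1 e2 e3 e4 Ef Eg; ring.
Qed.

End independence.

(** * Moments of sums of independent variables *)

Section power_inequalities.
Context (R : realType).
Implicit Types x y a b t D : R.

Lemma sqr_pow_ge0 x e : 0 <= x ^+ e.*2.
Proof. by rewrite -mul2n exprM exprn_ge0// sqr_ge0. Qed.

Lemma mixed_power_le x y i j e : (i + j = e.*2)%N ->
  `|x ^+ i * y ^+ j| <= x ^+ e.*2 + y ^+ e.*2.
Proof.
move=> ij.
have evn (z : R) : z ^+ e.*2 = `|z| ^+ e.*2.
  by rewrite -normrX ger0_norm// sqr_pow_ge0.
rewrite normrM !normrX (evn x) (evn y).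
have [xy|/ltW yx] := leP `|x| `|y|.
  apply: le_trans (_ : `|y| ^+ e.*2 <= _); last by rewrite lerDr exprn_ge0.
  by rewrite -ij exprD ler_pM// ?exprn_ge0// lerXn2r// nnegrE.
apply: le_trans (_ : `|x| ^+ e.*2 <= _); last by rewrite lerDl exprn_ge0.
by rewrite -ij exprD ler_pM// ?exprn_ge0// lerXn2r// nnegrE.
Qed.

(** The first two binomial terms are kept exact. Each later one contains [y ^ 2] times a monomial of
    degree [2 e], hence is at most its coefficient times [(x ^ (2 e) + y ^ (2 e)) * y ^ 2], and all
    coefficients add up to [2 ^ (2 e + 2)]. *)
Lemma power_sum_le x y e :
  (x + y) ^+ e.*2.+2 <= x ^+ e.*2.+2 + e.*2.+2%:R * (x ^+ e.*2.+1 * y)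
    + 2 ^+ e.*2.+2 * (x ^+ e.*2 * y ^+ 2 + y ^+ e.*2.+2).
Proof.
rewrite exprDn big_ord_recl big_ord_recl /= addrA lerD//.
  rewrite /bump/= !subn0 !expr0 mulr1 bin0 bin1 mulr1n expr1.
  by rewrite subSS subn0 mulr_natl.
have -> : x ^+ e.*2 * y ^+ 2 + y ^+ e.*2.+2 = (x ^+ e.*2 + y ^+ e.*2) * y ^+ 2.
  by rewrite mulrDl -[in RHS]exprD addn2.
set Z := (X in _ * X).
have Z0 : 0 <= Z by rewrite mulr_ge0 ?sqr_ge0// addr_ge0 ?sqr_pow_ge0.
have -> : (2 : R) ^+ e.*2.+2 = (\sum_(i < e.*2.+3) 'C(e.*2.+2, i))%:R.
  have := expnDn 1 1 e.*2.+2; rewrite addn1 => h.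
  rewrite -natrX; congr (_%:R); rewrite h; apply: eq_bigr => i _.
  by rewrite !exp1n !muln1.
rewrite big_ord_recl big_ord_recl natrD natrD natr_sum !mulrDl mulr_suml addrA.
rewrite ler_wpDl//; first by rewrite addr_ge0// mulr_ge0.
apply: ler_sum => i _.
rewrite -mulr_natl ler_wpM2l//.
rewrite /= /bump/= !add1n !subSS -[in y ^+ i.+2]addn2 exprD mulrA ler_wpM2r ?sqr_ge0//.
apply: le_trans (ler_norm _) _; apply: mixed_power_le.
by rewrite subnK// -ltnS.
Qed.

(** Either [t <= D] or [t / D >= 1]. With [D] close to the true size of [t], it lowers the order of
    a moment, as Hoelder's inequality would. *)
Lemma power_young t D e : 0 <= t -> 0 < D -> t ^+ e <= t ^+ e.+1 / D + D ^+ e.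
Proof.
move=> t0 D0; have [tD|Dt] := leP t D.
  rewrite -[leLHS]add0r lerD ?mulr_ge0 ?exprn_ge0 ?invr_ge0 ?(ltW D0)//.
  by rewrite lerXn2r// nnegrE ltW.
rewrite -[leLHS]addr0 lerD ?exprn_ge0 ?(ltW D0)//.
by rewrite exprS mulrC mulrA ler_peMl ?exprn_ge0// mulrC ler_pdivlMr// mul1r ltW.
Qed.

Lemma power_superadditive a b e : 0 <= a -> 0 <= b ->
  a ^+ e.+1 + b ^+ e.+1 <= (a + b) ^+ e.+1.
Proof.
move=> a0 b0; elim: e => [|e ih]; first by rewrite !expr1.
rewrite exprS [b ^+ _]exprS [leRHS]exprS.
apply: le_trans (ler_wpM2l (addr_ge0 a0 b0) ih).
rewrite mulrDl !mulrDr; have := mulr_ge0 a0 (exprn_ge0 e.+1 b0).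
have := mulr_ge0 b0 (exprn_ge0 e.+1 a0); lra.
Qed.

(** The shape needed to close the induction of [prefix_sum_moment]: old bound, cross term and new
    term recombine into a single power. *)
Lemma power_superadditive3 a b e : 0 <= a -> 0 <= b ->
  a ^+ e.+2 + b * a ^+ e.+1 + b ^+ e.+2 <= (a + b) ^+ e.+2.
Proof.
move=> a0 b0; rewrite [leRHS]exprS.
apply: le_trans (ler_wpM2l (addr_ge0 a0 b0) (power_superadditive e a0 b0)).
rewrite [a ^+ e.+2]exprS [b ^+ e.+2]exprS mulrDl !mulrDr.
have := mulr_ge0 a0 (exprn_ge0 e.+1 b0); lra.
Qed.

Lemma normX_le_1D x i e : (i <= e.*2)%N -> `|x ^+ i| <= 1 + x ^+ e.*2.
Proof.
move=> ie; have := @mixed_power_le x 1 i (e.*2 - i) e (subnKC ie).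
by rewrite !expr1n mulr1 addrC.
Qed.

End power_inequalities.

Section moments.
Context d (T : measurableType d) (R : realType) (P : probability T R).

Lemma summable_lower_power (f : T -> R) i e : (i <= e.*2)%N ->
  measurable_fun setT f -> summable_rv P (fun w => f w ^+ e.*2) ->
  summable_rv P (fun w => f w ^+ i).
Proof.
move=> ie mf sf.
apply: (@summable_le _ _ _ _ (fun w => 1 + f w ^+ e.*2)).
- exact: measurable_funX.
- by move=> w; exact: normX_le_1D.
- by apply: summableD => //; exact: summable_cst.
Qed.

Lemma Ex_lower_power (f : T -> R) i e : (i <= e.*2)%N ->
  measurable_fun setT f -> summable_rv P (fun w => f w ^+ e.*2) ->
  Ex P (fun w => f w ^+ i) <= 1 + Ex P (fun w => f w ^+ e.*2).
Proof.
move=> ie mf sf.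
rewrite -[X in X + _](Ex_cst P) -ExD//; last exact: summable_cst.
apply: Ex_le.
- exact: summable_lower_power sf.
- by apply: summableD => //; exact: summable_cst.
- by move=> w; apply: le_trans (ler_norm _) _; exact: normX_le_1D.
Qed.

Lemma summable_mixed_power (f g : T -> R) i j e : (i + j = e.*2)%N ->
  measurable_fun setT f -> measurable_fun setT g ->
  summable_rv P (fun w => f w ^+ e.*2) -> summable_rv P (fun w => g w ^+ e.*2) ->
  summable_rv P (fun w => f w ^+ i * g w ^+ j).
Proof.
move=> ij mf mg sf sg.
apply: (@summable_le _ _ _ _ (fun w => f w ^+ e.*2 + g w ^+ e.*2)).
- by apply: measurable_funM; exact: measurable_funX.
- by move=> w; exact: mixed_power_le.
- exact: summableD.
Qed.

(** In [power_sum_le] the term linear in [x] has expectation zero, by independence and centering. *)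
Lemma Ex_power_step G H (M x : T -> R) e :
  G `<=` measurable -> H `<=` measurable -> independent_sys P <<s G >> <<s H >> ->
  meas_wrt G M -> meas_wrt H x ->
  summable_rv P (fun w => M w ^+ e.*2.+2) ->
  summable_rv P (fun w => x w ^+ e.*2.+2) -> Ex P x = 0 ->
  summable_rv P (fun w => (M w + x w) ^+ e.*2.+2) /\
  Ex P (fun w => (M w + x w) ^+ e.*2.+2) <=
    Ex P (fun w => M w ^+ e.*2.+2) + 2 ^+ e.*2.+2 *
     (Ex P (fun w => M w ^+ e.*2) * Ex P (fun w => x w ^+ 2)
       + Ex P (fun w => x w ^+ e.*2.+2)).
Proof.
move=> Gm Hm GH mM mx sM sx x0.
have mM' := meas_wrt_meas Gm mM; have mx' := meas_wrt_meas Hm mx.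
have sx1 : summable_rv P x.
  by apply: summable_ext (@summable_lower_power x 1 e.+1 _ mx' sx).
have sx2 : summable_rv P (fun w => x w ^+ 2).
  exact: (@summable_lower_power x 2 e.+1).
have sM1 : summable_rv P (fun w => M w ^+ e.*2.+1).
  by apply: (@summable_lower_power M _ e.+1) => //; rewrite doubleS.
have sM2 : summable_rv P (fun w => M w ^+ e.*2).
  by apply: (@summable_lower_power M _ e.+1) => //; rewrite doubleS ltnW.
have [s1 e1] := ExM_indep Gm Hm GH (meas_wrtX _ mM) mx sM1 sx1.
have [s2 e2] := ExM_indep Gm Hm GH (meas_wrtX _ mM) (meas_wrtX _ mx) sM2 sx2.
have s3 : summable_rv P (fun w => M w ^+ e.*2.+2 + e.*2.+2%:R * (M w ^+ e.*2.+1 * x w)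
    + 2 ^+ e.*2.+2 * (M w ^+ e.*2 * x w ^+ 2 + x w ^+ e.*2.+2)).
  apply: summableD; last by apply: summableZ; exact: summableD.
  by apply: summableD => //; exact: summableZ.
have s4 : summable_rv P (fun w => (M w + x w) ^+ e.*2.+2).
  apply: summable_le s3; first by apply: measurable_funX; exact: measurable_funD.
  move=> w; rewrite ger0_norm; first exact: power_sum_le.
  by rewrite -doubleS sqr_pow_ge0.
split => //.
apply: le_trans (Ex_le s4 s3 (fun w => power_sum_le _ _ _)) _.
rewrite ExD; last 2 first.
- by apply: summableD => //; exact: summableZ.
- by apply: summableZ; exact: summableD.
rewrite ExD//; last exact: summableZ.
by rewrite !ExZ ?ExD// ?e1 ?e2 ?x0 ?mulr0 ?addr0//; exact: summableD.
Qed.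

(* [G t] generates the past before time [t] and [H t] the present. *)
Record independent_steps (n : nat) (G : nat -> set_system T)
    (H : 'I_n -> set_system T) : Prop := IndependentSteps {
  past_measurable : forall t, G t `<=` measurable;
  present_measurable : forall t, H t `<=` measurable;
  past_present_independent : forall t : 'I_n,
    independent_sys P <<s G t >> <<s H t >>;
  past_past : forall t, G t `<=` <<s G t.+1 >>;
  present_past : forall t, H t `<=` <<s G t.+1 >> }.

Lemma big_ord_prefixS (n : nat) (V : nmodType) (F : 'I_n -> V) (t : 'I_n) :
  \sum_(i < n | (i < t.+1)%N) F i = \sum_(i < n | (i < t)%N) F i + F t.
Proof.
rewrite (bigD1 t)//= addrC; congr (_ + _); apply: eq_bigl => i.
by rewrite ltnS ltn_neqAle andbC -val_eqE.
Qed.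

Lemma big_ord_prefix_full (n : nat) (V : nmodType) (F : 'I_n -> V) :
  \sum_(i < n | (i < n)%N) F i = \sum_i F i.
Proof. by apply: eq_bigl => i; rewrite ltn_ord. Qed.

Lemma prefix_sum_meas n G (H : 'I_n -> set_system T) (x : 'I_n -> T -> R) t :
  independent_steps G H -> (forall i, meas_wrt (H i) (x i)) -> (t <= n)%N ->
  meas_wrt (G t) (fun w => \sum_(i < n | (i < t)%N) x i w).
Proof.
move=> st mx; elim: t => [_|t ih tn].
  by apply: meas_wrt_ext (meas_wrt_cst _ 0) => w; rewrite big_pred0.
apply: (@meas_wrt_ext _ _ _ _
  (fun w => \sum_(i < n | (i < t)%N) x i w + x (Ordinal tn) w)).
  by move=> w; rewrite -(big_ord_prefixS (fun i => x i w) (Ordinal tn)).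
apply: meas_wrtD.
  exact: (meas_wrt_sub (past_past st (t := t)) (ih (ltnW tn))).
exact: meas_wrt_sub (present_past st (t := Ordinal tn)) (mx _).
Qed.

Section sum_moment.
Variables (n : nat) (G : nat -> set_system T) (H : 'I_n -> set_system T).
Hypothesis st : independent_steps G H.
Variables (x : 'I_n -> T -> R) (a : 'I_n -> R) (m : R) (e : nat).
Local Notation q := e.+2.
Hypothesis m0 : 0 <= m.
Hypothesis mx : forall i, meas_wrt (H i) (x i).
Hypothesis sx : forall i, summable_rv P (fun w => x i w ^+ q.*2).
Hypothesis x_mom : forall i, Ex P (fun w => x i w ^+ q.*2) <= m.
Hypothesis x_mean : forall i, Ex P (x i) = 0.

Let S t w := \sum_(i < n | (i < t)%N) a i * x i w.

Let m' := 1 + m.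
(** The power of 2 comes from [power_sum_le], the factor 2 from the lower moment of the partial sum,
    and [m'] dominates both the second and the top moment of each variable. *)
Let B : R := 2 * 2 ^+ q.*2 * m'.

Let m'1 : 1 <= m'. Proof. by rewrite lerDl. Qed.

Let B1 : 1 <= B.
Proof.
have : (1 : R) <= 2 ^+ q.*2 by rewrite exprn_ege1// ler1n.
by rewrite /B; move: (2 ^+ _) m'1 => X; nra.
Qed.

(** The offset [A0] keeps [D] positive, so that [power_young] can divide by it even while the first
    coefficients vanish. *)
Let prefix_sum_moment (A0 : R) t : 0 < A0 -> (t <= n)%N ->
  summable_rv P (fun w => S t w ^+ q.*2) /\
  Ex P (fun w => S t w ^+ q.*2)
    <= (B * (A0 + \sum_(i < n | (i < t)%N) a i ^+ 2)) ^+ q.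
Proof.
move=> A00; elim: t => [_|t ih tn].
  rewrite big_pred0// addr0.
  have E : (fun w => S 0 w ^+ q.*2) = fun=> 0.
    by apply/funext => w; rewrite /S big_pred0// expr0n.
  rewrite E Ex_cst; split; first exact: summable_cst.
  by rewrite exprn_ge0// mulr_ge0 ?(le_trans ler01 B1)// ltW.
have [sS SB] := ih (ltnW tn); pose k := Ordinal tn.
set A := A0 + \sum_(i < n | (i < t)%N) a i ^+ 2 in SB *.
have A1 : 0 < A by rewrite ltr_pwDl// sumr_ge0// => i _; rewrite sqr_ge0.
set D := B * A in SB *; have D0 : 0 < D by rewrite mulr_gt0// (lt_le_trans ltr01).
have E w : S t.+1 w = S t w + a k * x k w.
  by rewrite /S (big_ord_prefixS _ k).
have EA : A0 + \sum_(i < n | (i < t.+1)%N) a i ^+ 2 = A + a k ^+ 2.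
  by rewrite (big_ord_prefixS _ k) addrA.
have mS : meas_wrt (G t) (S t).
  apply: (prefix_sum_meas (x := fun i w => a i * x i w) st) (ltnW tn) => i.
  by apply: meas_wrtM => //; exact: meas_wrt_cst.
have mS' := meas_wrt_meas (past_measurable st (t := t)) mS.
have max : meas_wrt (H k) (fun w => a k * x k w).
  by apply: meas_wrtM; [exact: meas_wrt_cst | exact: mx].
have mxk := meas_wrt_meas (present_measurable st (t := k)) (mx k).
have sax i : (i <= q.*2)%N -> summable_rv P (fun w => (a k * x k w) ^+ i).
  move=> iq; apply: (@summable_ext _ _ _ _ (fun w => a k ^+ i * x k w ^+ i)).
    by move=> w; rewrite exprMn.
  by apply: summableZ; exact: (@summable_lower_power _ _ q).
have Eax i : (i <= q.*2)%N ->
    Ex P (fun w => (a k * x k w) ^+ i) = a k ^+ i * Ex P (fun w => x k w ^+ i).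
  move=> iq; rewrite -ExZ; last exact: (@summable_lower_power _ _ q).
  by apply: Ex_ext => w; rewrite exprMn.
have Eax0 : Ex P (fun w => a k * x k w) = 0.
  by have := @Eax 1%N isT; rewrite !expr1 => ->; rewrite x_mean mulr0.
have [s1 le1] := Ex_power_step (e := e.+1) (past_measurable st (t := t)) (present_measurable st (t := k))
  (past_present_independent st (t := k)) mS max sS (sax _ (leqnn _)) Eax0.
have -> : (fun w => S t.+1 w ^+ q.*2) = (fun w => (S t w + a k * x k w) ^+ q.*2).
  by apply/funext => w; rewrite E.
split => //; apply: le_trans le1 _.
rewrite EA !Eax//.
(* The induction hypothesis bounds the moment of order [2 q] by [D ^ q]; [power_young] at level [D]
   lowers the order by two at the cost of a factor 2. *)
have M2 : Ex P (fun w => S t w ^+ e.+1.*2) <= 2 * D ^+ e.+1.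
  apply: (@le_trans _ _ (Ex P (fun w => D^-1 * S t w ^+ q.*2 + D ^+ e.+1))).
    apply: Ex_le.
    - by apply: (@summable_lower_power _ _ q) => //; rewrite leq_double.
    - by apply: summableD; [exact: summableZ | exact: summable_cst].
    - move=> w; rewrite -!mul2n !exprM mulrC; apply: power_young => //.
      exact: sqr_ge0.
  rewrite ExD; [|exact: summableZ|exact: summable_cst].
  rewrite ExZ// Ex_cst mulrC.
  have : Ex P (fun w => S t w ^+ q.*2) / D <= D ^+ e.+1.
    by rewrite ler_pdivrMr// -exprSr.
  by lra.
have x2 : Ex P (fun w => x k w ^+ 2) <= m'.
  apply: le_trans (@Ex_lower_power _ 2 q _ mxk (sx k)) _ => //.
  by rewrite lerD2l.
have xq : Ex P (fun w => x k w ^+ q.*2) <= m' by apply: le_trans (x_mom k) _; rewrite lerDr.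
have x20 : 0 <= Ex P (fun w => x k w ^+ 2) by apply: Ex_ge0 => w; exact: sqr_ge0.
have S0 : 0 <= Ex P (fun w => S t w ^+ e.+1.*2).
  by apply: Ex_ge0 => w; exact: sqr_pow_ge0.
set c : R := 2 ^+ _.
have c0 : 1 <= c by rewrite exprn_ege1// ler1n.
have BE : B = 2 * c * m' by [].
apply: (@le_trans _ _ (D ^+ q + c * (2 * D ^+ e.+1 * (a k ^+ 2 * m') + a k ^+ q.*2 * m'))).
  apply: lerD => //; apply: ler_wpM2l; first by apply: le_trans c0.
  apply: lerD.
    by apply: ler_pM => //; [rewrite mulr_ge0// sqr_ge0 | rewrite ler_wpM2l// sqr_ge0].
  by apply: ler_wpM2l => //; exact: (sqr_pow_ge0 _ q).
have -> : a k ^+ q.*2 = (a k ^+ 2) ^+ q by rewrite -exprM mul2n.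
have b0 := sqr_ge0 (a k); set b := a k ^+ 2 in b0 *.
have -> : B * (A + b) = D + B * b by rewrite mulrDr.
apply: le_trans (power_superadditive3 e (ltW D0) (mulr_ge0 (le_trans ler01 B1) b0)).
rewrite -addrA lerD2l mulrDr lerD//.
  by rewrite BE le_eqVlt; apply/orP; left; apply/eqP; ring.
rewrite [(B * b) ^+ _]exprMn (_ : c * _ = (c * m') * b ^+ q); last by ring.
apply: ler_wpM2r; first exact: exprn_ge0.
apply: (@le_trans _ _ B); last exact: ler_eXnr.
by rewrite BE; nra.
Qed.

(** A Khinchine-type inequality. Taking for [A0] the sum of squares itself doubles the base [B],
    whence the 4; if that sum is zero, all coefficients vanish. *)
Lemma sum_moment t : (t <= n)%N ->
  summable_rv P (fun w => S t w ^+ q.*2) /\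
  Ex P (fun w => S t w ^+ q.*2) <=
    (4 * 2 ^+ q.*2 * (1 + m)) ^+ q * (\sum_(i < n | (i < t)%N) a i ^+ 2) ^+ q.
Proof.
move=> tn; set A := \sum_(i < n | _) _.
have A0 : 0 <= A by rewrite sumr_ge0// => i _; rewrite sqr_ge0.
have [A_eq0|A_neq0] := eqVneq A 0.
  have E : (fun w => S t w ^+ q.*2) = fun=> 0.
    apply/funext => w; rewrite /S big1 ?expr0n// => i it.
    have /eqP := psumr_eq0P (fun j _ => sqr_ge0 (a j)) A_eq0 it.
    by rewrite sqrf_eq0 => /eqP ->; rewrite mul0r.
  by rewrite E Ex_cst A_eq0 [0 ^+ q]expr0n mulr0; split => //; exact: summable_cst.
have Ap : 0 < A by rewrite lt_neqAle eq_sym A_neq0.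
have [s le] := prefix_sum_moment Ap tn.
split => //; apply: le_trans le _; rewrite -exprMn le_eqVlt; apply/orP; left.
by apply/eqP; congr (_ ^+ _); rewrite /B -/A /m'; ring.
Qed.

End sum_moment.
End moments.

Lemma sqr_sum_cond_le (R : realType) (I : finType) (Q : pred I) (F : I -> R) :
  (\sum_(i | Q i) F i) ^+ 2 <= #|Q|%:R * \sum_(i | Q i) F i ^+ 2.
Proof.
have : 0 <= \sum_(i | Q i) \sum_(j | Q j) (F i - F j) ^+ 2.
  by apply: sumr_ge0 => i _; apply: sumr_ge0 => j _; exact: sqr_ge0.
have -> : \sum_(i | Q i) \sum_(j | Q j) (F i - F j) ^+ 2 =
    #|Q|%:R * \sum_(i | Q i) F i ^+ 2 + #|Q|%:R * \sum_(i | Q i) F i ^+ 2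
    - 2 * (\sum_(i | Q i) F i) ^+ 2.
  transitivity (\sum_(i | Q i)
      (#|Q|%:R * F i ^+ 2 - 2 * (F i * \sum_(j | Q j) F j) + \sum_(j | Q j) F j ^+ 2)).
    apply: eq_bigr => i _.
    transitivity (\sum_(j | Q j) (F i ^+ 2 - 2 * (F i * F j) + F j ^+ 2)).
      by apply: eq_bigr => j _; ring.
    by rewrite big_split/= sumrB sumr_const -mulr_sumr -mulr_sumr -[_ *+ #|_|]mulr_natl.
  rewrite big_split/= sumrB -!mulr_sumr sumr_const -mulr_suml -[_ *+ #|_|]mulr_natl.
  by ring.
by lra.
Qed.

Lemma sqr_sum_le (R : realType) (I : finType) (F : I -> R) :
  (\sum_i F i) ^+ 2 <= #|I|%:R * \sum_i F i ^+ 2.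
Proof. exact: sqr_sum_cond_le. Qed.

(** The slack is [2 x ^ 2 (M - x) ^ 2]: the term in [M x ^ 3] is absorbed by its neighbours, while
    the one in [M ^ 3 x], of mean zero in the application, stays exact. *)
Lemma fourth_power_le (R : realType) (M x : R) :
  (M + x) ^+ 4 <= M ^+ 4 + 4 * (M ^+ 3 * x) + 8 * (M ^+ 2 * x ^+ 2) + 3 * x ^+ 4.
Proof.
have h : 0 <= (x * (M - x)) ^+ 2 by exact: sqr_ge0.
rewrite [leRHS](_ : _ = (M + x) ^+ 4 + 2 * (x * (M - x)) ^+ 2); last by ring.
by rewrite lerDl mulr_ge0.
Qed.

(** * Squared norms of sums of independent vectors *)

Section bilinear.
Context d (T : measurableType d) (R : realType) (P : probability T R).
Variables (n p : nat) (G : nat -> set_system T) (H : 'I_n -> set_system T).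
Hypothesis st : independent_steps P G H.
Variables (xi : 'I_n -> 'I_p -> T -> R) (c : R).
Hypothesis c1 : 1 <= c.
Hypothesis mxi : forall k j, meas_wrt (H k) (xi k j).
Hypothesis xi_mean : forall k j, Ex P (xi k j) = 0.
Hypothesis sxi : forall k (v : 'I_p -> R),
  summable_rv P (fun w => (\sum_j xi k j w * v j) ^+ 4).
Hypothesis xi_mom : forall k (v : 'I_p -> R),
  Ex P (fun w => (\sum_j xi k j w * v j) ^+ 4) <= c * (\sum_j v j ^+ 2) ^+ 2.

Definition partial_sum (t : nat) (j : 'I_p) (w : T) : R :=
  \sum_(k < n | (k < t)%N) xi k j w.

(** [partial_sum k] stops strictly before [k], hence is determined by the past: these are martingale
    increments. *)
Definition increment (k : 'I_n) (w : T) : R :=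
  \sum_j xi k j w * partial_sum k j w.

(* [|S_t|^2 = sum_k |xi_k|^2 + 2 off_diagonal t] for the partial sums [S_t]. *)
Definition off_diagonal (t : nat) (w : T) : R :=
  \sum_(k < n | (k < t)%N) increment k w.

Let N (t : nat) (w : T) : R := \sum_j partial_sum t j w ^+ 2.

(** The constant of [sum_moment] for [e = 0], that is, for fourth moments. *)
Let K : R := (4 * 2 ^+ 4 * (1 + c)) ^+ 2.

Let delta_sum k j w : \sum_i xi k i w * (i == j)%:R = xi k j w.
Proof.
rewrite (bigD1 j)//= eqxx mulr1 big1 ?addr0// => i ij.
by rewrite (negbTE ij) mulr0.
Qed.

Let delta_norm (j : 'I_p) : \sum_i ((i == j)%:R : R) ^+ 2 = 1.
Proof.
rewrite (bigD1 j)//= eqxx expr1n big1 ?addr0// => i ij.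
by rewrite (negbTE ij) expr0n.
Qed.

Let sxi4 k j : summable_rv P (fun w => xi k j w ^+ 4).
Proof.
by apply: summable_ext (@sxi k (fun i => (i == j)%:R)) => w; rewrite delta_sum.
Qed.

Let xi4 k j : Ex P (fun w => xi k j w ^+ 4) <= c.
Proof.
rewrite -[leRHS]mulr1 -[X in c * X](expr1n _ 2) -(delta_norm j).
apply: le_trans (xi_mom k _); rewrite le_eqVlt; apply/orP; left; apply/eqP.
by apply: Ex_ext => w; rewrite delta_sum.
Qed.

Let c0 : 0 <= c. Proof. exact: le_trans c1. Qed.

Let partial_sum_meas t j : (t <= n)%N -> meas_wrt (G t) (partial_sum t j).
Proof. by move=> tn; apply: (prefix_sum_meas st) => // i; exact: mxi. Qed.

Let partial_sum_moment t j : (t <= n)%N ->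
  summable_rv P (fun w => partial_sum t j w ^+ 4) /\
  Ex P (fun w => partial_sum t j w ^+ 4) <= K * n%:R ^+ 2.
Proof.
move=> tn.
have [s le] := sum_moment st (fun=> 1) (e := 0) c0 (fun k => mxi k j)
  (fun k => sxi4 k j) (fun k => xi4 k j) (fun k => xi_mean k j) tn.
have E w : \sum_(i < n | (i < t)%N) 1 * xi i j w = partial_sum t j w.
  by apply: eq_bigr => i _; rewrite mul1r.
split; first by apply: summable_ext s => w; rewrite E.
rewrite (@Ex_ext _ _ _ _ _ (fun w => (\sum_(i < n | (i < t)%N) 1 * xi i j w) ^+ 4)); last first.
  by move=> w; rewrite E.
apply: le_trans le _; rewrite ler_wpM2l ?sqr_ge0//.
have -> : \sum_(i < n | (i < t)%N) (1 : R) ^+ 2 = #|[pred i : 'I_n | (i < t)%N]|%:R.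
  by rewrite -sumr_const; apply: eq_bigr => i _; rewrite expr1n.
by rewrite lerXn2r ?nnegrE ?ler0n// ler_nat -[leqRHS]card_ord max_card.
Qed.

Let N_ge0 t w : 0 <= N t w. Proof. by apply: sumr_ge0 => j _; exact: sqr_ge0. Qed.

Let N_meas t : (t <= n)%N -> meas_wrt (G t) (N t).
Proof.
by move=> tn; apply: meas_wrt_sum => j _; apply: meas_wrtX; exact: partial_sum_meas.
Qed.

Let N_moment t : (t <= n)%N ->
  summable_rv P (fun w => N t w ^+ 2) /\
  Ex P (fun w => N t w ^+ 2) <= p%:R ^+ 2 * (K * n%:R ^+ 2).
Proof.
move=> tn.
have s1 : summable_rv P (fun w => p%:R * \sum_j partial_sum t j w ^+ 4).
  by apply: summableZ; apply: summable_sum => j _; have [] := partial_sum_moment j tn.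
have le w : N t w ^+ 2 <= p%:R * \sum_j partial_sum t j w ^+ 4.
  apply: le_trans (sqr_sum_le _) _; rewrite card_ord ler_wpM2l//.
  by under eq_bigr do rewrite -exprM.
have s2 : summable_rv P (fun w => N t w ^+ 2).
  apply: summable_le s1; last by move=> w; rewrite ger0_norm ?sqr_ge0.
  by apply: measurable_funX; exact: meas_wrt_meas (past_measurable st (t := t)) (N_meas tn).
split => //; apply: le_trans (Ex_le s2 s1 le) _.
rewrite ExZ; last first.
  by apply: summable_sum => j _; have [] := partial_sum_moment j tn.
rewrite Ex_sum; last by move=> j _; have [] := partial_sum_moment j tn.
rewrite expr2 -mulrA ler_wpM2l// -[X in X%:R * _]card_ord mulr_natl -sumr_const.
by apply: ler_sum => j _; have [] := partial_sum_moment j tn.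
Qed.

Let increment_meas (k : 'I_n) : meas_wrt (G k.+1) (increment k).
Proof.
apply: meas_wrt_sum => j _; apply: meas_wrtM.
  exact: meas_wrt_sub (present_past st (t := k)) (mxi _ _).
apply: meas_wrt_sub (past_past st (t := k)) (partial_sum_meas _ _).
exact: ltnW.
Qed.

Let off_diagonalS (k : 'I_n) w : off_diagonal k.+1 w = off_diagonal k w + increment k w.
Proof. exact: big_ord_prefixS. Qed.

Let off_diagonal_meas t : (t <= n)%N -> meas_wrt (G t) (off_diagonal t).
Proof.
elim: t => [_|t ih tn].
  by apply: meas_wrt_ext (meas_wrt_cst _ 0) => w; rewrite /off_diagonal big_pred0.
apply: (@meas_wrt_ext _ _ _ _ (fun w => off_diagonal t w + increment (Ordinal tn) w)).
  by move=> w; rewrite -(off_diagonalS (Ordinal tn)).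
apply: meas_wrtD; last exact: (increment_meas (Ordinal tn)).
exact: (meas_wrt_sub (past_past st (t := t)) (ih (ltnW tn))).
Qed.

(* Conditioning on the past turns [increment k] into a linear form in [xi k]
   with frozen coefficients [partial_sum k]. *)
Let joint_meas (k : 'I_n) (f : T -> R) e : meas_wrt (G k) f ->
  measurable_fun (setT : set (g_sigma_algebraType (G k) * g_sigma_algebraType (H k)))
    (fun x => f x.1 * (\sum_j xi k j x.2 * partial_sum k j x.1) ^+ e).
Proof.
move=> mf; apply: measurable_funM; first exact: meas_wrt_fst.
apply: measurable_funX; apply: measurable_sum => j.
apply: measurable_funM; first exact: (meas_wrt_snd (mxi k j)).
by apply: meas_wrt_fst; apply: partial_sum_meas; exact: ltnW.
Qed.

Let linear_meas (k : 'I_n) (v : 'I_p -> R) :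
  measurable_fun setT (fun w => \sum_j xi k j w * v j).
Proof.
apply: (meas_wrt_meas (present_measurable st (t := k))).
by apply: meas_wrt_sum => j _; apply: meas_wrtM; [exact: mxi|exact: meas_wrt_cst].
Qed.

Let sxi2 k (v : 'I_p -> R) : summable_rv P (fun w => (\sum_j xi k j w * v j) ^+ 2).
Proof.
by apply: (@summable_lower_power _ _ _ _ _ 2 2) => //; exact: linear_meas.
Qed.

Let xi_mom2 k (v : 'I_p -> R) :
  Ex P (fun w => (\sum_j xi k j w * v j) ^+ 2) <= c * \sum_j v j ^+ 2.
Proof.
have v0 : 0 <= \sum_j v j ^+ 2 by apply: sumr_ge0 => j _; exact: sqr_ge0.
rewrite -(@ler_pXn2r _ 2)// ?nnegrE; last 2 first.
- by apply: Ex_ge0 => w; exact: sqr_ge0.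
- exact: mulr_ge0.
have s4 : summable_rv P (fun w => ((\sum_j xi k j w * v j) ^+ 2) ^+ 2).
  by apply: summable_ext (sxi k v) => w; rewrite -exprM.
apply: le_trans (Ex_sqr_le (sxi2 k v) s4) _.
rewrite (@Ex_ext _ _ _ _ _ (fun w => (\sum_j xi k j w * v j) ^+ 4)); last first.
  by move=> w; rewrite -exprM.
apply: le_trans (xi_mom k v) _; rewrite exprMn ler_wpM2r ?sqr_ge0//.
by rewrite expr2 ler_peMl.
Qed.

(** The bound is proved in the form [A * (t / n)], so each step may add [A / n]. Half of this
    absorbs the share [y / (2 n)] of the current fourth moment [y <= A]; the other half pays
    [(32 + 3) c ^ 2 n] times the expectation of [N ^ 2], whence the constant 70. *)
Lemma off_diagonal_moment :
  summable_rv P (fun w => off_diagonal n w ^+ 4) /\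
  Ex P (fun w => off_diagonal n w ^+ 4) <=
    70 * c ^+ 2 * (4 * 2 ^+ 4 * (1 + c)) ^+ 2 * n%:R ^+ 4 * p%:R ^+ 2.
Proof.
rewrite -/K; set A := _ * _ * _.
have A0 : 0 <= A.
  apply: mulr_ge0; last exact: sqr_ge0.
  apply: mulr_ge0; last exact: exprn_ge0.
  apply: mulr_ge0; last exact: sqr_ge0.
  by apply: mulr_ge0 => //; exact: sqr_ge0.
have [n0|n_gt0] := posnP n.
  have E : (fun w => off_diagonal n w ^+ 4) = fun=> 0.
    apply/funext => w; rewrite /off_diagonal big1 ?expr0n// => i.
    by have := ltn_ord i; rewrite {2}n0.
  by rewrite E Ex_cst; split => //; exact: summable_cst.
have nR : 1 <= n%:R :> R by rewrite ler1n.
have nR0 : 0 < n%:R :> R by rewrite ltr0n.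
suff step t : (t <= n)%N -> summable_rv P (fun w => off_diagonal t w ^+ 4) /\
    Ex P (fun w => off_diagonal t w ^+ 4) <= A * (t%:R / n%:R).
  by have [s le] := step n (leqnn n); split => //; rewrite divff ?gt_eqF ?mulr1 in le.
elim: t => [_|t ih tn].
  have E : (fun w => off_diagonal 0 w ^+ 4) = fun=> 0.
    by apply/funext => w; rewrite /off_diagonal big_pred0// expr0n.
  by rewrite E Ex_cst mul0r mulr0; split => //; exact: summable_cst.
have [sM leM] := ih (ltnW tn); pose k := Ordinal tn.
have Gm := past_measurable st (t := t); have Hm := present_measurable st (t := k).
have GH := past_present_independent st (t := k).
have mM := off_diagonal_meas (ltnW tn).
have mM' := meas_wrt_meas Gm mM.
have mx' : measurable_fun setT (increment k).
  exact: meas_wrt_meas (past_measurable st (t := t.+1)) (increment_meas k).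
have [sN leN] := N_moment (ltnW tn).
have mN' := meas_wrt_meas Gm (N_meas (ltnW tn)).
have [sx4 lex4] : summable_rv P (fun w => increment k w ^+ 4) /\
    Ex P (fun w => increment k w ^+ 4) <= Ex P (fun w => c * N t w ^+ 2).
  have [|||s le] := Ex_cond_le Gm Hm GH (joint_meas (k := k) 4 (meas_wrt_cst (G k) 1)) (b := fun w => c * N t w ^+ 2).
  - by move=> x; rewrite mul1r (sqr_pow_ge0 _ 2).
  - move=> w /=; under eq_integral do rewrite mul1r.
    by rewrite (ExE (sxi _ _)) lee_fin; exact: xi_mom.
  - exact: summableZ.
  split; first by apply: summable_ext s => w; rewrite mul1r.
  by apply: le_trans le; rewrite le_eqVlt; apply/orP; left; apply/eqP; apply: Ex_ext => w; rewrite mul1r.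
have sMN : summable_rv P (fun w => off_diagonal t w ^+ 2 * N t w).
  apply: (@summable_le _ _ _ _ (fun w => off_diagonal t w ^+ 4 + N t w ^+ 2)).
  - by apply: measurable_funM => //; exact: measurable_funX.
  - move=> w; rewrite ger0_norm; last by rewrite mulr_ge0// sqr_ge0.
    have := sqr_ge0 (off_diagonal t w ^+ 2 - N t w).
    have := sqr_ge0 (off_diagonal t w ^+ 2 + N t w).
    by rewrite (_ : off_diagonal t w ^+ 4 = (off_diagonal t w ^+ 2) ^+ 2) -?exprM//; lra.
  - exact: summableD.
have [sMx leMx] : summable_rv P (fun w => off_diagonal t w ^+ 2 * increment k w ^+ 2) /\
    Ex P (fun w => off_diagonal t w ^+ 2 * increment k w ^+ 2) <=
      Ex P (fun w => c * (off_diagonal t w ^+ 2 * N t w)).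
  apply: (Ex_cond_le Gm Hm GH (joint_meas (k := k) 2 (meas_wrtX 2 mM)) (b := fun w => c * (off_diagonal t w ^+ 2 * N t w))).
  - by move=> x; rewrite mulr_ge0// sqr_ge0.
  - move=> w /=; under eq_integral do rewrite EFinM.
    rewrite ge0_integralZl_EFin//; last 3 first.
    + by move=> x _; rewrite lee_fin sqr_ge0.
    + by apply/measurable_EFinP; exact: (summable_meas (sxi2 k _)).
    + exact: sqr_ge0.
    rewrite (ExE (sxi2 _ _)) -EFinM lee_fin mulrCA.
    apply: ler_wpM2l; first exact: sqr_ge0.
    exact: (xi_mom2 k (fun j => partial_sum k j w)).
  - exact: summableZ.
(* Each coordinate of [xi k] is centered and independent of its coefficient, which belongs to the
   past. *)
have sM3x : summable_rv P (fun w => off_diagonal t w ^+ 3 * increment k w) /\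
    Ex P (fun w => off_diagonal t w ^+ 3 * increment k w) = 0.
  have h j : summable_rv P (fun w => (off_diagonal t w ^+ 3 * partial_sum k j w) * xi k j w) /\
      Ex P (fun w => (off_diagonal t w ^+ 3 * partial_sum k j w) * xi k j w) = 0.
    have [sp _] := partial_sum_moment j (ltnW tn).
    have mp := partial_sum_meas j (ltnW tn).
    have [|||s e] := @ExM_indep _ _ _ _ _ _ Gm Hm GH (fun w => off_diagonal t w ^+ 3 * partial_sum k j w) (xi k j) _ (mxi k j).
    - by apply: meas_wrtM => //; exact: meas_wrtX.
    - apply: summable_ext (@summable_mixed_power _ _ _ _ _ _ 3 1 2 _ mM' (meas_wrt_meas Gm mp) sM sp) => //.
    - apply: summable_ext (@summable_lower_power _ _ _ _ _ 1 2 _ (meas_wrt_meas Hm (mxi k j)) (sxi4 k j)) => //.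
    - by split => //; rewrite e xi_mean mulr0.
  have E w : off_diagonal t w ^+ 3 * increment k w =
      \sum_j (off_diagonal t w ^+ 3 * partial_sum k j w) * xi k j w.
    by rewrite /increment mulr_sumr; apply: eq_bigr => j _; ring.
  split; first by apply: (summable_ext (fun w => esym (E w))); apply: summable_sum => j _; have [] := h j.
  by rewrite (Ex_ext _ E) Ex_sum ?big1// => j _; have [] := h j.
have sR : summable_rv P (fun w => off_diagonal t w ^+ 4 +
    4 * (off_diagonal t w ^+ 3 * increment k w)
    + 8 * (off_diagonal t w ^+ 2 * increment k w ^+ 2) + 3 * increment k w ^+ 4).
  have [s3 _] := sM3x.
  by do 3 (apply: summableD; last exact: summableZ).
have E w : off_diagonal t.+1 w = off_diagonal t w + increment k w.
  exact: (off_diagonalS k).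
have s4 : summable_rv P (fun w => off_diagonal t.+1 w ^+ 4).
  apply: summable_le sR.
    apply: measurable_funX.
    exact: meas_wrt_meas (past_measurable st (t := t.+1)) (off_diagonal_meas tn).
  by move=> w; rewrite ger0_norm ?(sqr_pow_ge0 _ 2)// E; exact: fourth_power_le.
split => //.
apply: le_trans (Ex_le s4 sR _) _.
  by move=> w; rewrite E; exact: fourth_power_le.
have [s3 e3] := sM3x.
have q1 := summableZ 4 s3; have q2 := summableZ 8 sMx; have q3 := summableZ 3 sx4.
have q12 := summableD sM q1.
rewrite (ExD (summableD q12 q2) q3) (ExD q12 q2) (ExD sM q1).
rewrite !ExZ// e3 mulr0 addr0.
set V := Ex P (fun w => N t w ^+ 2) in leN.
set y := Ex P (fun w => off_diagonal t w ^+ 4) in leM *.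
(* Young's inequality with a weight of order [n]: the share of the fourth moment must remain
   summable over [n] steps. *)
have MN : 8 * c * Ex P (fun w => off_diagonal t w ^+ 2 * N t w) <=
    y / (2 * n%:R) + 32 * c ^+ 2 * n%:R * V.
  rewrite [y / _]mulrC /y /V -(ExZ (8 * c) sMN) -(ExZ _ sM) -(ExZ _ sN).
  rewrite -ExD; [|exact: summableZ|exact: summableZ].
  apply: Ex_le; [exact: summableZ|by apply: summableD; exact: summableZ|move=> w].
  have := sqr_ge0 (off_diagonal t w ^+ 2 - 8 * c * n%:R * N t w).
  rewrite -(pmulr_rge0 _ (_ : 0 < (2 * n%:R)^-1)) ?invr_gt0 ?mulr_gt0//.
  set X := off_diagonal t w; set Y := N t w => h; rewrite -subr_ge0; apply: le_trans h _.
  by rewrite le_eqVlt; apply/orP; left; apply/eqP; field; exact: lt0r_neq0.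
rewrite !ExZ// in lex4 leMx; rewrite -/V in lex4.
have tn1 : t%:R / n%:R <= 1 :> R by rewrite ler_pdivrMr// mul1r ler_nat ltnW.
have yA : y / (2 * n%:R) <= A / (2 * n%:R).
  rewrite ler_wpM2r ?invr_ge0 ?mulr_ge0//.
  by apply: le_trans leM _; rewrite -[leRHS]mulr1 ler_wpM2l.
have AE : A / (2 * n%:R) = 35 * c ^+ 2 * n%:R * (p%:R ^+ 2 * (K * n%:R ^+ 2)).
  rewrite /A; field; exact: lt0r_neq0.
have tE : A * (t.+1%:R / n%:R) = A * (t%:R / n%:R) + 2 * (A / (2 * n%:R)).
  by rewrite -natr1; field; exact: lt0r_neq0.
rewrite tE.
have V0 : 0 <= V by apply: Ex_ge0 => w; exact: sqr_ge0.
have cc : c * V <= c ^+ 2 * n%:R * V.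
  apply: ler_wpM2r => //; rewrite expr2 -mulrA ler_peMr//.
  by apply: le_trans c1 _; rewrite ler_peMr.
have VV : 35 * c ^+ 2 * n%:R * V <= A / (2 * n%:R).
  by rewrite AE ler_wpM2l// !mulr_ge0// sqr_ge0.
by lra.
Qed.

End bilinear.

(** * Random design matrices *)

Section block_steps.
Context d (T : measurableType d) (R : realType) (P : probability T R).
Variables (J : finType) (F : J -> set_system T).
Hypothesis FT : forall i, F i setT.
Hypothesis FI : forall i, setI_closed (F i).
Hypothesis Fm : forall i, F i `<=` measurable.
Hypothesis Find : mutually_independent P F.

Definition past_block (n : nat) (A : 'I_n -> {set J}) (t : nat) : {set J} :=
  finset (fun k => [exists i : 'I_n, (i < t)%N && (k \in A i)]).

Lemma generators_subset (A B : {set J}) : (forall k, k \in A -> k \in B) ->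
  generators F A `<=` <<s generators F B >>.
Proof.
move=> AB C [k kA FC]; apply: sub_sigma_algebra.
by exists k => //; exact: AB.
Qed.

Lemma block_independent_steps (n : nat) (A : 'I_n -> {set J}) :
  (forall i j k, k \in A i -> k \in A j -> i = j) ->
  independent_steps P (fun t => generators F (past_block A t))
    (fun i => generators F (A i)).
Proof.
move=> Adisj; split.
- by move=> t; exact: generators_measurable.
- by move=> t; exact: generators_measurable.
- move=> t; apply: independent_generators => // k.
  rewrite inE => /existsP[i /andP[it ki]]; apply/negP => kt.
  by move: it; rewrite (Adisj _ _ _ ki kt) ltnn.
- move=> t; apply: generators_subset => k; rewrite !inE => /existsP[i /andP[it ki]].
  by apply/existsP; exists i; rewrite ki andbT ltnW.
- move=> t; apply: generators_subset => k kt; rewrite !inE.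
  by apply/existsP; exists t; rewrite kt ltnSn.
Qed.

End block_steps.

Section sigma_of_real.
Context d (T : measurableType d) (R : realType).
Variables (J : finType) (f : J -> T -> R).
Hypothesis mf : forall j, measurable_fun setT (f j).
Let F j := sigma_of (@measurable _ R) (f j).

Lemma sigma_of_setT j : F j setT.
Proof. by exists setT. Qed.

Lemma sigma_of_setI j : setI_closed (F j).
Proof.
move=> _ _ [A mA ->] [B mB ->]; exists (A `&` B); first exact: measurableI.
by rewrite preimage_setI.
Qed.

Lemma sigma_of_measurable j : F j `<=` measurable.
Proof. by move=> _ [B mB ->]; rewrite -[_ @^-1` _]setTI; exact: mf. Qed.

Lemma meas_wrt_generators (A : {set J}) j : j \in A -> meas_wrt (generators F A) (f j).
Proof.
move=> jA; split=> _ B mB; rewrite setTI; apply: sub_sigma_algebra.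
by exists j => //; exists B.
Qed.

End sigma_of_real.

Section centering.
Context d (T : measurableType d) (R : realType) (P : probability T R).

Lemma fourth_power_sum_le (x y : R) : (x + y) ^+ 4 <= 8 * (x ^+ 4 + y ^+ 4).
Proof.
have h := sqr_ge0 (x ^+ 2 - y ^+ 2); have h2 := sqr_ge0 (x - y).
have h3 : 0 <= (x - y) ^+ 2 * (x ^+ 2 + y ^+ 2).
  by rewrite mulr_ge0// addr_ge0 ?sqr_ge0.
rewrite -subr_ge0.
have -> : 8 * (x ^+ 4 + y ^+ 4) - (x + y) ^+ 4 =
   5 * (x ^+ 2 - y ^+ 2) ^+ 2 + 2 * ((x - y) ^+ 2 * (x ^+ 2 + y ^+ 2)) by ring.
by rewrite addr_ge0// mulr_ge0.
Qed.

Lemma Ex_fourth_le (Y : T -> R) : measurable_fun setT Y ->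
  summable_rv P (fun w => Y w ^+ 4) ->
  Ex P Y ^+ 4 <= Ex P (fun w => Y w ^+ 4).
Proof.
move=> mY s4.
have s2 : summable_rv P (fun w => Y w ^+ 2) by exact: (@summable_lower_power _ _ _ _ _ 2 2).
have s1 : summable_rv P Y.
  by apply: summable_ext (@summable_lower_power _ _ _ _ _ 1 2 _ mY s4) => //.
have s4' : summable_rv P (fun w => (Y w ^+ 2) ^+ 2).
  by apply: summable_ext s4 => w; rewrite -exprM.
have -> : Ex P (fun w => Y w ^+ 4) = Ex P (fun w => (Y w ^+ 2) ^+ 2).
  by apply: Ex_ext => w; rewrite -exprM.
apply: le_trans (Ex_sqr_le s2 s4').
rewrite (_ : Ex P Y ^+ 4 = (Ex P Y ^+ 2) ^+ 2); last by rewrite -exprM.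
rewrite lerXn2r// ?nnegrE ?sqr_ge0//; first by apply: Ex_ge0 => w; exact: sqr_ge0.
exact: Ex_sqr_le.
Qed.

(** The factor 16 is 8 times 2: [fourth_power_sum_le], then Jensen for the mean. *)
Lemma centered_fourth (Y : T -> R) (b : R) : measurable_fun setT Y ->
  summable_rv P (fun w => Y w ^+ 4) -> Ex P (fun w => Y w ^+ 4) <= b ->
  [/\ summable_rv P Y, Ex P (fun w => Y w - Ex P Y) = 0,
      summable_rv P (fun w => (Y w - Ex P Y) ^+ 4) &
      Ex P (fun w => (Y w - Ex P Y) ^+ 4) <= 16 * b].
Proof.
move=> mY s4 le4.
have s1 : summable_rv P Y.
  by apply: summable_ext (@summable_lower_power _ _ _ _ _ 1 2 _ mY s4) => //.
have s' : summable_rv P (fun w => 8 * (Y w ^+ 4 + (- Ex P Y) ^+ 4)).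
  by apply: summableZ; apply: summableD => //; exact: summable_cst.
have sc : summable_rv P (fun w => (Y w - Ex P Y) ^+ 4).
  apply: summable_le s'; first by apply: measurable_funX; apply: measurable_funB.
  by move=> w; rewrite ger0_norm ?(sqr_pow_ge0 _ 2)//; exact: fourth_power_sum_le.
split => //.
- by rewrite ExB// ?Ex_cst ?subrr//; exact: summable_cst.
apply: le_trans (Ex_le sc s' _) _; first by move=> w; exact: fourth_power_sum_le.
rewrite ExZ; last by apply: summableD => //; exact: summable_cst.
rewrite ExD//; last exact: summable_cst.
rewrite Ex_cst (_ : (- Ex P Y) ^+ 4 = Ex P Y ^+ 4); last by rewrite exprNn sqrr_sign mul1r || ring.
have := Ex_fourth_le mY s4; lra.
Qed.

End centering.

(** * Moments attached to one column of a random design *)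

Section design.
Context d (T : measurableType d) (R : realType) (P : probability T R).
Variables (n p : nat) (z : 'I_n -> 'I_p -> T -> R) (m alpha : R).
Hypothesis mz : forall k j, measurable_fun setT (z k j).
Let F (kj : 'I_n * 'I_p) := sigma_of (@measurable _ R) (fun w => z kj.1 kj.2 w).
Hypothesis Find : mutually_independent P F.
Hypothesis z_mean : forall k j, Ex P (z k j) = 0.
Hypothesis sz : forall k j, summable_rv P (fun w => z k j w ^+ 8).
Hypothesis z_mom : forall k j, Ex P (fun w => z k j w ^+ 8) <= m.
Hypothesis m0 : 0 <= m.

Let FT : forall i, F i setT. Proof. by move=> i; exact: sigma_of_setT. Qed.
Let FI : forall i, setI_closed (F i). Proof. by move=> i; exact: (@sigma_of_setI _ _ _ _ (fun kj => z kj.1 kj.2)). Qed.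
Let Fm : forall i, F i `<=` measurable. Proof. by move=> i; exact: (@sigma_of_measurable _ _ _ _ (fun kj => z kj.1 kj.2)). Qed.

(** Two filtrations are used: entries within a row, for linear forms of that row, and whole rows,
    for sums over [k]. *)
Let row_set (k : 'I_n) : {set 'I_n * 'I_p} := finset (fun kj => kj.1 == k).
Let entry_set (k : 'I_n) (j : 'I_p) : {set 'I_n * 'I_p} :=
  finset (fun kj => kj == (k, j)).

Let row_steps : independent_steps P
  (fun t => generators F (past_block row_set t)) (fun k => generators F (row_set k)).
Proof.
apply: block_independent_steps => // i j k.
by rewrite !inE => /eqP <- /eqP <-.
Qed.

Let entry_steps k : independent_steps P
  (fun t => generators F (past_block (entry_set k) t))
  (fun j => generators F (entry_set k j)).
Proof.
apply: block_independent_steps => // i j kj.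
by rewrite !inE => /eqP -> /eqP[].
Qed.

Let z_entry k j : meas_wrt (generators F (entry_set k j)) (z k j).
Proof.
apply: (@meas_wrt_generators _ _ _ _ (fun kj => z kj.1 kj.2) _ (k, j)).
by rewrite !inE.
Qed.

Let z_row k j : meas_wrt (generators F (row_set k)) (z k j).
Proof.
apply: (@meas_wrt_generators _ _ _ _ (fun kj => z kj.1 kj.2) _ (k, j)).
by rewrite !inE.
Qed.

(** The constant of [sum_moment] for [e = 2], that is, for eighth moments. *)
Definition row_form_const : R := (4 * 2 ^+ 8 * (1 + m)) ^+ 4.

Lemma row_form_const_ge1 : 1 <= row_form_const.
Proof.
have h : 1 <= 1 + m by rewrite lerDl.
by rewrite exprn_ege1//; lra.
Qed.

Let row_form_const_ge0 : 0 <= row_form_const. Proof. exact: le_trans row_form_const_ge1. Qed.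

Definition row_form (k : 'I_n) (v : 'I_p -> R) (w : T) : R := \sum_j v j * z k j w.

Lemma row_form_meas k v : meas_wrt (generators F (row_set k)) (row_form k v).
Proof. by apply: meas_wrt_sum => j _; apply: meas_wrtM; [exact: meas_wrt_cst|]. Qed.

Let row_form_meas' k v : measurable_fun setT (row_form k v).
Proof. exact: meas_wrt_meas (present_measurable row_steps (t := k)) (row_form_meas k v). Qed.

Lemma row_form_moment k v : summable_rv P (fun w => row_form k v w ^+ 8) /\
  Ex P (fun w => row_form k v w ^+ 8) <= row_form_const * (\sum_j v j ^+ 2) ^+ 4.
Proof.
have [s le] := sum_moment (entry_steps k) v (e := 2) m0 (z_entry k) (sz k) (z_mom k) (z_mean k) (leqnn p).
split; first by apply: summable_ext s => w; rewrite big_ord_prefix_full.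
rewrite (@Ex_ext _ _ _ _ _ (fun w => (\sum_(i < p | (i < p)%N) v i * z k i w) ^+ 8)); last first.
  by move=> w; rewrite big_ord_prefix_full.
by rewrite big_ord_prefix_full in le.
Qed.

(** The constant of [sum_moment] for [e = 0], with [b] bounding the fourth moments. *)
Definition deviation_const (b : R) : R := (4 * 2 ^+ 4 * (1 + b)) ^+ 2.

(** Eighth moments of the entries are fourth moments of their squares. Cancellation leaves [p ^ 2],
    where a term-by-term bound would give [p ^ 4]. *)
Lemma entry_square_deviation k :
  summable_rv P (fun w => (\sum_j (z k j w ^+ 2 - Ex P (fun w => z k j w ^+ 2))) ^+ 4) /\
  Ex P (fun w => (\sum_j (z k j w ^+ 2 - Ex P (fun w => z k j w ^+ 2))) ^+ 4)
    <= deviation_const (16 * m) * p%:R ^+ 2.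
Proof.
have h j : [/\ summable_rv P (fun w => z k j w ^+ 2),
   Ex P (fun w => z k j w ^+ 2 - Ex P (fun w => z k j w ^+ 2)) = 0,
      summable_rv P (fun w => (z k j w ^+ 2 - Ex P (fun w => z k j w ^+ 2)) ^+ 4) &
      Ex P (fun w => (z k j w ^+ 2 - Ex P (fun w => z k j w ^+ 2)) ^+ 4) <= 16 * m].
  apply: centered_fourth; first exact: measurable_funX.
    by apply: summable_ext (sz k j) => w; rewrite -exprM.
  by apply: le_trans (z_mom k j); rewrite le_eqVlt; apply/orP; left; apply/eqP; apply: Ex_ext => w; rewrite -exprM.
have m16 : 0 <= 16 * m by rewrite mulr_ge0.
have [s le] := sum_moment (entry_steps k) (fun=> 1) (e := 0) m16
  (x := fun j w => z k j w ^+ 2 - Ex P (fun w => z k j w ^+ 2))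
  (fun j => meas_wrtB (meas_wrtX 2 (z_entry k j)) (meas_wrt_cst _ _))
  (fun j => let: And4 _ _ h _ := h j in h) (fun j => let: And4 _ _ _ h := h j in h) (fun j => let: And4 _ h _ _ := h j in h) (leqnn p).
split; first by apply: summable_ext s => w; rewrite big_ord_prefix_full; under eq_bigr do rewrite mul1r.
rewrite (@Ex_ext _ _ _ _ _ (fun w => (\sum_(i < p | (i < p)%N) 1 * (z k i w ^+ 2 - Ex P (fun w => z k i w ^+ 2))) ^+ 4)); last first.
  by move=> w; rewrite big_ord_prefix_full; under [in RHS]eq_bigr do rewrite mul1r.
apply: le_trans le _; rewrite big_ord_prefix_full; under eq_bigr do rewrite expr1n.
by rewrite sumr_const card_ord.
Qed.

Variable a : 'I_p -> R.
Hypothesis a_norm : \sum_j a j ^+ 2 <= alpha.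

Let a0 : 0 <= \sum_j a j ^+ 2. Proof. by apply: sumr_ge0 => j _; exact: sqr_ge0. Qed.
Let alpha0 : 0 <= alpha. Proof. exact: le_trans a_norm. Qed.

Local Notation b := (fun k => row_form k a).

Let b_mom k : Ex P (fun w => row_form k a w ^+ 8) <= row_form_const * alpha ^+ 4.
Proof.
apply: le_trans (row_form_moment k a).2 _.
rewrite ler_wpM2l ?row_form_const_ge0//.
by rewrite lerXn2r// nnegrE.
Qed.

Lemma row_form_deviation :
  summable_rv P (fun w => (\sum_k (row_form k a w ^+ 2 - Ex P (fun w => row_form k a w ^+ 2))) ^+ 4) /\
  Ex P (fun w => (\sum_k (row_form k a w ^+ 2 - Ex P (fun w => row_form k a w ^+ 2))) ^+ 4)
    <= deviation_const (16 * (row_form_const * alpha ^+ 4)) * n%:R ^+ 2.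
Proof.
have h k : [/\ summable_rv P (fun w => row_form k a w ^+ 2),
   Ex P (fun w => row_form k a w ^+ 2 - Ex P (fun w => row_form k a w ^+ 2)) = 0,
      summable_rv P (fun w => (row_form k a w ^+ 2 - Ex P (fun w => row_form k a w ^+ 2)) ^+ 4) &
      Ex P (fun w => (row_form k a w ^+ 2 - Ex P (fun w => row_form k a w ^+ 2)) ^+ 4) <= 16 * (row_form_const * alpha ^+ 4)].
  apply: centered_fourth; first exact: measurable_funX.
    by apply: summable_ext (row_form_moment k a).1 => w; rewrite -exprM.
  by apply: le_trans (b_mom k); rewrite le_eqVlt; apply/orP; left; apply/eqP; apply: Ex_ext => w; rewrite -exprM.
have m16 : 0 <= 16 * (row_form_const * alpha ^+ 4).
  by apply: mulr_ge0 => //; apply: mulr_ge0; [exact: row_form_const_ge0|exact: exprn_ge0].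
have [s le] := sum_moment row_steps (fun=> 1) (e := 0) m16
  (x := fun k w => row_form k a w ^+ 2 - Ex P (fun w => row_form k a w ^+ 2))
  (fun j => meas_wrtB (meas_wrtX 2 (row_form_meas j a)) (meas_wrt_cst _ _))
  (fun j => let: And4 _ _ h _ := h j in h) (fun j => let: And4 _ _ _ h := h j in h) (fun j => let: And4 _ h _ _ := h j in h) (leqnn n).
split; first by apply: summable_ext s => w; rewrite big_ord_prefix_full; under eq_bigr do rewrite mul1r.
rewrite (@Ex_ext _ _ _ _ _ (fun w => (\sum_(i < n | (i < n)%N) 1 * (row_form i a w ^+ 2 - Ex P (fun w => row_form i a w ^+ 2))) ^+ 4)); last first.
  by move=> w; rewrite big_ord_prefix_full; under [in RHS]eq_bigr do rewrite mul1r.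
apply: le_trans le _; rewrite big_ord_prefix_full; under eq_bigr do rewrite expr1n.
by rewrite sumr_const card_ord.
Qed.

(** The 16 pays for centering a product of two row forms; the summand 1 ensures the lower bound by 1
    that [off_diagonal_moment] requires. *)
Definition product_const : R := 16 * (row_form_const * (1 + alpha ^+ 4)).

Lemma product_const_ge1 : 1 <= product_const.
Proof.
have h : 1 <= 1 + alpha ^+ 4 by rewrite lerDl exprn_ge0.
have := row_form_const_ge1; rewrite /product_const; move: (1 + _) row_form_const h => x y; nra.
Qed.

Lemma product_moment k v :
  summable_rv P (fun w => (row_form k a w * row_form k v w) ^+ 4) /\
  Ex P (fun w => (row_form k a w * row_form k v w) ^+ 4) <=
    row_form_const * (1 + alpha ^+ 4) * (\sum_j v j ^+ 2) ^+ 2.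
Proof.
set V := \sum_j v j ^+ 2.
have V0 : 0 <= V by apply: sumr_ge0 => j _; exact: sqr_ge0.
have [sa _] := row_form_moment k a; have lea := b_mom k.
have [sv lev] := row_form_moment k v; rewrite -/V in lev.
have s : summable_rv P (fun w => (row_form k a w * row_form k v w) ^+ 4).
  apply: (summable_ext (fun w => esym (exprMn 4 _ _))).
  exact: (@summable_mixed_power _ _ _ _ _ _ 4 4 4).
split => //.
have [V_eq0|V_neq0] := eqVneq V 0.
  have E : (fun w => (row_form k a w * row_form k v w) ^+ 4) = fun=> 0.
    apply/funext => w; rewrite [row_form k v w]big1 ?mulr0 ?expr0n// => j _.
    have /eqP := psumr_eq0P (fun j _ => sqr_ge0 (v j)) V_eq0 (i := j) isT.
    by rewrite sqrf_eq0 => /eqP ->; rewrite mul0r.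
  by rewrite E Ex_cst V_eq0 expr0n mulr0.
have Vp : 0 < V by rewrite lt_neqAle eq_sym V_neq0.
(* Weighted arithmetic-geometric mean; the weight [V ^ 2] balances eighth moments of order 1 and
   [V ^ 4]. *)
have s' : summable_rv P (fun w => V ^+ 2 / 2 * row_form k a w ^+ 8 + (V ^+ 2)^-1 / 2 * row_form k v w ^+ 8).
  by apply: summableD; exact: summableZ.
have Vn : V != 0 by [].
apply: le_trans (Ex_le s s' _) _.
  move=> w; move: (row_form k a w) (row_form k v w) => x y.
  rewrite -subr_ge0 (_ : _ - _ = (V ^+ 2)^-1 / 2 * (V ^+ 2 * x ^+ 4 - y ^+ 4) ^+ 2); last by field.
  by rewrite mulr_ge0 ?sqr_ge0// divr_ge0// invr_ge0 sqr_ge0.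
rewrite ExD; [|exact: summableZ|exact: summableZ].
rewrite !ExZ//.
apply: (@le_trans _ _ (V ^+ 2 / 2 * (row_form_const * alpha ^+ 4) + (V ^+ 2)^-1 / 2 * (row_form_const * V ^+ 4))).
  apply: lerD; apply: ler_wpM2l => //; first by rewrite divr_ge0// sqr_ge0.
  by rewrite divr_ge0// invr_ge0 sqr_ge0.
have -> : V ^+ 2 / 2 * (row_form_const * alpha ^+ 4) + (V ^+ 2)^-1 / 2 * (row_form_const * V ^+ 4) =
  2^-1 * (row_form_const * (1 + alpha ^+ 4) * V ^+ 2) by field.
have h : 0 <= row_form_const * (1 + alpha ^+ 4) * V ^+ 2.
  apply: mulr_ge0; last exact: sqr_ge0.
  by apply: mulr_ge0; [exact: row_form_const_ge0|rewrite addr_ge0// exprn_ge0].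
by lra.
Qed.

(** The terms [b_k z_k] are not centered: for centered independent entries this mean is [a j] times
    the variance of [z k j]. *)
Definition mu_row k j : R := Ex P (fun w => row_form k a w * z k j w).
Definition xi_row k j w : R := row_form k a w * z k j w - mu_row k j.

Let row_form_delta k j w : row_form k (fun i => (i == j)%:R) w = z k j w.
Proof.
rewrite /row_form (bigD1 j)//= eqxx mul1r big1 ?addr0// => i ij.
by rewrite (negbTE ij) mul0r.
Qed.

Let summable_product k v : summable_rv P (fun w => row_form k a w * row_form k v w).
Proof.
apply: summable_ext (@summable_lower_power _ _ _ _ _ 1 2 _ _ (product_moment k v).1) => //.
by apply: measurable_funM; exact: row_form_meas'.
Qed.

Let summable_bz k j : summable_rv P (fun w => row_form k a w * z k j w).
Proof.
by apply: summable_ext (summable_product k (fun i => (i == j)%:R)) => w; rewrite row_form_delta.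
Qed.

Let Ex_product k v : Ex P (fun w => row_form k a w * row_form k v w) = \sum_j v j * mu_row k j.
Proof.
under eq_bigr do rewrite -ExZ//.
rewrite -Ex_sum; last by move=> j _; exact: summableZ.
by apply: Ex_ext => w; rewrite /row_form mulr_sumr; apply: eq_bigr => j _; ring.
Qed.

Let xi_form k v w : \sum_j xi_row k j w * v j =
  row_form k a w * row_form k v w - Ex P (fun w => row_form k a w * row_form k v w).
Proof.
rewrite Ex_product /row_form mulr_sumr -sumrB; apply: eq_bigr => j _.
by rewrite /xi_row /row_form; ring.
Qed.

Lemma xi_row_off_diagonal :
  summable_rv P (fun w => off_diagonal xi_row n w ^+ 4) /\
  Ex P (fun w => off_diagonal xi_row n w ^+ 4) <=
    70 * product_const ^+ 2 * (4 * 2 ^+ 4 * (1 + product_const)) ^+ 2 * n%:R ^+ 4 * p%:R ^+ 2.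
Proof.
have h k v := @centered_fourth _ _ _ P (fun w => row_form k a w * row_form k v w) _
  (measurable_funM (row_form_meas' k a) (row_form_meas' k v)) (product_moment k v).1 (product_moment k v).2.
apply: (off_diagonal_moment row_steps product_const_ge1).
- move=> k j; apply: meas_wrtB; last exact: meas_wrt_cst.
  by apply: meas_wrtM => //; exact: row_form_meas.
- move=> k j; rewrite ExB//; last exact: summable_cst.
  by rewrite Ex_cst /mu_row subrr.
- move=> k v; have [_ _ s _] := h k v.
  by apply: summable_ext s => w; rewrite xi_form.
- move=> k v; have [_ _ _ le] := h k v.
  rewrite (Ex_ext _ (fun w => congr1 (fun x => x ^+ 4) (xi_form k v w))).
  by apply: le_trans le _; rewrite /product_const !mulrA.
Qed.

(** Duality: tested against [mu_row k] itself, the mean is the squared norm [M], and Jensen gives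
    [M ^ 4 <= product_const * M ^ 2]. Since the constant is at least 1, it bounds [M]. *)
Lemma mu_row_norm k : \sum_j mu_row k j ^+ 2 <= product_const.
Proof.
set M := \sum_j _.
have M0 : 0 <= M by apply: sumr_ge0 => j _; exact: sqr_ge0.
have E : Ex P (fun w => row_form k a w * row_form k (mu_row k) w) = M.
  by rewrite Ex_product; apply: eq_bigr => j _; rewrite expr2.
have [s le] := product_moment k (mu_row k).
have := le_trans (Ex_fourth_le (measurable_funM (row_form_meas' k a) (row_form_meas' k (mu_row k))) s) le.
rewrite E -/M => {}le; have c1 := product_const_ge1.
rewrite leNgt; apply/negP => cM.
have M1 : 1 < M by exact: le_lt_trans cM.
have : M ^+ 4 <= product_const * M ^+ 2.
  apply: le_trans le _; rewrite ler_wpM2r ?sqr_ge0// /product_const.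
  rewrite ler_peMl//; last by rewrite ler1n.
  by apply: mulr_ge0; [exact: row_form_const_ge0|rewrite addr_ge0// exprn_ge0].
rewrite (_ : M ^+ 4 = M ^+ 2 * M ^+ 2); last by rewrite -exprD.
rewrite ler_pM2r ?exprn_gt0 ?(lt_trans ltr01)// leNgt => /negP; apply.
by rewrite (lt_le_trans cM)// expr2 ler_peMl// ltW.
Qed.

End design.

Lemma partial_sum_sqr d (T : measurableType d) (R : realType) (n p : nat)
    (xi : 'I_n -> 'I_p -> T -> R) (w : T) t : (t <= n)%N ->
  \sum_j partial_sum xi t j w ^+ 2 =
    \sum_(k < n | (k < t)%N) \sum_j xi k j w ^+ 2 + 2 * off_diagonal xi t w.
Proof.
elim: t => [_|t ih tn].
  rewrite /off_diagonal [X in _ = X + _]big_pred0// [X in 2 * X]big_pred0// mulr0 addr0 big1// => j _.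
  by rewrite /partial_sum big_pred0// expr0n.
pose k := Ordinal tn.
rewrite /off_diagonal !(big_ord_prefixS _ k).
have -> : \sum_j partial_sum xi t.+1 j w ^+ 2 = \sum_j partial_sum xi t j w ^+ 2
    + \sum_j xi k j w ^+ 2 + 2 * increment xi k w.
  rewrite -big_split/= mulr_sumr -big_split/=; apply: eq_bigr => j _.
  by rewrite /partial_sum (big_ord_prefixS _ k); ring.
by rewrite ih ?(ltnW tn)// /off_diagonal; ring.
Qed.

(** The scalar core of [design_pointwise]. Products are separated into fourth powers, the only
    functions of the deviations whose expectations are controlled; 400 is a generous common
    constant. *)
Lemma curvature_algebra (R : realType) (B h t f g E rho m1 m2 c : R) :
  0 <= B -> 0 <= h -> 0 <= t -> 0 <= rho -> 0 <= m1 -> 0 <= m2 -> 0 <= c ->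
  t ^+ 4 <= E ->
  B <= `|f| + rho * m2 ->
  h <= 4 * B * (m1 + t) + 4 * c * rho + 4 * `|g| + 2 * rho ^+ 2 * c ->
  B ^+ 2 + h ^+ 2 <=
    400 * (1 + rho ^+ 4 * m2 ^+ 4 + m1 ^+ 4 + c ^+ 2 * rho ^+ 2
      + rho ^+ 4 * c ^+ 2 + rho ^+ 2 * m2 ^+ 2) * (1 + (E + f ^+ 4 + g ^+ 4)).
Proof.
move=> B0 h0 t0 r0 m10 m20 c0 tE BE hE.
have f4 : `|f| ^+ 4 = f ^+ 4 by rewrite -normrX ger0_norm// (sqr_pow_ge0 _ 2).
have f2 : `|f| ^+ 2 = f ^+ 2 by rewrite -normrX ger0_norm// sqr_ge0.
have g2 : `|g| ^+ 2 = g ^+ 2 by rewrite -normrX ger0_norm// sqr_ge0.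
have sq4 (x : R) : x ^+ 2 <= 1 + x ^+ 4.
  have := sqr_ge0 (x ^+ 2 - 1); have := sqr_ge0 (x ^+ 2 + 1).
  by rewrite (_ : x ^+ 4 = (x ^+ 2) ^+ 2) -?exprM//; lra.
have rm0 : 0 <= rho * m2 by exact: mulr_ge0.
have B4 : B ^+ 4 <= 8 * (f ^+ 4 + rho ^+ 4 * m2 ^+ 4).
  apply: (@le_trans _ _ ((`|f| + rho * m2) ^+ 4)).
    by rewrite lerXn2r// nnegrE addr_ge0.
  by apply: le_trans (fourth_power_sum_le _ _) _; rewrite f4 exprMn.
have B2 : B ^+ 2 <= 2 * (1 + f ^+ 4) + 2 * (rho ^+ 2 * m2 ^+ 2).
  apply: (@le_trans _ _ ((`|f| + rho * m2) ^+ 2)).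
    by rewrite lerXn2r// nnegrE addr_ge0.
  have := sqr_ge0 (`|f| - rho * m2); have := sq4 f; rewrite -f2 -exprMn.
  by move: (`|f|) (rho * m2) (f ^+ 4) => x y q; nra.
have mt4 : (m1 + t) ^+ 4 <= 8 * (m1 ^+ 4 + E).
  by apply: le_trans (fourth_power_sum_le _ _) _; lra.
have mt0 : 0 <= m1 + t by exact: addr_ge0.
set X1 := 4 * B * (m1 + t) in hE; set X2 := 4 * c * rho in hE.
set X3 := 4 * `|g| in hE; set X4 := 2 * rho ^+ 2 * c in hE.
have h2 : h ^+ 2 <= 4 * (X1 ^+ 2 + X2 ^+ 2 + X3 ^+ 2 + X4 ^+ 2).
  apply: (@le_trans _ _ ((X1 + X2 + X3 + X4) ^+ 2)).
    by rewrite lerXn2r// nnegrE (le_trans h0).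
  have := sqr_ge0 (X1 - X2); have := sqr_ge0 (X1 - X3); have := sqr_ge0 (X1 - X4).
  have := sqr_ge0 (X2 - X3); have := sqr_ge0 (X2 - X4); have := sqr_ge0 (X3 - X4).
  by lra.
have x1 : X1 ^+ 2 <= 64 * (f ^+ 4 + rho ^+ 4 * m2 ^+ 4 + m1 ^+ 4 + E).
  have -> : X1 ^+ 2 = 16 * (B ^+ 2 * (m1 + t) ^+ 2) by rewrite /X1; ring.
  have := sqr_ge0 (B ^+ 2 - (m1 + t) ^+ 2); rewrite sqrrB -!exprM; lra.
have x2 : X2 ^+ 2 = 16 * (c ^+ 2 * rho ^+ 2) by rewrite /X2; ring.
have x3 : X3 ^+ 2 <= 16 * (1 + g ^+ 4).
  by rewrite /X3 exprMn g2; have := sq4 g; lra.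
have x4 : X4 ^+ 2 = 4 * (rho ^+ 4 * c ^+ 2) by rewrite /X4; ring.
have nn (x : R) : 0 <= x ^+ 4 by exact: (sqr_pow_ge0 _ 2).
have E0 : 0 <= E by apply: le_trans tE.
have y1 : 0 <= rho ^+ 4 * m2 ^+ 4 by rewrite mulr_ge0.
have y2 : 0 <= c ^+ 2 * rho ^+ 2 by rewrite mulr_ge0 ?sqr_ge0.
have y3 : 0 <= rho ^+ 4 * c ^+ 2 by rewrite mulr_ge0 ?sqr_ge0.
have y4 : 0 <= rho ^+ 2 * m2 ^+ 2 by rewrite mulr_ge0 ?sqr_ge0.
set A := 1 + _ + _ + _ + _ + _; set Q := E + f ^+ 4 + g ^+ 4.
have Q0 : 0 <= Q by rewrite !addr_ge0.
have A1 : 1 <= A by have := nn m1; rewrite /A; lra.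
have AQ : A + Q <= A * (1 + Q) by rewrite mulrDr mulr1 lerD2l ler_peMl.
apply: (@le_trans _ _ (400 * (A + Q))); last by rewrite -mulrA ler_wpM2l.
have := nn m1; have := nn f; have := nn g; rewrite /A /Q; lra.
Qed.

Lemma mean_sqr_sum_le (R : realType) (n p : nat) (mu : 'I_n -> 'I_p -> R) c :
  (forall k, \sum_j mu k j ^+ 2 <= c) ->
  \sum_j (\sum_k mu k j) ^+ 2 <= n%:R ^+ 2 * c.
Proof.
move=> muc; apply: (@le_trans _ _ (\sum_j n%:R * \sum_k mu k j ^+ 2)).
  by apply: ler_sum => j _; apply: le_trans (sqr_sum_le _) _; rewrite card_ord.
rewrite -mulr_sumr exchange_big/= expr2 -mulrA ler_wpM2l//.
apply: le_trans (ler_sum _ (fun k _ => muc k)) _.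
by rewrite sumr_const card_ord mulr_natl.
Qed.

(** * Deterministic bound for one realisation of a design *)

Section pointwise.
Context d (T : measurableType d) (R : realType).
Variables (n p : nat) (z : 'I_n -> 'I_p -> T -> R) (a : 'I_p -> R).
Variables (mu nu : 'I_n -> 'I_p -> R) (beta : 'I_n -> R) (rho m1 m2 c : R) (w : T).
Hypothesis p0 : (0 < p)%N.
Hypothesis np : n%:R <= rho * p%:R.
Hypothesis m10 : 0 <= m1.
Hypothesis m20 : 0 <= m2.
Hypothesis c0 : 0 <= c.
Hypothesis mu_c : forall k, \sum_j mu k j ^+ 2 <= c.
Hypothesis nu_m1 : forall k j, nu k j <= m1.
Hypothesis beta_m2 : forall k, beta k <= m2.

Let pR : 1 <= p%:R :> R. Proof. by rewrite ler1n. Qed.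
Let pR0 : 0 < p%:R :> R. Proof. by rewrite ltr0n. Qed.
Let xi k j w := row_form z k a w * z k j w - mu k j.
Let b k := row_form z k a w.
Let e k := (\sum_j (z k j w ^+ 2 - nu k j)) / p%:R.
Let f := (\sum_k (b k ^+ 2 - beta k)) / p%:R.
Let g := off_diagonal xi n w / p%:R ^+ 2.
Let E := \sum_k e k ^+ 4.

(** The vector with coordinates [\sum_k b k * z k j w] is the sum of the [xi k] plus that of the
    means. The squared norm of the first part is the diagonal [\sum_k |xi_k|^2], controlled by row
    norms, plus twice [off_diagonal]. *)
Lemma design_pointwise :
  ((\sum_k b k ^+ 2) / p%:R) ^+ 2 +
    ((\sum_j (\sum_k b k * z k j w) ^+ 2) / p%:R ^+ 2) ^+ 2 <=
  400 * (1 + rho ^+ 4 * m2 ^+ 4 + m1 ^+ 4 + c ^+ 2 * rho ^+ 2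
      + rho ^+ 4 * c ^+ 2 + rho ^+ 2 * m2 ^+ 2) * (1 + (E + f ^+ 4 + g ^+ 4)).
Proof.
have rho0 : 0 <= rho by rewrite -(pmulr_lge0 _ pR0) (le_trans _ np).
have E0 : 0 <= E by apply: sumr_ge0 => k _; exact: (sqr_pow_ge0 _ 2).
(* The fourth root of [E] bounds all row deviations [e k] at once. *)
pose t := Num.sqrt (Num.sqrt E).
have t0 : 0 <= t by exact: sqrtr_ge0.
have tE : t ^+ 4 = E.
  by rewrite (exprM t 2 2) !sqr_sqrtr// sqrtr_ge0.
have et k : `|e k| <= t.
  rewrite -(@ler_pXn2r _ 4)// ?nnegrE// tE -normrX ger0_norm ?(sqr_pow_ge0 _ 2)//.
  by rewrite /E (bigD1 k)//= lerDl sumr_ge0// => i _; exact: (sqr_pow_ge0 _ 2).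
set B := _ / p%:R; set h := _ / p%:R ^+ 2.
have b0 : 0 <= \sum_k b k ^+ 2 by apply: sumr_ge0 => k _; exact: sqr_ge0.
have B0 : 0 <= B by rewrite divr_ge0// ltW.
have h0 : 0 <= h.
  by rewrite divr_ge0 ?sqr_ge0// sumr_ge0// => j _; exact: sqr_ge0.
apply: (curvature_algebra (t := t)) => //; first by rewrite tE.
  rewrite /B (_ : \sum_k b k ^+ 2 = \sum_k (b k ^+ 2 - beta k) + \sum_k beta k); last first.
    by rewrite -big_split/=; apply: eq_bigr => k _; rewrite subrK.
  rewrite mulrDl lerD//; first exact: ler_norm.
  rewrite ler_pdivrMr//; apply: (@le_trans _ _ (n%:R * m2)).
    apply: le_trans (ler_sum _ (fun k _ => beta_m2 k)) _.
    by rewrite sumr_const card_ord mulr_natl.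
  by rewrite mulrAC ler_wpM2r.
have zk k : \sum_j z k j w ^+ 2 <= p%:R * (m1 + t).
  have -> : \sum_j z k j w ^+ 2 = p%:R * e k + \sum_j nu k j.
    rewrite /e mulrC divfK ?gt_eqF// -big_split/=.
    by apply: eq_bigr => j _; rewrite subrK.
  rewrite mulrDr addrC lerD//.
    apply: le_trans (ler_sum _ (fun j _ => nu_m1 k j)) _.
    by rewrite sumr_const card_ord mulr_natl.
  by rewrite ler_wpM2l ?(ltW pR0)//; exact: le_trans (ler_norm _) (et k).
have xik k : \sum_j xi k j w ^+ 2 <= 2 * (p%:R * (m1 + t)) * b k ^+ 2 + 2 * c.
  apply: (@le_trans _ _ (\sum_j (2 * b k ^+ 2 * z k j w ^+ 2 + 2 * mu k j ^+ 2))).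
    apply: ler_sum => j _; rewrite /xi -/(b k).
    have := sqr_ge0 (b k * z k j w + mu k j).
    by move: (b k) (z k j w) (mu k j) => x y u; nra.
  rewrite big_split/= -!mulr_sumr lerD//; last by rewrite ler_wpM2l.
  rewrite mulrAC ler_wpM2r ?sqr_ge0// ler_wpM2l//.
have S2 : \sum_j (\sum_k b k * z k j w) ^+ 2 <=
    2 * (\sum_j partial_sum xi n j w ^+ 2) + 2 * (n%:R ^+ 2 * c).
  apply: (@le_trans _ _ (\sum_j (2 * partial_sum xi n j w ^+ 2 + 2 * (\sum_k mu k j) ^+ 2))).
    apply: ler_sum => j _.
    have -> : \sum_k b k * z k j w = partial_sum xi n j w + \sum_k mu k j.
      rewrite /partial_sum big_ord_prefix_full.
      by rewrite -big_split/=; apply: eq_bigr => k _; rewrite /xi subrK.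
    move: (partial_sum _ _ _ _) (\sum_k _) => x y; have := sqr_ge0 (x - y); lra.
  rewrite big_split/= -!mulr_sumr lerD2l ler_wpM2l//.
  exact: mean_sqr_sum_le.
have S3 : \sum_j partial_sum xi n j w ^+ 2 <=
    2 * (p%:R * (m1 + t)) * (\sum_k b k ^+ 2) + 2 * c * n%:R + 2 * off_diagonal xi n w.
  rewrite partial_sum_sqr// lerD2r.
  rewrite big_ord_prefix_full.
  apply: le_trans (ler_sum _ (fun k _ => xik k)) _.
  by rewrite big_split/= -mulr_sumr sumr_const card_ord mulr_natr.
rewrite /h ler_pdivrMr ?exprn_gt0//.
have gM : off_diagonal xi n w <= `|g| * p%:R ^+ 2.
  rewrite -ler_pdivrMr ?exprn_gt0//; exact: ler_norm.
have BE : \sum_k b k ^+ 2 = B * p%:R by rewrite /B divfK// gt_eqF.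
have nn2 : n%:R ^+ 2 <= (rho * p%:R) ^+ 2 :> R.
  by rewrite lerXn2r// nnegrE// mulr_ge0// ltW.
have n3 : c * n%:R <= c * (rho * p%:R ^+ 2).
  rewrite ler_wpM2l// (le_trans np)// ler_wpM2l// expr2 ler_peMl// ltW.
have n4 : n%:R ^+ 2 * c <= (rho * p%:R) ^+ 2 * c by rewrite ler_wpM2r.
rewrite BE in S3.
apply: le_trans S2 _.
have -> : (4 * B * (m1 + t) + 4 * c * rho + 4 * `|g| + 2 * rho ^+ 2 * c) * p%:R ^+ 2 =
  2 * (2 * (p%:R * (m1 + t)) * (B * p%:R) + 2 * (c * (rho * p%:R ^+ 2)) + 2 * (`|g| * p%:R ^+ 2))
    + 2 * ((rho * p%:R) ^+ 2 * c) by ring.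
by lra.
Qed.

End pointwise.

Lemma summable_scaled_fourth d (T : measurableType d) (R : realType)
    (P : probability T R) (f : T -> R) (q b : R) : 0 < q ->
  summable_rv P (fun w => f w ^+ 4) -> Ex P (fun w => f w ^+ 4) <= b * q ^+ 4 ->
  summable_rv P (fun w => (f w / q) ^+ 4) /\ Ex P (fun w => (f w / q) ^+ 4) <= b.
Proof.
move=> q0 s le.
have E w : (f w / q) ^+ 4 = (q ^+ 4)^-1 * f w ^+ 4 by rewrite exprMn exprVn mulrC.
split; first by apply: (summable_ext (fun w => esym (E w))); exact: summableZ.
by rewrite (Ex_ext _ E) ExZ// mulrC ler_pdivrMr ?exprn_gt0.
Qed.

Section design_control.
Context (R : realType).
Variables (m alpha rho : R).
Hypothesis m0 : 0 <= m.
Hypothesis alpha0 : 0 <= alpha.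
Hypothesis rho0 : 0 <= rho.

(* When the [a i] are the columns of [Sigma^(1/2)], the two terms controlled here
   are the squares of [p^-1 |X e_i|^2] and [p^-2 |Z^T X e_i|^2].  The random
   variable [S] does not depend on [i]: its mean is of order [1 / p] although it
   dominates the deviations of all [p] columns, because the deviations of a single
   column have fourth moments of order [p^-2]. *)
Lemma design_control : exists2 C : R, 0 < C &
  forall d (T : measurableType d) (P : probability T R) (n p : nat)
    (z : 'I_n -> 'I_p -> T -> R) (a : 'I_p -> 'I_p -> R),
  (0 < p)%N -> n%:R <= rho * p%:R ->
  (forall k j, measurable_fun setT (z k j)) ->
  mutually_independent P (fun kj : 'I_n * 'I_p =>
    sigma_of (@measurable _ R) (fun w => z kj.1 kj.2 w)) ->
  (forall k j, Ex P (z k j) = 0) ->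
  (forall k j, summable_rv P (fun w => z k j w ^+ 8)) ->
  (forall k j, Ex P (fun w => z k j w ^+ 8) <= m) ->
  (forall i, \sum_j a i j ^+ 2 <= alpha) ->
  exists S : T -> R,
    [/\ forall w, 0 <= S w, summable_rv P S, Ex P S <= C / p%:R &
      forall w i,
        ((\sum_k row_form z k (a i) w ^+ 2) / p%:R) ^+ 2 +
        ((\sum_j (\sum_k row_form z k (a i) w * z k j w) ^+ 2) / p%:R ^+ 2) ^+ 2
          <= C * (1 + S w)].
Proof.
set m1 := 1 + m; set m2 := 1 + row_form_const m * alpha ^+ 4; set c := product_const m alpha.
have m10 : 0 <= m1 by rewrite addr_ge0.
have row_form_const0 : 0 <= row_form_const m := le_trans ler01 (row_form_const_ge1 m0).
have m20 : 0 <= m2 by rewrite addr_ge0// mulr_ge0// exprn_ge0.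
have deviation_const0 (b : R) : 0 <= deviation_const b by exact: sqr_ge0.
set A := 400 * (1 + rho ^+ 4 * m2 ^+ 4 + m1 ^+ 4 + c ^+ 2 * rho ^+ 2
      + rho ^+ 4 * c ^+ 2 + rho ^+ 2 * m2 ^+ 2).
have A0 : 0 < A.
  have := mulr_ge0 (exprn_ge0 4 rho0) (exprn_ge0 4 m20); have := exprn_ge0 4 m10.
  have := mulr_ge0 (sqr_ge0 c) (sqr_ge0 rho); have := mulr_ge0 (sqr_ge0 rho) (sqr_ge0 m2).
  have := mulr_ge0 (exprn_ge0 4 rho0) (sqr_ge0 c); rewrite /A; lra.
set Kg := 70 * c ^+ 2 * (4 * 2 ^+ 4 * (1 + c)) ^+ 2.
have Kg0 : 0 <= Kg by rewrite /Kg mulr_ge0 ?sqr_ge0// mulr_ge0 ?sqr_ge0.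
set A' := rho * deviation_const (16 * m) + rho ^+ 2 * deviation_const (16 * (row_form_const m * alpha ^+ 4)) + rho ^+ 4 * Kg.
have A'0 : 0 <= A'.
  have := mulr_ge0 rho0 (deviation_const0 (16 * m)); have := mulr_ge0 (exprn_ge0 4 rho0) Kg0.
  have := mulr_ge0 (exprn_ge0 2 rho0) (deviation_const0 (16 * (row_form_const m * alpha ^+ 4))).
  by rewrite /A'; lra.
exists (A + A'); first by rewrite ltr_wpDr.
move=> d T P n p z a p0 np mz Find z_mean sz z_mom a_norm.
have pR0 : 0 < p%:R :> R by rewrite ltr0n.
have n0 : 0 <= n%:R :> R by [].
pose nu k j := Ex P (fun w => z k j w ^+ 2).
pose mu i k j := mu_row P z (a i) k j.
pose beta i k := Ex P (fun w => row_form z k (a i) w ^+ 2).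
pose e k w := (\sum_j (z k j w ^+ 2 - nu k j)) / p%:R.
pose f i w := (\sum_k (row_form z k (a i) w ^+ 2 - beta i k)) / p%:R.
pose g i w := off_diagonal (xi_row P z (a i)) n w / p%:R ^+ 2.
have eP k : summable_rv P (fun w => e k w ^+ 4) /\
    Ex P (fun w => e k w ^+ 4) <= deviation_const (16 * m) / p%:R ^+ 2.
  have [s le] := entry_square_deviation mz Find sz z_mom m0 k.
  apply: summable_scaled_fourth => //; apply: le_trans le _.
  by rewrite le_eqVlt; apply/orP; left; apply/eqP; field; exact: lt0r_neq0.
have fP i : summable_rv P (fun w => f i w ^+ 4) /\
    Ex P (fun w => f i w ^+ 4) <= deviation_const (16 * (row_form_const m * alpha ^+ 4)) * n%:R ^+ 2 / p%:R ^+ 4.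
  have [s le] := row_form_deviation mz Find z_mean sz z_mom m0 (a_norm i).
  apply: summable_scaled_fourth => //; apply: le_trans le _.
  by rewrite le_eqVlt; apply/orP; left; apply/eqP; field; exact: lt0r_neq0.
have gP i : summable_rv P (fun w => g i w ^+ 4) /\
    Ex P (fun w => g i w ^+ 4) <= Kg * n%:R ^+ 4 / p%:R ^+ 6.
  have [s le] := xi_row_off_diagonal mz Find z_mean sz z_mom m0 (a_norm i).
  apply: summable_scaled_fourth => //; first by rewrite exprn_gt0.
  apply: le_trans le _.
  by rewrite le_eqVlt; apply/orP; left; apply/eqP; rewrite /Kg /c; field; exact: lt0r_neq0.
(* The row deviations [e k] are common to all columns; [f i] and [g i] are summed over the columns.
   That makes [n] and [2 p] terms of order [p ^ -2]. *)
pose S w := \sum_k e k w ^+ 4 + \sum_i (f i w ^+ 4 + g i w ^+ 4).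
have nn (x : R) : 0 <= x ^+ 4 by exact: (sqr_pow_ge0 _ 2).
have S1 : summable_rv P (fun w => \sum_k e k w ^+ 4).
  by apply: summable_sum => k _; have [] := eP k.
have S2 : summable_rv P (fun w => \sum_i (f i w ^+ 4 + g i w ^+ 4)).
  apply: summable_sum => i _; apply: summableD; first by have [] := fP i.
  by have [] := gP i.
exists S; split.
- by move=> w; rewrite addr_ge0// sumr_ge0// => i _; rewrite addr_ge0.
- exact: summableD.
- rewrite ExD// Ex_sum; last by move=> k _; have [] := eP k.
  rewrite Ex_sum; last first.
    by move=> i _; apply: summableD; [have [] := fP i|have [] := gP i].
  apply: (@le_trans _ _ (A' / p%:R)); last first.
    by rewrite ler_wpM2r ?invr_ge0 ?(ltW pR0)// lerDr ltW.
  rewrite /A' mulrDl; apply: (@le_trans _ _ (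
    n%:R * (deviation_const (16 * m) / p%:R ^+ 2) +
    p%:R * (deviation_const (16 * (row_form_const m * alpha ^+ 4)) * n%:R ^+ 2 / p%:R ^+ 4 + Kg * n%:R ^+ 4 / p%:R ^+ 6))).
    apply: lerD.
      apply: le_trans (ler_sum _ (fun k _ => (eP k).2)) _.
      by rewrite sumr_const card_ord -[leLHS]mulr_natl.
    rewrite [leRHS]mulr_natl -[X in _ *+ X](card_ord p) -sumr_const; apply: ler_sum => i _.
    rewrite ExD; [|by have [] := fP i|by have [] := gP i].
    by apply: lerD; [have [] := fP i|have [] := gP i].
  have -> : p%:R * (deviation_const (16 * (row_form_const m * alpha ^+ 4)) * n%:R ^+ 2 / p%:R ^+ 4 + Kg * n%:R ^+ 4 / p%:R ^+ 6)
    = (n%:R / p%:R) ^+ 2 * deviation_const (16 * (row_form_const m * alpha ^+ 4)) / p%:R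
     + (n%:R / p%:R) ^+ 4 * Kg / p%:R.
    by field; exact: lt0r_neq0.
  have -> : n%:R * (deviation_const (16 * m) / p%:R ^+ 2) = (n%:R / p%:R) * deviation_const (16 * m) / p%:R.
    by field; exact: lt0r_neq0.
  have h : n%:R / p%:R <= rho by rewrite ler_pdivrMr.
  have hp : 0 <= n%:R / p%:R :> R by rewrite divr_ge0// ltW.
  have pV : 0 <= p%:R^-1 :> R by rewrite invr_ge0 ltW.
  rewrite addrA -!mulrDl ler_wpM2r// !lerD// ler_wpM2r// lerXn2r// nnegrE.
- move=> w i.
  have le := @design_pointwise _ _ _ _ _ z (a i) (mu i) nu (beta i) rho m1 m2 c w p0 np m10 m20 _ _ _ _.
  apply: le_trans (le _ _ _ _) _.
  + exact: le_trans (product_const_ge1 m0 (a_norm i)).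
  + by move=> k; exact: (mu_row_norm mz Find z_mean sz z_mom m0 (a_norm i)).
  + move=> k j; apply: le_trans (@Ex_lower_power _ _ _ P _ 2 4 _ (mz k j) (sz k j)) _ => //.
    by rewrite lerD2l.
  + move=> k.
    have [s lem] := row_form_moment mz Find z_mean sz z_mom m0 k (a i).
    have mr : measurable_fun setT (row_form z k (a i)).
      apply: measurable_sum => j; apply: measurable_funM => //.
    apply: le_trans (@Ex_lower_power _ _ _ P _ 2 4 _ mr s) _ => //.
    rewrite lerD2l; apply: le_trans lem _; rewrite ler_wpM2l//.
    by rewrite lerXn2r// nnegrE// sumr_ge0// => j _; exact: sqr_ge0.
  rewrite -/A; apply: ler_pM => //.
  + exact: ltW.
  + by rewrite !addr_ge0// sumr_ge0.
  + by rewrite lerDl.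
  + by rewrite lerD2l /S -addrA lerD2l (bigD1 i)//= lerDl sumr_ge0// => j _; rewrite addr_ge0.
Qed.

End design_control.

(** * Exponential moments *)

Section exponential_moments.
Context d (T : measurableType d) (R : realType) (P : probability T R).

(** The sum of the geometric series with first term [2 expR 1] and ratio [expR (- 1 / 2)]. *)
Definition gauss_const : R := 2 * expR 1 / (1 - expR (- 2^-1)).

Let ratio_lt1 : expR (- 2^-1) < 1 :> R.
Proof. by rewrite -[ltRHS]expR0 ltr_expR oppr_lt0. Qed.

Lemma gauss_const_ge1 : 1 <= gauss_const.
Proof.
have h : 0 < 1 - expR (- 2^-1) :> R by rewrite subr_gt0 ratio_lt1.
rewrite /gauss_const ler_pdivlMr// mul1r.
have := expR_gt0 (- 2^-1 : R); have := expR_ge1Dx (1 : R); lra.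
Qed.

(* Choosing [m = floor (|y| / 2)] in the exponent [m |y| - m ^ 2] nearly
   attains its maximum [y ^ 2 / 4], so the Gaussian-type weight is dominated by
   a summable combination of the exponentials [exp (m y)]. *)
Lemma sqr_exp_le (y : R) :
  let m := Num.truncn (`|y| / 2) in
  expR (y ^+ 2 / 4) <=
    expR (1 - m%:R ^+ 2) * (expR (m%:R * y) + expR (- m%:R * y)).
Proof.
set m := Num.truncn _ => /=.
have /andP[m1 m2] := @truncn_itv R (`|y| / 2) ltac:(by rewrite divr_ge0).
rewrite -/m -[m.+1%:R]natr1 in m1 m2.
apply: (@le_trans _ _ (expR (1 - m%:R ^+ 2) * expR (m%:R * `|y|))).
  rewrite -expRD ler_expR -[y ^+ 2]real_normK ?num_real//.
  move: (m%:R) (`|y|) m1 m2 => k x kx xk.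
  have : 0 <= (1 - (x / 2 - k)) * (1 + (x / 2 - k)) by apply: mulr_ge0; lra.
  lra.
rewrite ler_wpM2l ?expR_ge0//.
have [y0|y0] := leP 0 y; first by rewrite ger0_norm// lerDl expR_ge0.
by rewrite ltr0_norm// mulrN mulNr lerDr expR_ge0.
Qed.

(** After scaling by [tau], [sqr_exp_le] bounds the weight by one term of a series of exponentials,
    hence by the whole series, which is integrated term by term. *)
Lemma subgauss_exp_sqr (x : T -> R) (tau : R) : measurable_fun setT x -> 0 < tau ->
  (forall s : R, (\int[P]_w (expR (s * x w))%:E <= (expR (s ^+ 2 * tau ^+ 2 / 2))%:E)%E) ->
  (\int[P]_w (expR (x w ^+ 2 / (4 * tau ^+ 2)))%:E <= gauss_const%:E)%E.
Proof.
move=> mx tau0 mgf; pose y w := x w / tau.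
have my : measurable_fun setT y by exact: measurable_funM.
have mexp (f : T -> R) : measurable_fun setT f -> measurable_fun setT (fun w => expR (f w)).
  by move=> mf; apply: measurableT_comp => //; exact: measurable_expR.
have yE (s : R) : (\int[P]_w (expR (s * y w))%:E <= (expR (s ^+ 2 / 2))%:E)%E.
  have := mgf (s / tau).
  have -> : (s / tau) ^+ 2 * tau ^+ 2 / 2 = s ^+ 2 / 2 by field; exact: lt0r_neq0.
  apply: le_trans; rewrite le_eqVlt; apply/orP; left; apply/eqP.
  by apply: eq_integral => w _; rewrite /y mulrA mulrAC.
have es (s : R) : summable_rv P (fun w => expR (s * y w)) /\
    Ex P (fun w => expR (s * y w)) <= expR (s ^+ 2 / 2).
  by apply: ge0_summable => //; apply: mexp; exact: measurable_funM.
pose f m w := expR (1 - m%:R ^+ 2) * (expR (m%:R * y w) + expR (- m%:R * y w)).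
have f0 m w : 0 <= f m w by rewrite mulr_ge0 ?addr_ge0 ?expR_ge0.
have mf m : measurable_fun setT (f m).
  apply: measurable_funM => //; apply: measurable_funD; apply: mexp; exact: measurable_funM.
have intf m : (\int[P]_w (f m w)%:E <= (2 * expR 1 * expR (- 2^-1) ^+ m)%:E)%E.
  have [s1 e1] := es m%:R; have [s2 e2] := es (- m%:R).
  rewrite (ExE (summableZ _ (summableD s1 s2))) lee_fin ExZ; last exact: summableD.
  rewrite ExD// sqrrN in e2 *.
  apply: (@le_trans _ _ (expR (1 - m%:R ^+ 2) * (2 * expR (m%:R ^+ 2 / 2)))).
    by rewrite ler_wpM2l ?expR_ge0//; lra.
  (* The exponent is [1 - m ^ 2 / 2]; since [m <= m ^ 2] for natural numbers, the terms decay
     geometrically. *)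
  rewrite mulrCA -mulrA ler_wpM2l// -expRD -expRM_natl -expRD ler_expR.
  have : (m%:R : R) <= m%:R ^+ 2 by rewrite -natrX ler_nat; case: (m) => // k; rewrite expnS leq_pmulr// expn_gt0.
  lra.
have le1 w : ((expR (x w ^+ 2 / (4 * tau ^+ 2)))%:E <= \sum_(m <oo) (f m w)%:E)%E.
  have -> : x w ^+ 2 / (4 * tau ^+ 2) = y w ^+ 2 / 4 by rewrite /y; field; exact: lt0r_neq0.
  apply: (@le_trans _ _ (f (Num.truncn (`|y w| / 2)) w)%:E).
    by rewrite lee_fin; exact: sqr_exp_le.
  rewrite (nneseriesD1 (n := Num.truncn (`|y w| / 2)))//; last by move=> k _; rewrite lee_fin.
  by rewrite leeDl// nneseries_ge0// => k _ _; rewrite lee_fin.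
apply: (@le_trans _ _ (\int[P]_w (\sum_(m <oo) (f m w)%:E))%E).
  apply: ge0_le_integral => //.
  - apply/measurable_EFinP; apply: mexp; apply: measurable_funM => //.
    exact: measurable_funX.
  - apply: ge0_emeasurable_sum => //.
    + by move=> m w _ _; rewrite lee_fin.
    + by move=> m _; exact/measurable_EFinP.
rewrite integral_nneseries//; last 2 first.
- by move=> m; exact/measurable_EFinP.
- by move=> m w _; rewrite lee_fin.
apply: lime_le.
  by apply: is_cvg_nneseries => m _ _; apply: integral_ge0 => w _; rewrite lee_fin.
apply: nearW => k.
apply: (@le_trans _ _ (\sum_(0 <= m < k) (2 * expR 1 * expR (- 2^-1) ^+ m)%:E)%E).
  by apply: lee_sum => m _.
rewrite sumEFin lee_fin.
have := @geometric_seriesE R (2 * expR 1) (expR (- 2^-1)) (negbT (lt_eqF ratio_lt1)).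
move=> /(congr1 (fun u => u k)) /= E.
rewrite [leLHS](_ : _ = series (geometric (2 * expR 1) (expR (- 2^-1))) k)// E.
rewrite /gauss_const ler_wpM2r ?invr_ge0 ?subr_ge0 ?(ltW ratio_lt1)//.
rewrite ler_piMr ?mulr_ge0 ?expR_ge0// lerBlDr lerDl exprn_ge0// expR_ge0.
Qed.

(** The tangent line at [- x] gives [expR x - 1 <= x * expR x]; this is used twice for positive [x],
    and once together with [x <= expR x - 1] for negative [x]. *)
Lemma expR_le_quadratic (x : R) : expR x <= 1 + x + x ^+ 2 * expR `|x|.
Proof.
have h1 : 1 + x <= expR x := expR_ge1Dx x.
have h2 : 1 - x <= expR (- x) by exact: expR_ge1Dx.
have h3 : expR x * expR (- x) = 1 by rewrite -expRD subrr expR0.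
have h4 := expR_gt0 x.
have h5 : expR x - 1 <= x * expR x.
  by have := ler_wpM2l (ltW h4) h2; rewrite h3; lra.
have [x0|x0] := leP 0 x.
  rewrite ger0_norm//; have := ler_wpM2l x0 h5.
  by rewrite expr2 mulrA; lra.
have h6 : 1 <= expR `|x| by rewrite -[leLHS]expR0 ler_expR.
have h7 : x * (expR x - 1) <= x ^+ 2.
  by rewrite expr2 ler_wnM2l ?(ltW x0)//; lra.
have h8 : x ^+ 2 <= x ^+ 2 * expR `|x| by rewrite ler_peMr ?sqr_ge0.
lra.
Qed.

(** The linear term of the quadratic bound vanishes. With [D = |Y| + C], the remainder is at most
    [s ^ 2 D ^ 2 expR (D / 2)], because [|s| <= 1 / 2], and [D ^ 2 <= 16 expR (D / 2)] leaves
    [16 s ^ 2 expR C expR |Y|], whose mean is bounded by assumption. *)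
Lemma centered_mgf (Y : T -> R) (C s : R) : measurable_fun setT Y ->
  (\int[P]_w (expR `|Y w|)%:E <= C%:E)%E -> `|s| <= 2^-1 ->
  [/\ summable_rv P Y, summable_rv P (fun w => expR (s * (Y w - Ex P Y))) &
    Ex P (fun w => expR (s * (Y w - Ex P Y))) <= expR (16 * C * expR C * s ^+ 2)].
Proof.
move=> mY intC s2.
have mexp (f : T -> R) : measurable_fun setT f -> measurable_fun setT (fun w => expR (f w)).
  by move=> mf; apply: measurableT_comp => //; exact: measurable_expR.
have mnY : measurable_fun setT (fun w => `|Y w|) by exact: measurableT_comp.
have [se le] : summable_rv P (fun w => expR `|Y w|) /\ Ex P (fun w => expR `|Y w|) <= C.
  by apply: ge0_summable => //; exact: mexp.
have le_exp w : `|Y w| <= expR `|Y w| by have := expR_ge1Dx `|Y w|; lra.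
have sY : summable_rv P Y by exact: summable_le se.
set mu := Ex P Y.
have muC : `|mu| <= C.
  apply: le_trans (Ex_norm sY) _; apply: le_trans le.
  by apply: Ex_le => //; exact: summable_norm.
have C0 : 0 <= C by apply: le_trans muC.
pose g w := 1 + s * (Y w - mu) + 16 * s ^+ 2 * expR C * expR `|Y w|.
have sg : summable_rv P g.
  apply: summableD; last exact: summableZ.
  apply: summableD; first exact: summable_cst.
  by apply: summableZ; apply: summableB => //; exact: summable_cst.
have leg w : expR (s * (Y w - mu)) <= g w.
  apply: le_trans (expR_le_quadratic _) _; rewrite lerD2l.
  set D := `|Y w| + C.
  have D0 : 0 <= D by rewrite addr_ge0.
  have YD : `|Y w - mu| <= D by apply: le_trans (ler_normB _ _) _; rewrite lerD2l.
  have sD : `|s * (Y w - mu)| <= D / 2.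
    by rewrite normrM mulrC ler_pM.
  have Yd2 : (Y w - mu) ^+ 2 <= D ^+ 2.
    by rewrite -[leLHS]real_normK ?num_real// lerXn2r// nnegrE.
  have D16 : D ^+ 2 <= 16 * expR (D / 2).
    have -> : expR (D / 2) = expR (D / 4) ^+ 2.
      by rewrite -expRM_natl; congr expR; field.
    have h := expR_ge1Dx (D / 4).
    have : D <= 4 * expR (D / 4) by lra.
    by move: (expR _) => X; nra.
  apply: (@le_trans _ _ (s ^+ 2 * (16 * expR (D / 2)) * expR (D / 2))).
    rewrite exprMn; apply: ler_pM => //.
    - by rewrite mulr_ge0 ?sqr_ge0.
    - by rewrite ler_wpM2l ?sqr_ge0// (le_trans Yd2).
    - by rewrite ler_expR.
  rewrite [X in X * _](_ : _ = 16 * s ^+ 2 * expR (D / 2)); last by ring.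
  rewrite -mulrA -expRD -splitr /D expRD [expR `|_| * _]mulrC mulrA.
  by rewrite lexx.
have ss : summable_rv P (fun w => expR (s * (Y w - mu))).
  apply: summable_le sg; last by move=> w; rewrite ger0_norm ?expR_ge0.
  by apply: mexp; apply: measurable_funM => //; apply: measurable_funB.
split => //; apply: le_trans (Ex_le ss sg leg) _.
rewrite ExD; last 2 first.
- apply: summableD; first exact: summable_cst.
  by apply: summableZ; apply: summableB => //; exact: summable_cst.
- exact: summableZ.
rewrite ExD; last 2 first.
- exact: summable_cst.
- by apply: summableZ; apply: summableB => //; exact: summable_cst.
rewrite Ex_cst ExZ; last by apply: summableB => //; exact: summable_cst.
rewrite ExB//; last exact: summable_cst.
rewrite Ex_cst subrr mulr0 addr0 ExZ//.
apply: le_trans (expR_ge1Dx _); rewrite lerD2l.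
apply: (@le_trans _ _ (16 * s ^+ 2 * expR C * C)).
  apply: ler_wpM2l => //; apply: mulr_ge0; last exact: expR_ge0.
  by rewrite mulr_ge0 ?sqr_ge0.
by rewrite le_eqVlt; apply/orP; left; apply/eqP; ring.
Qed.

Lemma Ex_prod_steps n G (H : 'I_n -> set_system T) (y : 'I_n -> T -> R) t :
  independent_steps P G H -> (forall i, meas_wrt (H i) (y i)) ->
  (forall i, summable_rv P (y i)) -> (t <= n)%N ->
  [/\ meas_wrt (G t) (fun w => \prod_(i < n | (i < t)%N) y i w),
     summable_rv P (fun w => \prod_(i < n | (i < t)%N) y i w) &
     Ex P (fun w => \prod_(i < n | (i < t)%N) y i w) = \prod_(i < n | (i < t)%N) Ex P (y i)].
Proof.
move=> st my sy; elim: t => [_|t ih tn].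
  have E : (fun w => \prod_(i < n | (i < 0)%N) y i w) = fun=> 1.
    by apply/funext => w; rewrite big_pred0.
  by rewrite E Ex_cst big_pred0//; split => //; exact: summable_cst.
have [mp sp ep] := ih (ltnW tn); pose k := Ordinal tn.
have bigS (V : comNzRingType) (F : 'I_n -> V) :
    \prod_(i < n | (i < t.+1)%N) F i = \prod_(i < n | (i < t)%N) F i * F k.
  rewrite (bigD1 k)//= mulrC; congr (_ * _); apply: eq_bigl => i.
  by rewrite ltnS ltn_neqAle andbC -val_eqE.
have [s e] := ExM_indep (past_measurable st (t := t)) (present_measurable st (t := k))
  (past_present_independent st (t := k)) mp (my k) sp (sy k).
have E : (fun w => \prod_(i < n | (i < t.+1)%N) y i w) =
    (fun w => \prod_(i < n | (i < t)%N) y i w * y k w).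
  by apply/funext => w; rewrite bigS.
rewrite E bigS -ep; split => //; apply: meas_wrtM.
  exact: meas_wrt_sub (past_past st (t := t)) mp.
exact: meas_wrt_sub (present_past st (t := k)) (my k).
Qed.

Lemma markov_ge1 (f : T -> R) : (forall w, 0 <= f w) -> summable_rv P f ->
  measurable [set w | 1 <= f w] /\ (P [set w | (1 <= f w)%R] <= (Ex P f)%:E)%E.
Proof.
move=> f0 sf; have mf := summable_meas sf.
have mA : measurable [set w | 1 <= f w].
  rewrite (_ : [set w | 1 <= f w] = f @^-1` `[1, +oo[%classic); last first.
    by apply/seteqP; split => w /=; rewrite in_itv/= andbT.
  by rewrite -[_ @^-1` _]setTI; exact: mf.
split => //.
rewrite -ExE// -[X in P X]setIT -integral_indic//; apply: ge0_le_integral => //.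
- by apply/measurable_EFinP; exact: measurable_indic.
- exact/measurable_EFinP.
move=> w _; rewrite lee_fin indicE; case: (boolP (w \in _)) => [|_]; first by rewrite inE.
by rewrite f0.
Qed.

End exponential_moments.

(** * Largest eigenvalue *)

Section rayleigh.
Context (R : realType) (n : nat).
Variable A : 'M[R]_n.
Hypothesis Asym : A^T = A.

Let q (u : 'rV[R]_n) : R := (u *m A *m u^T) 0 0.
Let N (u : 'rV[R]_n) : R := (u *m u^T) 0 0.

Let NE u : N u = \sum_i u 0 i ^+ 2.
Proof. by rewrite /N mxE; apply: eq_bigr => i _; rewrite mxE expr2. Qed.

Let qE u : q u = \sum_j (\sum_i u 0 i * A i j) * u 0 j.
Proof. by rewrite /q mxE; apply: eq_bigr => j _; rewrite !mxE. Qed.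

Let cont_sum (I : Type) (r : seq I) (f : I -> 'rV[R]_n -> R) :
  (forall i, continuous (f i)) -> continuous (fun u => \sum_(i <- r) f i u).
Proof.
move=> cf; elim: r => [|i r ih].
  rewrite (_ : (fun u => _) = fun=> 0); first exact: cst_continuous.
  by apply/funext => u; rewrite big_nil.
rewrite (_ : (fun u => _) = (f i \+ fun u => \sum_(j <- r) f j u)).
  by move=> u; apply: continuousD; [exact: cf | exact: ih].
by apply/funext => u; rewrite big_cons.
Qed.

Let cont_coord i : continuous (fun u : 'rV[R]_n => u 0 i).
Proof. exact: coord_continuous. Qed.

Let q_cont : continuous q.
Proof.
rewrite (funext qE).
refine (@cont_sum _ (index_enum _) (fun j u => (\sum_i u 0 i * A i j) * u 0 j) _) => j u.
apply: continuousM; last exact: cont_coord.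
refine (@cont_sum _ (index_enum _) (fun i u => u 0 i * A i j) _ u) => i v.
by apply: continuousM; [exact: cont_coord | exact: cst_continuous].
Qed.

Let N_cont : continuous N.
Proof.
rewrite (funext NE).
refine (@cont_sum _ (index_enum _) (fun i u => u 0 i ^+ 2) _) => j u.
by apply: continuousM; exact: cont_coord.
Qed.

Let N_ge0 u : 0 <= N u.
Proof. by rewrite NE sumr_ge0// => i _; exact: sqr_ge0. Qed.

Let N_eq0 u : N u = 0 -> u = 0.
Proof.
rewrite NE => u0; apply/rowP => i; rewrite mxE.
have /eqP := psumr_eq0P (fun j _ => sqr_ge0 (u 0 j)) u0 (i := i) isT.
by rewrite sqrf_eq0 => /eqP.
Qed.

Let qZ c u : q (c *: u) = c ^+ 2 * q u.
Proof. by rewrite /q linearZ/= -!scalemxAl -scalemxAr !mxE; ring. Qed.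

Let NZ c u : N (c *: u) = c ^+ 2 * N u.
Proof. by rewrite /N linearZ/= -scalemxAl -scalemxAr !mxE; ring. Qed.

Let sphere : set 'rV[R]_n := [set u | N u = 1].

Let sphere_compact : compact sphere.
Proof.
pose box := [set u : 'rV[R]_n | forall i, [set x : R | x \in `[-1, 1]] (u ord0 i)].
have cbox : compact box.
  refine (@rV_compact R n (fun=> [set x : R | x \in `[-1, 1]]) _) => i; exact: segment_compact.
apply: (subclosed_compact _ cbox).
  rewrite (_ : sphere = N @^-1` [set 1]) //; apply: (@preimage_closed _ _ N) => [u _|]; [exact: N_cont | exact: closed_eq].
move=> u Nu i /=; rewrite in_itv/= -ler_norml -(@ler_pXn2r _ 2)// ?nnegrE//.
rewrite expr1n -Nu NE real_normK ?num_real// (bigD1 i)//= lerDl.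
by rewrite sumr_ge0// => j _; exact: sqr_ge0.
Qed.

Hypothesis n0 : (0 < n)%N.

Let sphere_nonempty : sphere !=set0.
Proof.
exists (delta_mx 0 (Ordinal n0)); rewrite /sphere/= NE (bigD1 (Ordinal n0))//=.
rewrite mxE !eqxx expr1n big1 ?addr0// => i ij.
by rewrite mxE (negbTE ij) andbF expr0n.
Qed.

(** Variational argument: the quadratic form attains a maximum [s] on the compact unit sphere at
    some [u0], and maximality forces the residual [s *: u0 - u0 *m A] to vanish. So [s] is an
    eigenvalue, hence at most the supremum. *)
Lemma rayleigh_row (u : 'rV[R]_n) : (u *m A *m u^T) 0 0 <= lambda_max A * (u *m u^T) 0 0.
Proof.
have [u0 + u0max] := compact_EVT_max sphere_nonempty sphere_compact (continuous_subspaceT q_cont).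
rewrite inE => u01; set s := q u0 in u0max.
have qs v : q v <= s * N v.
  have [v0|v0] := eqVneq (N v) 0.
    by rewrite v0 mulr0 (N_eq0 v0) /q !mul0mx mxE.
  have Np : 0 < N v by rewrite lt_neqAle eq_sym v0 N_ge0.
  have sq0 : 0 < Num.sqrt (N v) by rewrite sqrtr_gt0.
  have := u0max ((Num.sqrt (N v))^-1 *: v); rewrite inE /sphere/= NZ exprVn sqr_sqrtr ?N_ge0//.
  rewrite mulVf// => /(_ erefl); rewrite qZ exprVn sqr_sqrtr ?N_ge0// mulrC.
  by rewrite ler_pdivrMr.
have [w wE] : {w | w = s *: u0 - u0 *m A} by exists (s *: u0 - u0 *m A).
have expand t : s * N (u0 + t *: w) - q (u0 + t *: w) =
    2 * t * N w + t ^+ 2 * (s * N w - q w).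
  have tr : (u0 + t *: w)^T = u0^T + t *: w^T by rewrite linearD/= linearZ.
  have E1 : N (u0 + t *: w) = N u0 + 2 * t * (u0 *m w^T) 0 0 + t ^+ 2 * N w.
    rewrite /N tr mulmxDl !mulmxDr -!scalemxAl -!scalemxAr.
    have -> : w *m u0^T = (u0 *m w^T)^T by rewrite trmx_mul trmxK.
    by rewrite !mxE; ring.
  have E2 : q (u0 + t *: w) = q u0 + 2 * t * (u0 *m A *m w^T) 0 0 + t ^+ 2 * q w.
    rewrite /q tr !mulmxDl !mulmxDr -!scalemxAl -!scalemxAr.
    have -> : w *m A *m u0^T = (u0 *m A *m w^T)^T.
      by rewrite !trmx_mul trmxK Asym mulmxA.
    move: (u0 *m A *m u0^T) (u0 *m A *m w^T) (w *m A *m w^T) => X Y W.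
    by rewrite !mxE; ring.
  have E3 : s * (u0 *m w^T) 0 0 - (u0 *m A *m w^T) 0 0 = N w.
    have -> : N w = ((s *: u0 - u0 *m A) *m w^T) 0 0 by rewrite -wE.
    rewrite mulmxBl -scalemxAl.
    by move: (u0 *m w^T) (u0 *m A *m w^T) => X Y; rewrite !mxE.
  rewrite E1 E2 -/s u01 -E3; ring.
have w0 : w = 0.
  apply: N_eq0; apply/eqP; rewrite eq_le N_ge0 andbT leNgt; apply/negP => Nw.
  set r := s * N w - q w in expand.
  have r0 : 0 <= r by rewrite subr_ge0.
  (* A step short enough that, along [- w], the first-order gain [2 e N w] beats the second-order
     term [e ^ 2 r]; the summand 1 covers [r = 0]. *)
  pose e := N w / (r + 1).
  have e0 : 0 < e by rewrite divr_gt0// ltr_wpDl.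
  have := qs (u0 + (- e) *: w); rewrite -subr_ge0 expand.
  have er : e * r <= N w by rewrite /e mulrAC ler_pdivrMr ?ltr_wpDl// ler_wpM2l ?N_ge0// lerDl.
  have : e * (e * r) <= e * N w by rewrite ler_wpM2l// ltW.
  have : 0 < e * N w by rewrite mulr_gt0.
  by rewrite sqrrN expr2; lra.
have u00 : u0 != 0.
  by apply/eqP => u00; move: u01; rewrite u00 /sphere/= /N mul0mx mxE => /esym/eqP; rewrite oner_eq0.
have eig : eigenvalue A s.
  by apply/eigenvalueP; exists u0 => //; apply/esym/eqP; rewrite -subr_eq0 -wE w0.
(* Boundedness of the set of eigenvalues makes its [sup] a genuine upper bound. *)
have bounded a : eigenvalue A a -> a <= s.
  move=> /eigenvalueP[v vA v0]; have := qs v.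
  rewrite {1}/q vA -scalemxAl mxE -/(N v) ler_pM2r// lt_neqAle N_ge0 andbT eq_sym.
  by apply/negP => /eqP /N_eq0 /eqP; rewrite (negbTE v0).
apply: le_trans (qs u) _; rewrite ler_wpM2r ?N_ge0//.
by apply: ub_le_sup => //; exists s => a; exact: bounded.
Qed.

End rayleigh.

Lemma frob_sqr (R : realType) m n (A : 'M[R]_(m, n)) :
  frob A ^+ 2 = \sum_i \sum_j A i j ^+ 2.
Proof.
rewrite sqr_sqrtr//; apply: sumr_ge0 => i _; apply: sumr_ge0 => j _.
exact: sqr_ge0.
Qed.

Lemma frob_ge0 (R : realType) m n (A : 'M[R]_(m, n)) : 0 <= frob A.
Proof. exact: sqrtr_ge0. Qed.

Lemma frob_colE (R : realType) n (v : 'cV[R]_n) : frob v ^+ 2 = \sum_i v i 0 ^+ 2.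
Proof. by rewrite frob_sqr; apply: eq_bigr => i _; rewrite big_ord1. Qed.

Lemma frob_col_sqr (R : realType) n (v : 'cV[R]_n) : frob v ^+ 2 = (v^T *m v) 0 0.
Proof.
rewrite frob_sqr mxE; apply: eq_bigr => i _.
by rewrite big_ord1 mxE expr2.
Qed.

Lemma rayleigh_le (R : realType) n (A : 'M[R]_n) (c : R) (v : 'cV[R]_n) :
  A^T = A -> lambda_max A <= c -> (v^T *m A *m v) 0 0 <= c * frob v ^+ 2.
Proof.
move=> Asym Ac; have [n0|n0] := posnP n.
  subst n; rewrite frob_sqr big_ord0 mulr0 mxE big_ord0//.
apply: (@le_trans _ _ (lambda_max A * frob v ^+ 2)); last first.
  by rewrite ler_wpM2r ?sqr_ge0.
by have := rayleigh_row Asym n0 v^T; rewrite trmxK frob_col_sqr.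
Qed.

(** * Frobenius inner product and Kronecker products *)

Section frobenius.
Context (R : realType).

Definition frob_dot m n (A B : 'M[R]_(m, n)) : R := \sum_i \sum_j A i j * B i j.

Lemma frobB_sqr m n (A B : 'M[R]_(m, n)) :
  frob (A - B) ^+ 2 = frob A ^+ 2 - 2 * frob_dot A B + frob B ^+ 2.
Proof.
rewrite !frob_sqr /frob_dot mulr_sumr -sumrB -big_split/=; apply: eq_bigr => i _.
rewrite mulr_sumr -sumrB -big_split/=; apply: eq_bigr => j _.
by rewrite !mxE; ring.
Qed.

Lemma frobZ_sqr m n c (A : 'M[R]_(m, n)) : frob (c *: A) ^+ 2 = c ^+ 2 * frob A ^+ 2.
Proof.
rewrite !frob_sqr mulr_sumr; apply: eq_bigr => i _; rewrite mulr_sumr.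
by apply: eq_bigr => j _; rewrite mxE exprMn.
Qed.

Lemma frob_dotZ m n c (A B : 'M[R]_(m, n)) : frob_dot A (c *: B) = c * frob_dot A B.
Proof.
rewrite /frob_dot mulr_sumr; apply: eq_bigr => i _; rewrite mulr_sumr.
by apply: eq_bigr => j _; rewrite mxE mulrCA.
Qed.

(** By cyclicity of the trace, conjugation by [X] has conjugation by [X^T] as adjoint; this moves
    the residuals to [p] by [p] matrices and produces [score]. *)
Lemma frob_dot_conj m p (X : 'M[R]_(m, p)) (A : 'M[R]_m) (D : 'M[R]_p) :
  frob_dot A (X *m D *m X^T) = \sum_a \sum_b (X^T *m A *m X) a b * D a b.
Proof.
have trE k (B C : 'M[R]_k) : frob_dot B C = \tr (B^T *m C).
  rewrite /frob_dot /mxtrace exchange_big/=; apply: eq_bigr => i _.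
  by rewrite mxE; apply: eq_bigr => j _; rewrite mxE.
rewrite -/(frob_dot _ D) !trE !trmx_mul trmxK !mulmxA mxtrace_mulC.
by rewrite !mulmxA.
Qed.

(** Stacking only permutes entries, up to the transposition built into [vec]. This links
    [restricted_eigenvalue] to the quadratic part of the loss. *)
Lemma frob_vec_tens m p (X : 'M[R]_(m, p)) (D : 'M[R]_p) :
  frob ((X *t X) *m vec D) ^+ 2 = frob (X *m D *m X^T) ^+ 2.
Proof.
have unindex_bij (a b : nat) : bijective (@mxtens_unindex a b).
  exists (@mxtens_index a b); [exact: mxtens_unindexK | exact: mxtens_indexK].
have index_bij (a b : nat) : bijective (@mxtens_index a b).
  exists (@mxtens_unindex a b); [exact: mxtens_indexK | exact: mxtens_unindexK].
rewrite !frob_sqr [RHS]exchange_big/= [RHS]pair_bigA/=.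
rewrite [LHS](reindex (@mxtens_index m m))/=; last exact/onW_bij/index_bij.
apply: eq_bigr => -[i j] _; rewrite big_ord1; congr (_ ^+ 2).
rewrite !mxE [LHS](reindex (@mxtens_index p p))/=; last exact/onW_bij/index_bij.
under [in RHS]eq_bigr do rewrite mxE mulr_suml.
rewrite pair_bigA/=; apply: eq_bigr => -[k l] _.
by rewrite tensmxE !mxE mxtens_indexK/=; ring.
Qed.

End frobenius.

(** * Basic inequality *)

Section basic_inequality.
Context (R : realType) (p L : nat) (N : 'I_L -> nat).
Variables (X : forall l, 'M[R]_(N l, p)) (y : forall l, 'cV[R]_(N l)).
Variables (sigma lam g kappa0 : R) (W Om : 'M[R]_p) (s : nat).

Let Del := W - Om.

Definition residual l : 'M[R]_(N l) :=
  y l *m (y l)^T - p%:R^-1 *: (X l *m Om *m (X l)^T) - (sigma ^+ 2)%:M.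

Definition score (a b : 'I_p) : R :=
  L%:R^-1 * \sum_(l < L) p%:R^-1 * ((X l)^T *m residual l *m X l) a b.

Hypothesis L0 : (0 < L)%N.
Hypothesis lam0 : 0 <= lam.
Hypothesis kappa0_gt0 : 0 < kappa0.
Hypothesis Om_pd : posdef Om.
Hypothesis W_min : is_minimizer X y sigma lam W.
Hypothesis RE : forall l, exists2 k, kappa0 <= k & restricted_eigenvalue (X l) k.
Hypothesis score_le : forall a b, `|score a b| <= g.
Hypothesis g_lam : 4 * g <= lam.
Hypothesis Om_sparse : (#|offdiag_support Om| <= s)%N.

Let Om_sym : Om^T = Om := Om_pd.1.

Let LR : 0 < L%:R :> R. Proof. by rewrite ltr0n. Qed.

Let Del_sym : Del^T = Del.
Proof. by case: W_min => -[Wsym _] _; rewrite /Del linearB/= Wsym Om_sym. Qed.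

Let pen (A : 'M[R]_p) : R := \sum_(i < p) \sum_(j < p | i != j) `|A i j|.

(** The loss is quadratic, so its expansion at [Om] is exact. The second-order term is bounded below
    design by design, [Del] being symmetric, and minimality of [W] compares the rest. *)
Let curvature : kappa0 * frob Del ^+ 2 <=
  2 * (\sum_a \sum_b score a b * Del a b) + lam * (pen Om - pen W).
Proof.
have [_ /(_ _ Om_pd)] := W_min; rewrite /objective -!/(pen _) => le.
have resE l : y l *m (y l)^T - p%:R^-1 *: (X l *m W *m (X l)^T) - (sigma ^+ 2)%:M =
    residual l - p%:R^-1 *: (X l *m Del *m (X l)^T).
  have -> : W = Del + Om by rewrite subrK.
  rewrite /residual mulmxDr mulmxDl scalerDr opprD addrA.
  by rewrite [RHS]addrAC; congr (_ - _); rewrite addrAC.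
have LB : L%:R^-1 * (\sum_(l < L) frob (residual l) ^+ 2) - 2 * (\sum_a \sum_b score a b * Del a b)
    + kappa0 * frob Del ^+ 2 <=
    L%:R^-1 * (\sum_(l < L) frob (y l *m (y l)^T - p%:R^-1 *: (X l *m W *m (X l)^T)
            - (sigma ^+ 2)%:M) ^+ 2).
  have -> : \sum_a \sum_b score a b * Del a b =
     L%:R^-1 * \sum_(l < L) p%:R^-1 * frob_dot (residual l) (X l *m Del *m (X l)^T).
    transitivity (\sum_a \sum_b \sum_(l < L)
        L%:R^-1 * (p%:R^-1 * (((X l)^T *m residual l *m X l) a b * Del a b))).
      apply: eq_bigr => a _; apply: eq_bigr => b _.
      rewrite /score -mulrA mulr_suml mulr_sumr; apply: eq_bigr => l _; ring.
    under eq_bigr do rewrite exchange_big/=.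
    rewrite exchange_big/= mulr_sumr; apply: eq_bigr => l _.
    rewrite frob_dot_conj !mulr_sumr; apply: eq_bigr => a _.
    by rewrite !mulr_sumr.
  have -> : kappa0 * frob Del ^+ 2 = L%:R^-1 * \sum_(l < L) kappa0 * frob Del ^+ 2.
    by rewrite sumr_const card_ord -[X in _ = _ * X]mulr_natl mulKf// gt_eqF.
  rewrite mulrCA -mulrBr -mulrDr; apply: ler_wpM2l; first by rewrite invr_ge0 ltW.
  rewrite mulr_sumr -sumrB -big_split/=; apply: ler_sum => l _.
  rewrite resE (frobB_sqr (residual l)) frob_dotZ lerD2l frobZ_sqr -frob_vec_tens exprVn.
  have [k kk0 rel] := RE l; apply: le_trans (rel _ Del_sym).
  by rewrite ler_wpM2r ?sqr_ge0.
have resO : \sum_(l < L) frob (y l *m (y l)^T - p%:R^-1 *: (X l *m Om *m (X l)^T)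
            - (sigma ^+ 2)%:M) ^+ 2 = \sum_(l < L) frob (residual l) ^+ 2 by [].
rewrite resO in le; rewrite mulrBr; lra.
Qed.

(** The diagonal belongs to [S] because it is not penalised; it accounts for [p] in [p + s]. *)
Let S (ij : 'I_p * 'I_p) := (ij \in offdiag_support Om) || (ij.1 == ij.2).

Let card_S : (#|[pred ij | S ij]| <= p + s)%N.
Proof.
rewrite addnC; apply: leq_trans (leq_add Om_sparse (leqnn p)).
rewrite -[X in (_ <= _ + X)%N]card_ord.
rewrite -(card_imset (f := fun i : 'I_p => (i, i)) 'I_p); last by move=> i j [].
apply: leq_trans (leq_card_setU _ _); apply: subset_leq_card.
apply/fintype.subsetP => -[i j] Sij; apply/finset.setUP; move: Sij.
by rewrite inE /S => /orP[|/eqP /= <-]; [left | right; exact: imset_f].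
Qed.

(** Off [S] the entry of [W] equals that of [Del], so the penalty yields [- lam |Del i j|] and
    absorbs the score term, at most [lam |Del i j| / 2]. On [S] both terms are simply added. *)
Let entry_bound i j :
  2 * (score i j * Del i j) + lam * (if i != j then `|Om i j| - `|W i j| else 0) <=
    if S (i, j) then 2 * lam * `|Del i j| else 0.
Proof.
have DE : Del i j = W i j - Om i j by rewrite !mxE.
have sc : score i j * Del i j <= g * `|Del i j|.
  by apply: le_trans (ler_norm _) _; rewrite normrM ler_wpM2r.
have gl : 4 * (g * `|Del i j|) <= lam * `|Del i j| by rewrite mulrA ler_wpM2r.
have lD : 0 <= lam * `|Del i j| by rewrite mulr_ge0.
rewrite /S /= inE/=; have [eij|neij] := eqVneq i j.
  by rewrite andbF /= mulr0; lra.
rewrite andbT orbF; have [Oeq0|Oneq0] := eqVneq (Om i j) 0.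
  have -> : `|W i j| = `|Del i j| by rewrite DE Oeq0 subr0.
  by rewrite Oeq0 normr0 /=; lra.
have : lam * (`|Om i j| - `|W i j|) <= lam * `|Del i j|.
  by rewrite ler_wpM2l// DE distrC lerB_dist.
by rewrite /=; lra.
Qed.

Lemma basic_inequality :
  frob (W - Om) <= 2 * lam * Num.sqrt (p + s)%:R / kappa0.
Proof.
rewrite -/Del; set f := frob Del.
have f0 : 0 <= f by exact: frob_ge0.
pose Q := \sum_(ij | S ij) `|Del ij.1 ij.2|.
have Q0 : 0 <= Q by exact: sumr_ge0.
have penE A : pen A = \sum_i \sum_j (if i != j then `|A i j| else 0).
  by apply: eq_bigr => i _; rewrite big_mkcond.
have QE : \sum_i \sum_j (if S (i, j) then 2 * lam * `|Del i j| else 0) = 2 * lam * Q.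
  rewrite pair_bigA/= -big_mkcond/= mulr_sumr; apply: eq_big => -[i j] //.
have fQ : kappa0 * f ^+ 2 <= 2 * lam * Q.
  apply: le_trans curvature _; rewrite -QE !penE -sumrB.
  rewrite mulr_sumr [lam * _]mulr_sumr -big_split/=; apply: ler_sum => i _.
  rewrite mulr_sumr -sumrB mulr_sumr -big_split/=; apply: ler_sum => j _.
  apply: le_trans (entry_bound i j); rewrite lerD2l.
  by case: ifP => // _; rewrite subrr.
have Qf : Q <= Num.sqrt (p + s)%:R * f.
  rewrite -(@ler_pXn2r _ 2)// ?nnegrE ?mulr_ge0 ?sqrtr_ge0//.
  rewrite exprMn sqr_sqrtr//; apply: le_trans (sqr_sum_cond_le _ _) _.
  apply: ler_pM => //.
  - by apply: sumr_ge0 => ij _; exact: sqr_ge0.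
  - by rewrite ler_nat.
  rewrite frob_sqr pair_bigA/= [leRHS](bigID S)/=.
  rewrite -[leLHS]addr0 lerD//; last by apply: sumr_ge0 => ij _; exact: sqr_ge0.
  by apply: ler_sum => ij _; rewrite real_normK ?num_real.
rewrite ler_pdivlMr//.
have [->|fn0] := eqVneq f 0; first by rewrite mul0r !mulr_ge0// sqrtr_ge0.
have fp : 0 < f by rewrite lt_neqAle eq_sym fn0.
rewrite -(ler_pM2r fp) -[leRHS]mulrA; apply: (@le_trans _ _ (2 * lam * Q)).
  by apply: le_trans fQ; rewrite le_eqVlt; apply/orP; left; apply/eqP; ring.
by apply: ler_wpM2l => //; exact: mulr_ge0.
Qed.

End basic_inequality.

(** * Concentration of the score *)

Section random_vectors.
Context d (T : measurableType d) (R : realType) (P : probability T R).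

(** A finite value of the extended expectation forces integrability, so the moment hypotheses of the
    model provide summability. *)
Lemma Ex_of_expectation (f : T -> R) (c : R) : measurable_fun setT f ->
  ('E_P[f] = c%:E)%E -> summable_rv P f /\ Ex P f = c.
Proof.
move=> mf Ef.
have intE : (\int[P]_w (f w)%:E = c%:E)%E by move: Ef; rewrite unlock.
have sf : summable_rv P f.
  apply/integrableP; split; first exact/measurable_EFinP.
  by rewrite integral_fin_num_abs// intE.
by split => //; apply: EFin_inj; rewrite -ExE.
Qed.

Lemma cov_second_moment (f g : T -> R) (c : R) :
  measurable_fun setT f -> measurable_fun setT g ->
  ('E_P[f] = 0%:E)%E -> ('E_P[g] = 0%:E)%E -> covariance P f g = c%:E ->
  summable_rv P (fun w => f w * g w) /\ Ex P (fun w => f w * g w) = c.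
Proof.
move=> mf mg f0 g0 cov; apply: Ex_of_expectation; first exact: measurable_funM.
move: cov; rewrite unlock /= f0 g0 /= => <-; congr ('E_P[_])%E.
by apply/funext => w /=; rewrite !fctE /= !subr0.
Qed.

Definition linform k (v : 'cV[R]_k) (x : T -> 'cV[R]_k) (w : T) : R :=
  (v^T *m x w) 0 0.

Lemma linformE k (v : 'cV[R]_k) x w : linform v x w = \sum_i v i 0 * x w i 0.
Proof. by rewrite /linform mxE; apply: eq_bigr => i _; rewrite mxE. Qed.

Lemma linform_meas k (v : 'cV[R]_k) (x : T -> 'cV[R]_k) :
  random_matrix x -> measurable_fun setT (linform v x).
Proof.
move=> mx; rewrite (_ : linform v x = fun w => \sum_i v i 0 * x w i 0).
  by apply: measurable_sum => i; apply: measurable_funM.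
by apply/funext => w; rewrite linformE.
Qed.

(** The hypothesis concerns unit vectors: the norm of [v] is moved into the scalar [s], and [v = 0]
    is treated apart. *)
Lemma linform_subgauss k (x : T -> 'cV[R]_k) (tau : R) (v : 'cV[R]_k) (s : R) :
  random_matrix x -> sub_gaussian P x 0 tau ->
  summable_rv P (fun w => expR (s * linform v x w)) /\
  Ex P (fun w => expR (s * linform v x w)) <= expR (s ^+ 2 * (tau ^+ 2 * frob v ^+ 2) / 2).
Proof.
move=> mx [_ sg].
apply: ge0_summable => //.
  apply: (@measurableT_comp _ _ _ _ _ _ (@expR R)); first exact: measurable_expR.
  by apply: measurable_funM => //; exact: linform_meas.
have [v0|v0] := eqVneq v 0.
  have -> : (fun w => (expR (s * linform v x w))%:E) = cst 1%:E.
    by apply/funext => w; rewrite v0 /linform trmx0 mul0mx mxE mulr0 expR0.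
  rewrite integral_cst// [X in (_ * X)%E](_ : _ = 1%E) ?mule1; last exact: probability_setT.
  rewrite lee_fin v0 (_ : frob 0 = 0); last first.
    by rewrite /frob big1 ?sqrtr0// => i _; rewrite big1// => j _; rewrite mxE expr0n.
  by rewrite expr0n !(mulr0, mul0r) expR0.
have fv : 0 < frob v.
  rewrite lt_neqAle frob_ge0 andbT eq_sym; apply: contra v0 => /eqP fv0.
  have := frob_colE v; rewrite fv0 expr0n /= => /esym E.
  apply/eqP/colP => i; rewrite mxE.
  have /eqP := psumr_eq0P (fun i _ => sqr_ge0 (v i 0)) E (i := i) isT.
  by rewrite sqrf_eq0 => /eqP.
pose u := (frob v)^-1 *: v.
have fu : frob u = 1.
  apply/eqP; rewrite -(@eqrXn2 _ 2)// ?frob_ge0// expr1n frob_colE.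
  under eq_bigr do rewrite mxE exprMn.
  by rewrite -mulr_sumr -frob_colE exprVn mulVf// sqrf_eq0 gt_eqF.
have := sg u (s * frob v) fu; rewrite unlock.
have -> : (s * frob v) ^+ 2 * tau ^+ 2 / 2 = s ^+ 2 * (tau ^+ 2 * frob v ^+ 2) / 2 by ring.
apply: le_trans; rewrite le_eqVlt; apply/orP; left; apply/eqP.
apply: eq_integral => w _; congr (expR _)%:E.
rewrite subr0 /linform /u linearZ/= -scalemxAl [in RHS]mxE -mulrA.
by rewrite mulVKf// gt_eqF.
Qed.

Section second_moments.
Variables (k : nat) (x : T -> 'cV[R]_k) (M : 'M[R]_k).
Hypothesis mx : random_matrix x.
Hypothesis sM : forall i j, summable_rv P (fun w => x w i 0 * x w j 0).
Hypothesis eM : forall i j, Ex P (fun w => x w i 0 * x w j 0) = M i j.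

Lemma linform_second_moment (v u : 'cV[R]_k) :
  summable_rv P (fun w => linform v x w * linform u x w) /\
  Ex P (fun w => linform v x w * linform u x w) = (v^T *m M *m u) 0 0.
Proof.
have E w : linform v x w * linform u x w =
    \sum_i \sum_j (v i 0 * u j 0) * (x w i 0 * x w j 0).
  rewrite !linformE mulr_suml; apply: eq_bigr => i _; rewrite mulr_sumr.
  by apply: eq_bigr => j _; ring.
have s1 i : summable_rv P (fun w => \sum_j (v i 0 * u j 0) * (x w i 0 * x w j 0)).
  by apply: summable_sum => j _; exact: summableZ.
split; first by apply: (summable_ext (fun w => esym (E w))); apply: summable_sum.
rewrite (Ex_ext _ E) Ex_sum//.
transitivity (\sum_i \sum_j v i 0 * M i j * u j 0).
  apply: eq_bigr => i _; rewrite Ex_sum; last by move=> j _; exact: summableZ.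
  by apply: eq_bigr => j _; rewrite ExZ// eM; ring.
rewrite exchange_big mxE; apply: eq_bigr => j _; rewrite mxE mulr_suml.
by apply: eq_bigr => i _; rewrite mxE.
Qed.

Hypothesis ex1 : forall i, Ex P (fun w => x w i 0) = 0.

Lemma linform_mean (v : 'cV[R]_k) :
  summable_rv P (linform v x) /\ Ex P (linform v x) = 0.
Proof.
have s1 i : summable_rv P (fun w => x w i 0).
  have sq : summable_rv P (fun w => x w i 0 ^+ 1.*2) by exact: sM.
  by apply: summable_ext (@summable_lower_power _ _ _ _ _ 1 1 isT (mx i 0) sq).
split.
  apply: (summable_ext (fun w => esym (linformE v x w))); apply: summable_sum => i _.
  exact: summableZ.
rewrite (Ex_ext _ (linformE v x)) Ex_sum; last by move=> i _; exact: summableZ.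
by apply: big1 => i _; rewrite ExZ// ex1 mulr0.
Qed.

End second_moments.

End random_vectors.

Section sigma_of_matrix.
Context d (T : measurableType d) (R : realType) (m n : nat).
Variable X : T -> 'M[R]_(m, n).
Hypothesis mX : random_matrix X.

Let gens : set_system 'M[R]_(m, n) :=
  [set C | exists i j (B : set R),
         measurable B /\ C = [set A : 'M[R]_(m, n) | B (A i j)]].

Let Fx := sigma_of (@mxborel R m n) X.

Lemma sigma_of_mx_setT : Fx setT.
Proof. by exists setT => //; exact: (@measurableT _ (g_sigma_algebraType gens)). Qed.

Lemma sigma_of_mx_setI : setI_closed Fx.
Proof.
move=> _ _ [A mA ->] [B mB ->]; exists (A `&` B).
  exact: (@measurableI _ (g_sigma_algebraType gens)).
by rewrite preimage_setI.
Qed.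

Lemma sigma_of_mx_measurable : Fx `<=` measurable.
Proof.
move=> _ [B mB ->].
have h : measurable_fun setT (X : T -> g_sigma_algebraType gens).
  apply: (@measurability _ _ _ (g_sigma_algebraType gens) setT X gens) => // _ [_ [i [j [C [mC ->]]]] <-].
  exact: (mX i j).
by rewrite -[_ @^-1` _]setTI; exact: h.
Qed.

Lemma sigma_of_mx_entry i j (B : set R) : measurable B ->
  Fx ((fun w => X w i j) @^-1` B).
Proof.
move=> mB; exists [set A : 'M[R]_(m, n) | B (A i j)] => //.
by apply: sub_sigma_algebra; exists i, j, B.
Qed.

End sigma_of_matrix.

Lemma term_le_sum (R : realType) (I : finType) (F : I -> R) i :
  (forall j, 0 <= F j) -> F i <= \sum_j F j.
Proof. by move=> F0; rewrite (bigD1 i)//= lerDl sumr_ge0. Qed.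

Lemma col_form_entry (R : realType) m p (M : 'M[R]_(m, p)) (Q : 'M[R]_m) (c e : R) a b :
  ((c *: col a M)^T *m Q *m (e *: col b M)) 0 0 = c * e * (M^T *m Q *m M) a b.
Proof.
rewrite [(_ *: _)^T]linearZ/= -!scalemxAl -scalemxAr tr_col -!row_mul.
rewrite colE mulmxA -colE.
by move: (M^T *m Q *m M) => Y; rewrite !mxE mulrA.
Qed.

(** * Sub-Gaussian coordinates and the Chernoff bound *)

Section score.
Context d (T : measurableType d) (R : realType) (P : probability T R).
Variables (p L : nat) (N : 'I_L -> nat).
Variables (X : forall l, 'M[R]_(N l, p)) (Om : 'M[R]_p).
Variables (beta : 'I_L -> T -> 'cV[R]_p) (eps : forall l, T -> 'cV[R]_(N l)).
Variables (sigma tau_beta tau_eps : R).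
Hypothesis p0 : (0 < p)%N.
Hypothesis L0 : (0 < L)%N.
Hypothesis beta_meas : forall l, random_matrix (beta l).
Hypothesis eps_meas : forall l, random_matrix (eps l).
Let Fam (k : 'I_L + 'I_L) : set_system T :=
  match k with
  | inl l => sigma_of (@mxborel R p 1) (beta l)
  | inr l => sigma_of (@mxborel R (N l) 1) (eps l)
  end.
Hypothesis indep : mutually_independent P Fam.
Hypothesis beta_mean : forall l, has_mean P (beta l) 0.
Hypothesis beta_cov : forall l i j,
     ('E_P[fun w => (beta l w i 0 * beta l w j 0)%R])%E = (p%:R^-1 * Om i j)%:E.
Hypothesis eps_mean : forall l, has_mean P (eps l) 0.
Hypothesis eps_cov : forall l i j,
     covariance P (fun w => eps l w i 0) (fun w => eps l w j 0)
       = (((sigma ^+ 2)%:M : 'M[R]_(N l)) i j)%:E.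
Hypothesis beta_subg : forall l,
  sub_gaussian P (fun w => Num.sqrt p%:R *: beta l w) 0 tau_beta.
Hypothesis eps_subg : forall l, sub_gaussian P (eps l) 0 tau_eps.

Let pR : 0 < p%:R :> R. Proof. by rewrite ltr0n. Qed.
Let LR : 0 < L%:R :> R. Proof. by rewrite ltr0n. Qed.
Let sp0 : 0 < Num.sqrt p%:R :> R. Proof. by rewrite sqrtr_gt0. Qed.

Let FamT k : Fam k setT.
Proof. by case: k => l /=; exact: sigma_of_mx_setT. Qed.

Let FamI k : setI_closed (Fam k).
Proof. by case: k => l /=; exact: sigma_of_mx_setI. Qed.

Let Famm k : Fam k `<=` measurable.
Proof. by case: k => l /=; exact: sigma_of_mx_measurable. Qed.

Let sbeta l w : 'cV[R]_p := Num.sqrt p%:R *: beta l w.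

Let sbeta_meas l : random_matrix (sbeta l).
Proof.
move=> i j; rewrite (_ : (fun w => _) = fun w => Num.sqrt p%:R * beta l w i j).
  by apply: measurable_funM => //; exact: beta_meas.
by apply/funext => w; rewrite mxE.
Qed.

Let beta_coef l (a : 'I_p) : 'cV[R]_p := p%:R^-1 *: col a ((X l)^T *m X l).
Let eps_coef l (a : 'I_p) : 'cV[R]_(N l) := (Num.sqrt p%:R)^-1 *: col a (X l).

(** Coordinate [a] of [u_l], written as a sum of two independent linear forms; [projectionE]
    recovers the usual expression. *)
Definition projection l (a : 'I_p) (w : T) : R :=
  linform (beta_coef l a) (sbeta l) w + linform (eps_coef l a) (eps l) w.

Lemma projectionE l a w : projection l a w =
  (Num.sqrt p%:R)^-1 * ((X l)^T *m (X l *m beta l w + eps l w)) a 0.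
Proof.
rewrite /projection mulmxDr [in RHS]mxE mulrDr; congr (_ + _).
  rewrite /linform /beta_coef /sbeta [(_ *: _)^T]linearZ/= -scalemxAl -scalemxAr.
  have -> : (col a ((X l)^T *m X l))^T *m beta l w = row a ((X l)^T *m (X l *m beta l w)).
    by rewrite tr_col trmx_mul trmxK -row_mul mulmxA.
  move: (_ *m (_ *m beta l w)) => Q; rewrite !mxE mulrA; congr (_ * _).
  by rewrite -{1}(sqr_sqrtr (ltW pR)) expr2; field; exact: lt0r_neq0.
rewrite /linform /eps_coef [(_ *: _)^T]linearZ/= -scalemxAl tr_col -row_mul.
by move: (_ *m eps l w) => Q; rewrite !mxE.
Qed.

(* The summand [1] keeps the proxy positive when [tau_beta] and [tau_eps] vanish. *)
Definition variance_proxy l (a : 'I_p) : R :=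
  1 + tau_beta ^+ 2 * (p%:R^-1 ^+ 2 * frob (col a ((X l)^T *m X l)) ^+ 2)
    + tau_eps ^+ 2 * (p%:R^-1 * frob (col a (X l)) ^+ 2).

Let A (l : 'I_L) : {set 'I_L + 'I_L} := finset (fun k => (k == inl l) || (k == inr l)).

Let entry_wrt_inl (B : {set 'I_L + 'I_L}) l i : inl l \in B ->
  meas_wrt (generators Fam B) (fun w => beta l w i 0).
Proof.
move=> lB; split => _ C mC; rewrite setTI; apply: sub_sigma_algebra.
by exists (inl l) => //=; exact: sigma_of_mx_entry.
Qed.

Let entry_wrt_inr (B : {set 'I_L + 'I_L}) l i : inr l \in B ->
  meas_wrt (generators Fam B) (fun w => eps l w i 0).
Proof.
move=> lB; split => _ C mC; rewrite setTI; apply: sub_sigma_algebra.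
by exists (inr l) => //=; exact: sigma_of_mx_entry.
Qed.

Let lin_beta_wrt (B : {set 'I_L + 'I_L}) l v : inl l \in B ->
  meas_wrt (generators Fam B) (linform v (sbeta l)).
Proof.
move=> lB; apply: meas_wrt_ext (fun w => esym (linformE v (sbeta l) w)) _.
apply: meas_wrt_sum => i _; apply: meas_wrtM; first exact: meas_wrt_cst.
apply: (@meas_wrt_ext _ _ _ _ (fun w => Num.sqrt p%:R * beta l w i 0)).
  by move=> w; rewrite mxE.
by apply: meas_wrtM; [exact: meas_wrt_cst | exact: entry_wrt_inl].
Qed.

Let lin_eps_wrt (B : {set 'I_L + 'I_L}) l v : inr l \in B ->
  meas_wrt (generators Fam B) (linform v (eps l)).
Proof.
move=> lB; apply: meas_wrt_ext (fun w => esym (linformE v (eps l) w)) _.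
apply: meas_wrt_sum => i _; apply: meas_wrtM; first exact: meas_wrt_cst.
exact: entry_wrt_inr.
Qed.

Let projection_wrt l a : meas_wrt (generators Fam (A l)) (projection l a).
Proof.
apply: meas_wrtD; first by apply: lin_beta_wrt; rewrite inE eqxx.
by apply: lin_eps_wrt; rewrite inE eqxx orbT.
Qed.

Let steps : independent_steps P
  (fun t => generators Fam (past_block A t)) (fun l => generators Fam (A l)).
Proof.
apply: block_independent_steps => // i j k.
by rewrite !inE => /orP[] /eqP -> /orP[] /eqP // [].
Qed.

Let projection_meas l a : measurable_fun setT (projection l a).
Proof. exact: meas_wrt_meas (present_measurable steps (t := l)) (projection_wrt l a). Qed.

Let inl_inr_independent l :
  independent_sys P <<s generators Fam (finset.set1 (inl l)) >>
    <<s generators Fam (finset.set1 (inr l)) >>.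
Proof. by apply: independent_generators => // i; rewrite !inE => /eqP ->. Qed.

Let gm (B : {set 'I_L + 'I_L}) : generators Fam B `<=` measurable.
Proof. exact: generators_measurable. Qed.

Lemma variance_proxy_ge1 l a : 1 <= variance_proxy l a.
Proof.
rewrite /variance_proxy -addrA lerDl addr_ge0// mulr_ge0 ?sqr_ge0// mulr_ge0 ?sqr_ge0//.
Qed.

Lemma projection_mgf l a (s : R) :
  (\int[P]_w (expR (s * projection l a w))%:E <=
    (expR (s ^+ 2 * variance_proxy l a / 2))%:E)%E.
Proof.
have [sb eb] := linform_subgauss (beta_coef l a) s (sbeta_meas l) (beta_subg l).
have [se ee] := linform_subgauss (eps_coef l a) s (@eps_meas l) (eps_subg l).
have mexp : measurable_fun setT (fun x : R => expR (s * x)).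
  by apply: (@measurableT_comp _ _ _ _ _ _ (@expR R)); [exact: measurable_expR | exact: measurable_funM].
have [sm em] := ExM_indep (@gm _) (@gm _) (@inl_inr_independent l)
  (meas_wrt_comp mexp (lin_beta_wrt (beta_coef l a) (set11 (inl l))))
  (meas_wrt_comp mexp (lin_eps_wrt (eps_coef l a) (set11 (inr l)))) sb se.
have E w : expR (s * linform (beta_coef l a) (sbeta l) w) * expR (s * linform (eps_coef l a) (eps l) w) =
    expR (s * projection l a w).
  by rewrite -expRD -mulrDr.
rewrite (ExE (summable_ext E sm)) -(Ex_ext _ E) em lee_fin.
apply: (@le_trans _ _ (expR (s ^+ 2 * (tau_beta ^+ 2 * frob (beta_coef l a) ^+ 2) / 2) *
   expR (s ^+ 2 * (tau_eps ^+ 2 * frob (eps_coef l a) ^+ 2) / 2))).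
  by apply: ler_pM => //; apply: Ex_ge0 => w; exact: expR_ge0.
rewrite -expRD ler_expR /beta_coef /eps_coef !frobZ_sqr.
have -> : (Num.sqrt p%:R)^-1 ^+ 2 = p%:R^-1 :> R by rewrite exprVn sqr_sqrtr// ltW.
rewrite /variance_proxy; have := sqr_ge0 s; lra.
Qed.

(** The two coordinates are dependent, so they are separated by the arithmetic-geometric mean, first
    in the exponent and then between the two exponentials. The scale matches the weight of
    [subgauss_exp_sqr] with [tau ^ 2] the variance proxy. *)
Lemma projection_exp l a b :
  (\int[P]_w (expR `|projection l a w * projection l b w /
     (4 * Num.sqrt (variance_proxy l a) * Num.sqrt (variance_proxy l b))|)%:E
    <= (gauss_const R)%:E)%E.
Proof.
have v0 c : 0 < variance_proxy l c by apply: lt_le_trans (variance_proxy_ge1 l c).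
have sv0 c : 0 < Num.sqrt (variance_proxy l c) by rewrite sqrtr_gt0.
have h c := subgauss_exp_sqr (P := P) (projection_meas l c) (sv0 c).
have {}h c : (\int[P]_w (expR (projection l c w ^+ 2 / (4 * variance_proxy l c)))%:E <= (gauss_const R)%:E)%E.
  have := h c; rewrite sqr_sqrtr ?(ltW (v0 c))//; apply => s; exact: projection_mgf.
have mq c : measurable_fun setT (fun w => expR (projection l c w ^+ 2 / (4 * variance_proxy l c))).
  apply: (@measurableT_comp _ _ _ _ _ _ (@expR R)); first exact: measurable_expR.
  by apply: measurable_funM => //; exact: measurable_funX.
have sq c : summable_rv P (fun w => expR (projection l c w ^+ 2 / (4 * variance_proxy l c))) /\
    Ex P (fun w => expR (projection l c w ^+ 2 / (4 * variance_proxy l c))) <= gauss_const R.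
  exact: ge0_summable.
pose Y w := projection l a w * projection l b w /
  (4 * Num.sqrt (variance_proxy l a) * Num.sqrt (variance_proxy l b)).
have mY : measurable_fun setT Y.
  by apply: measurable_funM => //; exact: measurable_funM.
have meY : measurable_fun setT (fun w => expR `|Y w|).
  apply: (@measurableT_comp _ _ _ _ _ _ (@expR R)); first exact: measurable_expR.
  exact: measurableT_comp.
have le w : expR `|Y w| <= 2^-1 * (expR (projection l a w ^+ 2 / (4 * variance_proxy l a)) +
     expR (projection l b w ^+ 2 / (4 * variance_proxy l b))).
  set x := projection l a w / (2 * Num.sqrt (variance_proxy l a)).
  set y := projection l b w / (2 * Num.sqrt (variance_proxy l b)).
  have xE : projection l a w ^+ 2 / (4 * variance_proxy l a) = x ^+ 2.
    rewrite -{1}(sqr_sqrtr (ltW (v0 a))) /x; field; exact: lt0r_neq0.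
  have yE : projection l b w ^+ 2 / (4 * variance_proxy l b) = y ^+ 2.
    rewrite -{1}(sqr_sqrtr (ltW (v0 b))) /y; field; exact: lt0r_neq0.
  have YE : Y w = x * y by rewrite /Y /x /y; field; rewrite !lt0r_neq0.
  rewrite xE yE YE.
  have h1 : `|x * y| <= (x ^+ 2 + y ^+ 2) / 2.
    rewrite normrM -[x ^+ 2]real_normK ?num_real// -[y ^+ 2]real_normK ?num_real//.
    by have := sqr_ge0 (`|x| - `|y|); lra.
  apply: (@le_trans _ _ (expR (x ^+ 2 / 2) * expR (y ^+ 2 / 2))).
    by rewrite -expRD ler_expR -mulrDl.
  have e2 (u : R) : expR (u ^+ 2) = expR (u ^+ 2 / 2) ^+ 2.
    by rewrite -expRM_natl; congr expR; field.
  rewrite !e2; have := sqr_ge0 (expR (x ^+ 2 / 2) - expR (y ^+ 2 / 2)); lra.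
have [s1 e1] := sq a; have [s2 e2] := sq b.
have s3 := summableZ 2^-1 (summableD s1 s2).
have sY : summable_rv P (fun w => expR `|Y w|).
  by apply: summable_le s3 => // w; rewrite ger0_norm ?expR_ge0.
rewrite (ExE sY) lee_fin; apply: le_trans (Ex_le sY s3 le) _.
rewrite ExZ; last exact: summableD.
rewrite ExD// mulrC ler_pdivrMr// mulr_natr mulr2n.
apply: lerD; [exact: e1 | exact: e2].
Qed.

Let beta_moment l i j : summable_rv P (fun w => sbeta l w i 0 * sbeta l w j 0) /\
  Ex P (fun w => sbeta l w i 0 * sbeta l w j 0) = Om i j.
Proof.
have [s e] := Ex_of_expectation
  (measurable_funM (@beta_meas l i 0) (@beta_meas l j 0)) (beta_cov l i j).
have E w : sbeta l w i 0 * sbeta l w j 0 = p%:R * (beta l w i 0 * beta l w j 0).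
  by rewrite !mxE -{3}(sqr_sqrtr (ltW pR)); ring.
split; first by apply: (summable_ext (fun w => esym (E w))); exact: summableZ.
by rewrite (Ex_ext _ E) ExZ// e mulrA divff ?mul1r// lt0r_neq0.
Qed.

Let eps_moment l i j : summable_rv P (fun w => eps l w i 0 * eps l w j 0) /\
  Ex P (fun w => eps l w i 0 * eps l w j 0) = ((sigma ^+ 2)%:M : 'M[R]_(N l)) i j.
Proof.
by apply: cov_second_moment; [exact: eps_meas|exact: eps_meas| | |exact: eps_cov];
  have := @eps_mean l; rewrite /has_mean => ->; rewrite mxE.
Qed.

Let sbeta_mean l i : Ex P (fun w => sbeta l w i 0) = 0.
Proof.
have [s e] := Ex_of_expectation (@beta_meas l i 0) (@beta_mean l i).
rewrite (@Ex_ext _ _ _ _ _ (fun w => Num.sqrt p%:R * beta l w i 0)).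
  by rewrite ExZ// e mxE mulr0.
by move=> w; rewrite mxE.
Qed.

Let eps_mean' l i : Ex P (fun w => eps l w i 0) = 0.
Proof.
have [s e] := Ex_of_expectation (@eps_meas l i 0) (@eps_mean l i).
by rewrite e mxE.
Qed.

Definition score_mean l : 'M[R]_p :=
  p%:R^-1 *: ((X l)^T *m (p%:R^-1 *: (X l *m Om *m (X l)^T) + (sigma ^+ 2)%:M) *m X l).

Lemma projection_moment l a b :
  summable_rv P (fun w => projection l a w * projection l b w) /\
  Ex P (fun w => projection l a w * projection l b w) = score_mean l a b.
Proof.
have mb := linform_second_moment (fun i j => (beta_moment l i j).1) (fun i j => (beta_moment l i j).2).
have me := linform_second_moment (fun i j => (@eps_moment l i j).1) (fun i j => (@eps_moment l i j).2).
have eb := linform_mean (sbeta_meas l) (fun i j => (beta_moment l i j).1) (sbeta_mean l).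
have ee := linform_mean (@eps_meas l) (fun i j => (@eps_moment l i j).1) (@eps_mean' l).
set va := beta_coef l a; set vb := beta_coef l b.
set ua := eps_coef l a; set ub := eps_coef l b.
have cross v u : summable_rv P (fun w => linform v (sbeta l) w * linform u (eps l) w) /\
    Ex P (fun w => linform v (sbeta l) w * linform u (eps l) w) = 0.
  have [sv ev] := eb v; have [su eu] := ee u.
  have [s e] := ExM_indep (@gm _) (@gm _) (@inl_inr_independent l)
    (lin_beta_wrt v (set11 (inl l))) (lin_eps_wrt u (set11 (inr l))) sv su.
  by split => //; rewrite e ev mul0r.
have E w : projection l a w * projection l b w =
    (linform va (sbeta l) w * linform vb (sbeta l) w +
     linform ua (eps l) w * linform ub (eps l) w) +
    (linform va (sbeta l) w * linform ub (eps l) w +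
     linform vb (sbeta l) w * linform ua (eps l) w).
  by rewrite /projection -/va -/vb -/ua -/ub; ring.
have [s1 e1] := mb va vb; have [s2 e2] := me ua ub.
have [s3 e3] := cross va ub; have [s4 e4] := cross vb ua.
have s12 := summableD s1 s2; have s34 := summableD s3 s4.
split; first by apply: (summable_ext (fun w => esym (E w))); exact: summableD.
rewrite (Ex_ext _ E) (ExD s12 s34) (ExD s1 s2) (ExD s3 s4) e1 e2 e3 e4 !addr0.
rewrite /va /vb /ua /ub /beta_coef /eps_coef !col_form_entry.
have -> : (Num.sqrt p%:R)^-1 * (Num.sqrt p%:R)^-1 = p%:R^-1 :> R.
  by rewrite -invfM -expr2 sqr_sqrtr ?(ltW pR).
rewrite trmx_mul trmxK.
rewrite /score_mean mulmxDr mulmxDl -scalemxAr -scalemxAl !mulmxA.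
move: (_ *m X l) (_ *m _ *m X l) => Y1 Y2; rewrite !mxE; ring.
Qed.

Let y l w : 'cV[R]_(N l) := X l *m beta l w + eps l w.

(** The terms subtracted in [residual] are exactly the covariance of [y_l], so the score is a
    centered average. *)
Lemma scoreE a b w : score X (fun l => y l w) sigma Om a b =
  L%:R^-1 * \sum_(l < L)
    (projection l a w * projection l b w - Ex P (fun w => projection l a w * projection l b w)).
Proof.
rewrite /score; congr (_ * _); apply: eq_bigr => l _.
rewrite (projection_moment l a b).2 !projectionE.
have -> : residual X (fun l => y l w) sigma Om l =
    y l w *m (y l w)^T - (p%:R^-1 *: (X l *m Om *m (X l)^T) + (sigma ^+ 2)%:M).
  by rewrite /residual opprD addrA.
rewrite mulmxBr mulmxBl /score_mean -/(y l w).
have -> : (X l)^T *m (y l w *m (y l w)^T) *m X l =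
    ((X l)^T *m y l w) *m ((X l)^T *m y l w)^T by rewrite trmx_mul trmxK !mulmxA.
move: (_ *m y l w) (_ *m _ *m X l) => u M; rewrite !mxE big_ord1 !mxE.
have -> : (Num.sqrt p%:R)^-1 * u a 0 * ((Num.sqrt p%:R)^-1 * u b 0) =
   (Num.sqrt p%:R ^+ 2)^-1 * (u a 0 * u b 0) by field; exact: lt0r_neq0.
by rewrite sqr_sqrtr ?(ltW pR)// mulrBr.
Qed.

Let scale l a b : R := 4 * Num.sqrt (variance_proxy l a) * Num.sqrt (variance_proxy l b).

Let scale_gt0 l a b : 0 < scale l a b.
Proof.
have v0 c : 0 < variance_proxy l c by apply: lt_le_trans (variance_proxy_ge1 l c).
by rewrite /scale !mulr_gt0// sqrtr_gt0.
Qed.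

Let scale_sqr l a b : scale l a b ^+ 2 = 16 * (variance_proxy l a * variance_proxy l b).
Proof.
have v0 c : 0 <= variance_proxy l c by apply: le_trans (variance_proxy_ge1 l c).
by rewrite /scale !exprMn !sqr_sqrtr//; ring.
Qed.

Let centered l a b w : R :=
  projection l a w * projection l b w - Ex P (fun w => projection l a w * projection l b w).

Definition mgf_const : R := 16 * gauss_const R * expR (gauss_const R).

(** [centered_mgf] for the product divided by [scale], at [s = th * scale]; the additional 16 is
    that of [scale_sqr]. *)
Let centered_mgf_bound l a b (th : R) : `|th| * scale l a b <= 2^-1 ->
  summable_rv P (fun w => expR (th * centered l a b w)) /\
  Ex P (fun w => expR (th * centered l a b w)) <=
    expR (16 * mgf_const * th ^+ 2 * (variance_proxy l a * variance_proxy l b)).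
Proof.
move=> th2; set q := scale l a b; have q0 : 0 < q := scale_gt0 l a b.
pose Y w := projection l a w * projection l b w / q.
have mY : measurable_fun setT Y.
  by apply: measurable_funM => //; exact: measurable_funM.
have s2 : `|th * q| <= 2^-1 by rewrite normrM [X in _ * X]gtr0_norm.
have [sY s e] := centered_mgf mY (projection_exp l a b) s2.
have [sp _] := projection_moment l a b.
have EY : Ex P Y = Ex P (fun w => projection l a w * projection l b w) / q.
  rewrite mulrC -ExZ//; apply: Ex_ext => w; by rewrite /Y mulrC.
have E w : expR (th * q * (Y w - Ex P Y)) = expR (th * centered l a b w).
  by rewrite EY /Y /centered; congr expR; field; exact: lt0r_neq0.
split; first exact: summable_ext E s.
rewrite -(Ex_ext _ E); apply: le_trans e _.
by rewrite exprMn scale_sqr /mgf_const ler_expR le_eqVlt; apply/orP; left; apply/eqP; ring.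
Qed.

(** This equals [expR (th * L%:R * (score - g))], kept as a product over [l] for independence; the
    filter matches the prefix products of [Ex_prod_steps]. *)
Let chernoff_weight (th g : R) a b w : R :=
  expR (- (th * L%:R * g)) * \prod_(l < L | (l < L)%N) expR (th * centered l a b w).

Let chernoff_weight_bound (th g V : R) a b :
  (forall l, `|th| * scale l a b <= 2^-1) ->
  \sum_l variance_proxy l a * variance_proxy l b <= V * L%:R ->
  summable_rv P (chernoff_weight th g a b) /\
  Ex P (chernoff_weight th g a b) <=
    expR (16 * mgf_const * th ^+ 2 * V * L%:R - th * L%:R * g).
Proof.
move=> th2 leV.
have mexp : measurable_fun setT (fun x : R => expR (th * x)).
  by apply: (@measurableT_comp _ _ _ _ _ _ (@expR R)); [exact: measurable_expR | exact: measurable_funM].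
have mc l : meas_wrt (generators Fam (A l)) (fun w => expR (th * centered l a b w)).
  apply: (meas_wrt_comp mexp); apply: meas_wrtB; last exact: meas_wrt_cst.
  by apply: meas_wrtM; exact: projection_wrt.
have [_ s e] := Ex_prod_steps steps mc (fun l => (centered_mgf_bound (th2 l)).1) (leqnn L).
split; first exact: summableZ.
rewrite ExZ// e big_ord_prefix_full || rewrite ExZ// e.
apply: (@le_trans _ _ (expR (- (th * L%:R * g)) * \prod_(l < L | (l < L)%N)
   expR (16 * mgf_const * th ^+ 2 * (variance_proxy l a * variance_proxy l b)))).
  apply: ler_wpM2l; first exact: expR_ge0.
  apply: ler_prod => l _; rewrite (centered_mgf_bound (th2 l)).2 andbT.
  by apply: Ex_ge0 => w; exact: expR_ge0.
rewrite -expR_sum big_ord_prefix_full -mulr_sumr -expRD ler_expR addrC lerD2r.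
rewrite -[leRHS]mulrA ler_wpM2l// mulr_ge0 ?sqr_ge0// mulr_ge0// /mgf_const.
by rewrite mulr_ge0 ?expR_ge0// mulr_ge0// (le_trans _ (gauss_const_ge1 R)).
Qed.

Lemma score_concentration (th g V : R) : 0 < th ->
  (forall l a b, th * (4 * Num.sqrt (variance_proxy l a) * Num.sqrt (variance_proxy l b)) <= 2^-1) ->
  (forall a b, \sum_l variance_proxy l a * variance_proxy l b <= V * L%:R) ->
  exists B : set T, [/\ measurable B,
    (P B <= (2 * p%:R ^+ 2 *
        expR (16 * mgf_const * th ^+ 2 * V * L%:R - th * L%:R * g))%:E)%E &
    forall w, ~ B w -> forall a b, `|score X (fun l => y l w) sigma Om a b| <= g].
Proof.
move=> th0 th2 leV.
have thp l a b : `|th| * scale l a b <= 2^-1 by rewrite gtr0_norm//; exact: th2.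
have thn l a b : `|- th| * scale l a b <= 2^-1 by rewrite normrN gtr0_norm//; exact: th2.
have cp a b := chernoff_weight_bound g (fun l => thp l a b) (leV a b).
have cn a b := chernoff_weight_bound (- g) (fun l => thn l a b) (leV a b).
(* Markov's inequality for the sum of all weights performs the union bound; the pair [(- th, - g)]
   covers the lower tail. *)
pose f w := \sum_a \sum_b (chernoff_weight th g a b w + chernoff_weight (- th) (- g) a b w).
have cw0 th' g' a b w : 0 <= chernoff_weight th' g' a b w.
  by rewrite mulr_ge0 ?expR_ge0// prodr_ge0// => l _; exact: expR_ge0.
have s1 a b : summable_rv P (fun w => chernoff_weight th g a b w + chernoff_weight (- th) (- g) a b w).
  by apply: summableD; [have [] := cp a b | have [] := cn a b].
have s2 a : summable_rv P (fun w => \sum_b (chernoff_weight th g a b w + chernoff_weight (- th) (- g) a b w)).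
  by apply: summable_sum.
have sf : summable_rv P f by apply: summable_sum.
have f0 w : 0 <= f w by apply: sumr_ge0 => a _; apply: sumr_ge0 => b _; rewrite addr_ge0.
have [mB PB] := markov_ge1 f0 sf.
exists [set w | 1 <= f w]; split => //.
  apply: le_trans PB _; rewrite lee_fin.
  set Q := expR _.
  rewrite /f Ex_sum//; apply: (@le_trans _ _ (\sum_(a < p) \sum_(b < p) 2 * Q)).
    apply: ler_sum => a _; rewrite Ex_sum//; apply: ler_sum => b _.
    have [sp ep] := cp a b; have [sn en] := cn a b; rewrite ExD//.
    have -> : 2 * Q = Q + Q by ring.
    apply: lerD; first exact: ep.
    by apply: le_trans en _; rewrite sqrrN /Q !mulNr mulrN opprK.
  have sumE (c : R) : \sum_(a < p) c = p%:R * c.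
    by rewrite sumr_const card_ord -[LHS]mulr_natl.
  rewrite !sumE le_eqVlt; apply/orP; left; apply/eqP; ring.
move=> w /negP; rewrite -ltNge => fw a b.
have cwE th' g' : chernoff_weight th' g' a b w =
    expR (th' * L%:R * (score X (fun l => y l w) sigma Om a b - g')).
  rewrite /chernoff_weight -expR_sum big_ord_prefix_full -mulr_sumr -expRD scoreE.
  by congr expR; field; exact: lt0r_neq0.
have le1 : chernoff_weight th g a b w + chernoff_weight (- th) (- g) a b w <= f w.
  apply: (@le_trans _ _ (\sum_b (chernoff_weight th g a b w + chernoff_weight (- th) (- g) a b w))).
    by apply: (term_le_sum (F := fun b => chernoff_weight th g a b w + chernoff_weight (- th) (- g) a b w)) => c; exact: addr_ge0.
  apply: (term_le_sum (F := fun a => \sum_b (chernoff_weight th g a b w + chernoff_weight (- th) (- g) a b w))) => c.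
  by apply: sumr_ge0 => c' _; exact: addr_ge0.
have c1 : chernoff_weight th g a b w < 1.
  by apply: le_lt_trans fw; apply: le_trans le1; rewrite lerDl.
have c2 : chernoff_weight (- th) (- g) a b w < 1.
  by apply: le_lt_trans fw; apply: le_trans le1; rewrite lerDr.
move: c1 c2; rewrite !cwE !expR_lt1.
set x := score _ _ _ _ _ _; have tL : 0 < th * L%:R by rewrite mulr_gt0.
move=> c1 c2; rewrite ler_norml; apply/andP; split.
  rewrite leNgt; apply/negP => xg; have : 0 <= - th * L%:R * (x - - g); last by lra.
  by rewrite mulNr mulNr -mulrN mulr_ge0 ?(ltW tL)//; lra.
rewrite leNgt; apply/negP => xg; have : 0 <= th * L%:R * (x - g); last by lra.
by rewrite mulr_ge0 ?(ltW tL)//; lra.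
Qed.

End score.

(** * From [Z] to [Z *m Sh] *)

Section design_matrix.
Context (R : realType) (n p : nat).
Variables (Z : 'M[R]_(n, p)) (Sh Sg : 'M[R]_p) (c : R).
Hypothesis Sh_sym : Sh^T = Sh.
Hypothesis ShSh : Sh *m Sh = Sg.
Hypothesis Sg_sym : Sg^T = Sg.
Hypothesis Sg_c : lambda_max Sg <= c.

Lemma frob_sqrt_mul (v : 'cV[R]_p) : frob (Sh *m v) ^+ 2 <= c * frob v ^+ 2.
Proof.
rewrite frob_col_sqr trmx_mul Sh_sym mulmxA -[v^T *m _ *m _]mulmxA ShSh.
exact: rayleigh_le.
Qed.

Lemma frob_col_sqrt i : \sum_j Sh j i ^+ 2 <= c.
Proof.
have e1 : frob (delta_mx i 0 : 'cV[R]_p) ^+ 2 = 1.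
  rewrite frob_colE (bigD1 i)//= mxE !eqxx expr1n big1 ?addr0// => j ji.
  by rewrite mxE (negbTE ji) expr0n.
have := frob_sqrt_mul (delta_mx i 0); rewrite e1 mulr1; apply: le_trans.
rewrite -colE frob_colE le_eqVlt; apply/orP; left; apply/eqP.
by apply: eq_bigr => j _; rewrite mxE.
Qed.

Lemma col_design_entry i k : (Z *m Sh) k i = \sum_j Sh j i * Z k j.
Proof. by rewrite mxE; apply: eq_bigr => j _; rewrite mulrC. Qed.

Lemma frob_col_design i :
  frob (col i (Z *m Sh)) ^+ 2 = \sum_k (\sum_j Sh j i * Z k j) ^+ 2.
Proof.
by rewrite frob_colE; apply: eq_bigr => k _; rewrite mxE col_design_entry.
Qed.

Lemma frob_col_gram i :
  frob (col i ((Z *m Sh)^T *m (Z *m Sh))) ^+ 2 <=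
    c * \sum_j (\sum_k (\sum_j' Sh j' i * Z k j') * Z k j) ^+ 2.
Proof.
have -> : col i ((Z *m Sh)^T *m (Z *m Sh)) = Sh *m (Z^T *m col i (Z *m Sh)).
  by rewrite !colE trmx_mul Sh_sym !mulmxA.
apply: le_trans (frob_sqrt_mul _) _.
rewrite le_eqVlt; apply/orP; left; apply/eqP; congr (_ * _).
rewrite frob_colE; apply: eq_bigr => j _; congr (_ ^+ 2); rewrite mxE.
by apply: eq_bigr => k _; rewrite [LHS]mulrC mxE col_design_entry mxE.
Qed.

(** The hypothesis has the shape delivered by [design_control] for the columns of [Sh], and the
    left-hand side is the square of [variance_proxy]; the 3 comes from squaring a sum of three
    terms. *)
Lemma variance_proxy_sqr_le (tb te C S : R) i : (0 < p)%N -> 0 <= c -> 0 <= C -> 0 <= S ->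
  ((\sum_k (\sum_j Sh j i * Z k j) ^+ 2) / p%:R) ^+ 2 +
    ((\sum_j (\sum_k (\sum_j' Sh j' i * Z k j') * Z k j) ^+ 2) / p%:R ^+ 2) ^+ 2
     <= C * (1 + S) ->
  (1 + tb ^+ 2 * (p%:R^-1 ^+ 2 * frob (col i ((Z *m Sh)^T *m (Z *m Sh))) ^+ 2)
    + te ^+ 2 * (p%:R^-1 * frob (col i (Z *m Sh)) ^+ 2)) ^+ 2 <=
   3 * (1 + (tb ^+ 4 * c ^+ 2 + te ^+ 4) * C) * (1 + S).
Proof.
move=> p0 c0 C0 S0; set B := _ / p%:R; set h := _ / p%:R ^+ 2 => le.
have pR : 0 < p%:R :> R by rewrite ltr0n.
have B0 : 0 <= B.
  by rewrite /B; apply: divr_ge0; [apply: sumr_ge0 => k _; exact: sqr_ge0 | exact: ltW].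
have h0 : 0 <= h.
  by rewrite /h; apply: divr_ge0; [apply: sumr_ge0 => k _; exact: sqr_ge0 | exact: sqr_ge0].
have -> : p%:R^-1 * frob (col i (Z *m Sh)) ^+ 2 = B by rewrite frob_col_design mulrC.
have : p%:R^-1 ^+ 2 * frob (col i ((Z *m Sh)^T *m (Z *m Sh))) ^+ 2 <= c * h.
  rewrite exprVn mulrC ler_pdivrMr ?exprn_gt0//.
  apply: le_trans (frob_col_gram i) _.
  by rewrite /h -mulrA divfK// expf_neq0// gt_eqF.
set g := p%:R^-1 ^+ 2 * _ => gch.
have g0 : 0 <= g by rewrite mulr_ge0 ?sqr_ge0.
have t1 : 0 <= tb ^+ 2 * g by rewrite mulr_ge0 ?sqr_ge0.
have t2 : 0 <= te ^+ 2 * B by rewrite mulr_ge0 ?sqr_ge0.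
set x := tb ^+ 2 * g; set y := te ^+ 2 * B.
have s3 : (1 + x + y) ^+ 2 <= 3 * (1 + x ^+ 2 + y ^+ 2).
  have := sqr_ge0 (1 - x); have := sqr_ge0 (1 - y); have := sqr_ge0 (x - y); lra.
apply: le_trans s3 _; rewrite -mulrA ler_wpM2l//.
have xx : x ^+ 2 <= tb ^+ 4 * c ^+ 2 * h ^+ 2.
  rewrite (_ : tb ^+ 4 * c ^+ 2 * h ^+ 2 = (tb ^+ 2 * (c * h)) ^+ 2); last by ring.
  have xle : x <= tb ^+ 2 * (c * h) by apply: ler_wpM2l => //; exact: sqr_ge0.
  by rewrite ler_sqr ?nnegrE// (le_trans t1).
have yy : y ^+ 2 = te ^+ 4 * B ^+ 2 by rewrite /y; ring.
have q1 : 0 <= tb ^+ 4 * c ^+ 2 by rewrite mulr_ge0 ?sqr_ge0// (sqr_pow_ge0 _ 2).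
have q2 : 0 <= te ^+ 4 by rewrite (sqr_pow_ge0 _ 2).
have bh : tb ^+ 4 * c ^+ 2 * h ^+ 2 + te ^+ 4 * B ^+ 2 <=
    (tb ^+ 4 * c ^+ 2 + te ^+ 4) * (B ^+ 2 + h ^+ 2).
  have := mulr_ge0 q1 (sqr_ge0 B); have := mulr_ge0 q2 (sqr_ge0 h); lra.
have bh2 := le_trans bh (ler_wpM2l (addr_ge0 q1 q2) le).
have S1 : 1 <= 1 + S by rewrite lerDl.
rewrite yy.
have -> : (1 + (tb ^+ 4 * c ^+ 2 + te ^+ 4) * C) * (1 + S) =
    (1 + S) + (tb ^+ 4 * c ^+ 2 + te ^+ 4) * (C * (1 + S)) by ring.
rewrite -[1 + _ + _]addrA; apply: lerD => //.
by apply: le_trans bh2; rewrite lerD2r.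
Qed.

End design_matrix.

(** * High-probability events and conclusion *)

Lemma eighth_moment d (T : measurableType d) (R : realType) (P : probability T R)
    (z : T -> R) (m12 : R) : measurable_fun setT z ->
  ('E_P[fun w => (`|z w| ^+ 12)%R] <= m12%:E)%E ->
  summable_rv P (fun w => z w ^+ 8) /\ Ex P (fun w => z w ^+ 8) <= 1 + m12.
Proof.
move=> mz; rewrite unlock => Em.
have [s12 E12] : summable_rv P (fun w => `|z w| ^+ 12) /\ Ex P (fun w => `|z w| ^+ 12) <= m12.
  apply: ge0_summable => //.
  by apply: measurable_funX; exact: measurableT_comp.
have le8 w : z w ^+ 8 <= 1 + `|z w| ^+ 12.
  have -> : z w ^+ 8 = `|z w| ^+ 8.
    by rewrite -normrX ger0_norm// (sqr_pow_ge0 _ 4).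
  have [z1|z1] := leP `|z w| 1.
    by rewrite ler_wpDr// exprn_ile1.
  by rewrite ler_wpDl// ler_weXn2l// ltW.
have s1 : summable_rv P (fun w => 1 + `|z w| ^+ 12).
  by apply: summableD => //; exact: summable_cst.
have s8 : summable_rv P (fun w => z w ^+ 8).
  apply: summable_le s1; first exact: measurable_funX.
  by move=> w; rewrite ger0_norm// (sqr_pow_ge0 _ 4).
split => //; apply: le_trans (Ex_le s8 s1 le8) _.
by rewrite ExD ?Ex_cst ?lerD2l//; exact: summable_cst.
Qed.

Lemma design_event (R : realType) (m12 rho c tb te : R) : 0 <= m12 -> 0 <= rho -> 0 <= c ->
  exists2 C : R, 1 <= C &
  forall d (T : measurableType d) (P : probability T R) (p L : nat) (N : 'I_L -> nat)
    (Z : forall l, T -> 'M[R]_(N l, p)) (Sg Sh : 'I_L -> 'M[R]_p),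
  (0 < p)%N -> (0 < L)%N -> (forall l, (N l)%:R <= rho * p%:R) ->
  (forall l, random_matrix (Z l)) -> (forall l, iid_entries P (Z l)) ->
  (forall l i j, ('E_P[fun w => Z l w i j] = 0)%E) ->
  (forall l i j, ('E_P[fun w => (`|Z l w i j| ^+ 12)%R] <= m12%:E)%E) ->
  (forall l, posdef (Sg l)) -> (forall l, posdef (Sh l)) ->
  (forall l, Sh l *m Sh l = Sg l) -> (forall l, lambda_max (Sg l) <= c) ->
  exists D : set T, [/\ measurable D,
    (P (~` D) <= (C / Num.sqrt p%:R)%:E)%E &
    forall w, D w -> let X l := Z l w *m Sh l in
      (forall a, \sum_l variance_proxy X tb te l a ^+ 2 <= 2 * C * L%:R) /\
      (forall l a, variance_proxy X tb te l a ^+ 2 <= C * (1 + L%:R / Num.sqrt p%:R))].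
Proof.
move=> m0 rho0 c0.
have m1 : 0 <= 1 + m12 by rewrite addr_ge0.
have [C0 C00 ctl] := design_control m1 c0 rho0.
have q0 : 0 <= tb ^+ 4 * c ^+ 2 + te ^+ 4.
  by apply: addr_ge0; [apply: mulr_ge0; [exact: (sqr_pow_ge0 _ 2)|exact: sqr_ge0]|exact: (sqr_pow_ge0 _ 2)].
pose Ct := 3 * (1 + (tb ^+ 4 * c ^+ 2 + te ^+ 4) * C0).
have qC : 0 <= (tb ^+ 4 * c ^+ 2 + te ^+ 4) * C0 by rewrite mulr_ge0// ltW.
have Ct1 : 1 <= Ct by rewrite /Ct; lra.
exists (Ct + C0); first lra.
move=> d T P p L N Z Sg Sh p0 L0 Nle mZ iidZ Z0 Z12 Sgpd Shpd ShSh Sgc.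
have pR : 0 < p%:R :> R by rewrite ltr0n.
have LR : 0 < L%:R :> R by rewrite ltr0n.
have sp0 : 0 < Num.sqrt p%:R :> R by rewrite sqrtr_gt0.
have sp1 : 1 <= Num.sqrt p%:R :> R by rewrite -[leLHS]sqrtr1 ler_sqrt// ler1n.
have colSh l i : \sum_j Sh l j i ^+ 2 <= c.
  exact: (frob_col_sqrt (Shpd l).1 (ShSh l) (Sgpd l).1 (Sgc l)).
have exS l : {S : T -> R |
    [/\ forall w, 0 <= S w, summable_rv P S, Ex P S <= C0 / p%:R &
      forall w i,
        ((\sum_k (\sum_j Sh l j i * Z l w k j) ^+ 2) / p%:R) ^+ 2 +
        ((\sum_j (\sum_k (\sum_j' Sh l j' i * Z l w k j') * Z l w k j) ^+ 2)
           / p%:R ^+ 2) ^+ 2 <= C0 * (1 + S w)]}.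
  apply: cid.
  have e1 k j := Ex_of_expectation (mZ l k j) (Z0 l k j).
  have e8 k j := eighth_moment (mZ l k j) (Z12 l k j).
  have [S SP] := ctl d T P (N l) p (fun k j w => Z l w k j) (fun i j => Sh l j i)
    p0 (Nle l) (mZ l) (iidZ l).1 (fun k j => (e1 k j).2) (fun k j => (e8 k j).1)
    (fun k j => (e8 k j).2) (colSh l).
  by exists S.
pose S l := sval (exS l).
have S0 l w : 0 <= S l w by rewrite /S; case: (exS l) => ? [].
have sS l : summable_rv P (S l) by rewrite /S; case: (exS l) => ? [].
have ES l : Ex P (S l) <= C0 / p%:R by rewrite /S; case: (exS l) => ? [].
have bS l w i : ((\sum_k (\sum_j Sh l j i * Z l w k j) ^+ 2) / p%:R) ^+ 2 +
        ((\sum_j (\sum_k (\sum_j' Sh l j' i * Z l w k j') * Z l w k j) ^+ 2)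
           / p%:R ^+ 2) ^+ 2 <= C0 * (1 + S l w).
  by rewrite /S; case: (exS l) => ? [].
(* The sum of the [S l] has mean at most [C0 L / p]. Markov at level [L / sqrt p] fails with
   probability of order [1 / sqrt p], and this level also bounds each single [S l]. *)
pose k : R := Num.sqrt p%:R / L%:R.
have k0 : 0 < k by rewrite divr_gt0.
pose f w := k * \sum_l S l w.
have f0 w : 0 <= f w by rewrite mulr_ge0 ?sumr_ge0// ltW.
have sSum : summable_rv P (fun w => \sum_l S l w) by apply: summable_sum.
have sf : summable_rv P f by exact: summableZ.
have Ef : Ex P f <= C0 / Num.sqrt p%:R.
  rewrite ExZ// Ex_sum//.
  have : \sum_l Ex P (S l) <= L%:R * (C0 / p%:R).
    apply: le_trans (ler_sum _ (fun l _ => ES l)) _.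
    by rewrite sumr_const card_ord mulr_natl.
  move=> /(ler_wpM2l (ltW k0)) /le_trans; apply.
  rewrite /k -[in p%:R^-1](sqr_sqrtr (ltW pR)) le_eqVlt; apply/orP; left; apply/eqP.
  by field; rewrite !gt_eqF.
have [mA PA] := markov_ge1 f0 sf.
exists (~` [set w | 1 <= f w]); split; first exact: measurableC.
  rewrite setCK; apply: le_trans PA _; rewrite lee_fin (le_trans Ef)//.
  by rewrite ler_pM2r ?invr_gt0// lerDr (le_trans ler01).
move=> w /negP; rewrite -ltNge => fw X.
have sumS : \sum_l S l w <= L%:R / Num.sqrt p%:R.
  by rewrite -invf_div -[leRHS]mulr1 ler_pdivlMl// ltW.
have vpS l a : variance_proxy X tb te l a ^+ 2 <= Ct * (1 + S l w).
  apply: (variance_proxy_sqr_le (Shpd l).1 (ShSh l) (Sgpd l).1 (Sgc l)) => //; exact: ltW.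
have Ct0 : 0 <= Ct by rewrite (le_trans ler01).
have CtC : Ct <= Ct + C0 by rewrite lerDl ltW.
split=> [a|l a].
  apply: le_trans (ler_sum _ (fun l _ => vpS l a)) _.
  rewrite -mulr_sumr big_split /= sumr_const card_ord.
  have Lp : L%:R / Num.sqrt p%:R <= L%:R :> R by rewrite ler_pdivrMr// ler_peMr// ltW.
  have : Ct * (1 *+ L + \sum_l S l w) <= Ct * (2 * L%:R).
    by apply: ler_wpM2l => //; rewrite mulr_natl mulr2n; apply: lerD => //; exact: le_trans Lp.
  move=> /le_trans; apply; rewrite mulrA ler_wpM2r ?ler0n//; lra.
apply: le_trans (vpS l a) _; apply: ler_pM => //; first by rewrite addr_ge0.
rewrite lerD2l; apply: le_trans sumS; exact: (term_le_sum (F := fun l => S l w)).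
Qed.

Lemma ln_le_2sqrt (R : realType) (x : R) : 0 < x -> ln x <= 2 * Num.sqrt x.
Proof.
move=> x0; have s0 : 0 < Num.sqrt x by rewrite sqrtr_gt0.
rewrite -{1}(sqr_sqrtr (ltW x0)) lnXn// mulr2n.
have := @le_ln1Dx R (Num.sqrt x - 1); rewrite subrKC => /(_ _); lra.
Qed.

Lemma mgf_const_ge0 (R : realType) : 0 <= mgf_const R.
Proof.
rewrite /mgf_const mulr_ge0 ?expR_ge0// mulr_ge0//.
exact: le_trans (gauss_const_ge1 R).
Qed.

Lemma score_event (R : realType) (C K : R) : 1 <= C ->
  exists2 g0 : R, 0 < g0 &
  forall d (T : measurableType d) (P : probability T R) (p L : nat) (N : 'I_L -> nat)
    (X : forall l, 'M[R]_(N l, p)) (Om : 'M[R]_p)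
    (beta : 'I_L -> T -> 'cV[R]_p) (eps : forall l, T -> 'cV[R]_(N l))
    (sigma tb te : R),
  (1 < p)%N -> (0 < L)%N -> ln (p%:R : R) <= K * L%:R ->
  (forall l, random_matrix (beta l)) -> (forall l, random_matrix (eps l)) ->
  mutually_independent P (fun k : 'I_L + 'I_L =>
    match k with
    | inl l => sigma_of (@mxborel R p 1) (beta l)
    | inr l => sigma_of (@mxborel R (N l) 1) (eps l)
    end) ->
  (forall l, has_mean P (beta l) 0) ->
  (forall l i j,
     ('E_P[fun w => (beta l w i 0 * beta l w j 0)%R])%E = (p%:R^-1 * Om i j)%:E) ->
  (forall l, has_mean P (eps l) 0) ->
  (forall l i j,
     covariance P (fun w => eps l w i 0) (fun w => eps l w j 0)
       = (((sigma ^+ 2)%:M : 'M[R]_(N l)) i j)%:E) ->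
  (forall l, sub_gaussian P (fun w => Num.sqrt p%:R *: beta l w) 0 tb) ->
  (forall l, sub_gaussian P (eps l) 0 te) ->
  (forall a, \sum_l variance_proxy X tb te l a ^+ 2 <= 2 * C * L%:R) ->
  (forall l a, variance_proxy X tb te l a ^+ 2 <= C * (1 + L%:R / Num.sqrt p%:R)) ->
  exists B : set T, [/\ measurable B, (P B <= (2 / p%:R)%:E)%E &
    forall w, ~ B w -> forall a b,
      `|score X (fun l => X l *m beta l w + eps l w) sigma Om a b|
         <= g0 * Num.sqrt (ln p%:R / L%:R)].
Proof.
move=> C1; have C0 : 0 < C by exact: lt_le_trans C1.
pose M1 : R := 1 + C * (`|K| + 2).
have M10 : 0 < M1 by rewrite ltr_wpDr// mulr_ge0// ?addr_ge0// ltW.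
(* Once [vp * r <= M1], the parameter [a0 * r] times the scale is at most [4 * a0 * M1 = 1 / 2]. *)
pose a0 : R := (8 * M1)^-1.
have a00 : 0 < a0 by rewrite invr_gt0 mulr_gt0.
pose c1 := mgf_const R.
have c10 : 0 <= c1 := mgf_const_ge0 R.
(* Makes the Chernoff exponent [- 3 ln p], which beats the [2 p^2] of the union bound. *)
pose g0 : R := (3 + 16 * c1 * a0 ^+ 2 * (2 * C)) / a0.
have q0 : 0 <= 16 * c1 * a0 ^+ 2 * (2 * C).
  by rewrite !mulr_ge0// ?sqr_ge0// ltW.
exists g0; first by rewrite divr_gt0// ltr_wpDr.
move=> d T P p L N X Om beta eps sigma tb te p1 L0 lnKL mb me ind b0 bc e0 ec bs es sumv maxv.
have p0 : (0 < p)%N := ltnW p1.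
have pR : 0 < p%:R :> R by rewrite ltr0n.
have LR : 0 < L%:R :> R by rewrite ltr0n.
have sp0 : 0 < Num.sqrt p%:R :> R by rewrite sqrtr_gt0.
have lnp : 0 < ln (p%:R : R) by rewrite ln_gt0// ltr1n.
pose q : R := ln p%:R / L%:R.
have q0' : 0 < q by rewrite divr_gt0.
pose r := Num.sqrt q.
have r0 : 0 < r by rewrite sqrtr_gt0.
have rr : r ^+ 2 = q by rewrite sqr_sqrtr// ltW.
have qL : q * L%:R = ln p%:R by rewrite /q divfK// gt_eqF.
pose vp := variance_proxy X tb te.
have vp1 l a : 1 <= vp l a by exact: variance_proxy_ge1.
(* Its square is at most [C * (ln p / L + ln p / sqrt p)], bounded by the growth condition and
   [ln_le_2sqrt]. *)
have vpr l a : vp l a * r <= M1.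
  have h : (vp l a * r) ^+ 2 <= C * (`|K| + 2).
    rewrite exprMn rr; apply: le_trans (ler_wpM2r (ltW q0') (maxv l a)) _.
    rewrite -mulrA ler_wpM2l ?(ltW C0)// mulrDl mul1r lerD//.
      by rewrite ler_pdivrMr// (le_trans lnKL)// ler_wpM2r ?ler_norm// ltW.
    rewrite mulrAC mulrC -/q [L%:R * q]mulrC qL ler_pdivrMl// mulrC.
    exact: ln_le_2sqrt.
  have := sqr_ge0 (vp l a * r - 1); rewrite /M1; nra.
have th0 : 0 < a0 * r by rewrite mulr_gt0.
have hV a b : \sum_l vp l a * vp l b <= 2 * C * L%:R.
  have le l : vp l a * vp l b <= 2^-1 * vp l a ^+ 2 + 2^-1 * vp l b ^+ 2.
    have := sqr_ge0 (vp l a - vp l b); lra.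
  apply: le_trans (ler_sum _ (fun l _ => le l)) _.
  rewrite big_split /= -!mulr_sumr; have := sumv a; have := sumv b.
  rewrite /vp; lra.
have hth l a b : (a0 * r) * (4 * Num.sqrt (vp l a) * Num.sqrt (vp l b)) <= 2^-1.
  have va : 0 <= vp l a by exact: le_trans (vp1 l a).
  have vb : 0 <= vp l b by exact: le_trans (vp1 l b).
  have h : 4 * Num.sqrt (vp l a) * Num.sqrt (vp l b) <= 2 * (vp l a + vp l b).
    have := sqr_ge0 (Num.sqrt (vp l a) - Num.sqrt (vp l b)).
    by rewrite sqrrB !sqr_sqrtr//; lra.
  apply: le_trans (ler_wpM2l (ltW th0) h) _.
  have -> : a0 * r * (2 * (vp l a + vp l b)) = 2 * a0 * (vp l a * r + vp l b * r) by ring.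
  have : 2 * a0 * (vp l a * r + vp l b * r) <= 2 * a0 * (M1 + M1).
    by apply: ler_wpM2l; [rewrite mulr_ge0// ltW | exact: lerD].
  move=> /le_trans; apply; rewrite le_eqVlt; apply/orP; left; apply/eqP.
  by rewrite /a0; field; rewrite gt_eqF.
have [B [mB PB sB]] := score_concentration p0 L0 mb me ind b0 bc e0 ec bs es
   (g0 * r) th0 hth hV.
exists B; split => //; apply: le_trans PB _; rewrite lee_fin.
have -> : 16 * mgf_const R * (a0 * r) ^+ 2 * (2 * C) * L%:R -
          a0 * r * L%:R * (g0 * r) = - (ln p%:R *+ 3).
  have -> : a0 * r * L%:R * (g0 * r) = a0 * g0 * (r ^+ 2 * L%:R) by ring.
  have -> : 16 * mgf_const R * (a0 * r) ^+ 2 * (2 * C) * L%:R =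
     16 * mgf_const R * a0 ^+ 2 * (2 * C) * (r ^+ 2 * L%:R) by ring.
  have -> : a0 * g0 = 3 + 16 * c1 * a0 ^+ 2 * (2 * C).
    by rewrite /g0 mulrC divfK// gt_eqF.
  by rewrite rr qL -/c1; ring.
rewrite expRN -lnXn// lnK ?posrE ?exprn_gt0// le_eqVlt; apply/orP; left; apply/eqP.
by field; rewrite gt_eqF.
Qed.

Lemma probability_cvg1P d (T : measurableType d) (R : realType) (P : probability T R)
    (A : nat -> set T) : (forall n, measurable (A n)) ->
  (P (A n) @[n --> \oo] --> 1%E) <->
  (forall e : R, 0 < e -> \forall n \near \oo, (P (~` A n) <= e%:E)%E).
Proof.
move=> mA.
have PC n : (P (~` A n) = (1 - fine (P (A n)))%:E)%E.
  by rewrite probability_setC// EFinB fineK// fin_num_measure.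
have f1 n : `|1 - fine (P (A n))| = 1 - fine (P (A n)).
  by rewrite ger0_norm// -lee_fin -PC measure_ge0.
split=> [/fine_cvgP[_ /cvgrPdist_le cv] e e0|cv].
  by apply: filterS (cv e e0) => n /=; rewrite PC lee_fin f1.
apply/fine_cvgP; split; first by apply: nearW => n; rewrite fin_num_measure.
apply/cvgrPdist_le => e e0.
by apply: filterS (cv e e0) => n /=; rewrite PC lee_fin f1.
Qed.

Lemma near_natr_ge (R : realType) (u : nat -> nat) (x : R) :
  u n @[n --> \oo] --> \oo -> \forall n \near \oo, x <= (u n)%:R.
Proof. by move=> /cvgrnyP /cvgryPge; exact. Qed.

Lemma measurable_frob d (T : measurableType d) (R : realType) m n
    (X : T -> 'M[R]_(m, n)) : random_matrix X -> measurable_fun setT (fun w => frob (X w)).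
Proof.
move=> mX; apply: measurableT_comp.
  by apply: continuous_measurable_fun; exact: sqrt_continuous.
apply: measurable_sum => i; apply: measurable_sum => j.
by apply: measurable_funX; exact: mX.
Qed.

(** Fixed design is expressed by two probability spaces: the conclusion holds for every sequence
    [w0] of realisations eventually in [D n], with probability over coefficients and noise only.
    Positive definite matrices form an open set, on which a minimum need not be attained; [E n] are
    events on which [Ohat] attains it. The order of [lam] is given by [cstar], large enough to
    dominate the score, and an arbitrary [c2]. *)
Theorem theorem3p2 (R : realType)
  (* probability space of the designs *)
  (dD : measure_display) (TD : measurableType dD) (PD : probability TD R)
  (* probability space of the coefficients and the noise *)
  (dT : measure_display) (T : measurableType dT) (P : probability T R)
  (* dimensions *)
  (p L : nat -> nat) (N : forall n : nat, 'I_(L n) -> nat)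
  (gamma : nat -> R)
  (* Z, Sigma, Sigma^(1/2), Omega, beta, epsilon *)
  (Z : forall (n : nat) (l : 'I_(L n)), TD -> 'M[R]_(N n l, p n))
  (Sigma Sigmah : forall n : nat, 'I_(L n) -> 'M[R]_(p n))
  (Omega : forall n : nat, 'M[R]_(p n))
  (beta : forall n : nat, 'I_(L n) -> T -> 'cV[R]_(p n))
  (eps : forall (n : nat) (l : 'I_(L n)), T -> 'cV[R]_(N n l))
  (* constants *)
  (s : nat -> nat)
  (m12 sigma C0 C1 K clo chi cop_lo cop_hi tau_beta tau_eps kappa0 : R)
  (cSlo cShi : nat -> R)
  (* asymptotic regime *)
  (p_gt0 : forall n, (0 < p n)%N)
  (p_oo : p n @[n --> \oo] --> \oo)
  (L_oo : L n @[n --> \oo] --> \oo)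
  (N_oo : forall k : nat, \forall n \near \oo, forall l, (k <= N n l)%N)
  (ratio_cvg : forall e : R, 0 < e -> \forall n \near \oo,
     forall l : 'I_(L n), `|(p n)%:R / (N n l)%:R - gamma l| <= e)
  (logp_L : \forall n \near \oo, ln ((p n)%:R : R) <= K * (L n)%:R)
  (* designs *)
  (Z_meas : forall n l, random_matrix (Z n l))
  (Z_iid : forall n l, iid_entries PD (Z n l))
  (Z_mean : forall n l i j, ('E_PD[fun w => Z n l w i j] = 0)%E)
  (Z_var : forall n l i j, ('V_PD[fun w => Z n l w i j] = 1)%E)
  (Z_m12 : forall n l i j,
     ('E_PD[fun w => (`|Z n l w i j| ^+ 12)%R] <= m12%:E)%E)
  (Sigma_pd : forall n l, posdef (Sigma n l))
  (Sigmah_pd : forall n l, posdef (Sigmah n l))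
  (Sigmah_sqrt : forall n l, Sigmah n l *m Sigmah n l = Sigma n l)
  (* coefficients and noise *)
  (beta_meas : forall n l, random_matrix (beta n l))
  (eps_meas : forall n l, random_matrix (eps n l))
  (beta_eps_indep : forall n, mutually_independent P
     (fun k : 'I_(L n) + 'I_(L n) =>
        match k with
        | inl l => sigma_of (@mxborel R (p n) 1) (beta n l)
        | inr l => sigma_of (@mxborel R (N n l) 1) (eps n l)
        end))
  (beta_law : forall n l l',
     same_law P (@mxborel R (p n) 1) (beta n l) (beta n l'))
  (beta_mean : forall n l, has_mean P (beta n l) 0)
  (beta_cov : forall n l i j,
     ('E_P[fun w => (beta n l w i 0 * beta n l w j 0)%R])%E
       = ((p n)%:R^-1 * Omega n i j)%:E)
  (eps_mean : forall n l, has_mean P (eps n l) 0)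
  (eps_cov : forall n l i j,
     covariance P (fun w => eps n l w i 0) (fun w => eps n l w j 0)
       = (((sigma ^+ 2)%:M : 'M[R]_(N n l)) i j)%:E)
  (C0_gt0 : 0 < C0) (C1_gt0 : 0 < C1)
  (Omega_pd : forall n, posdef (Omega n))
  (Omega_lo : forall n, C0 < lambda_min (Omega n))
  (Omega_hi : forall n, lambda_max (Omega n) < C1)
  (* aspect ratios and spectra of the Sigma *)
  (clo_gt0 : 0 < clo) (gamma_bd : forall l, clo <= gamma l <= chi)
  (cSlo_gt0 : forall l, 0 < cSlo l)
  (Sigma_lo : forall n (l : 'I_(L n)), cSlo l <= lambda_min (Sigma n l))
  (Sigma_hi : forall n (l : 'I_(L n)), lambda_max (Sigma n l) <= cShi l)
  (cop_lo_gt0 : 0 < cop_lo) (cop_hi_gt0 : 0 < cop_hi)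
  (cShi_sup : forall l, cShi l <= cop_hi)
  (cSlo_inf : cop_lo < inf (range cSlo))
  (* sub-Gaussianity *)
  (beta_subg : forall n l,
     sub_gaussian P (fun w => Num.sqrt (p n)%:R *: beta n l w) 0 tau_beta)
  (eps_subg : forall n l, sub_gaussian P (eps n l) 0 tau_eps)
  (* sparsity *)
  (Omega_sparse : forall n, (#|offdiag_support (Omega n)| <= s n)%N)
  (* uniform lower bound on the curvature constants *)
  (kappa0_gt0 : 0 < kappa0) :
  exists (cstar : R) (D : nat -> set TD),
    [/\ 0 < cstar,
        forall n, measurable (D n),
        PD (D n) @[n --> \oo] --> 1%E
      & forall (w0 : nat -> TD) (lam : nat -> R) (c2 : R)
          (Ohat : forall n : nat, T -> 'M[R]_(p n)) (E : nat -> set T),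
        let X n l := Z n l (w0 n) *m Sigmah n l in
        let y n l w := X n l *m beta n l w + eps n l w in
        let rate n := Num.sqrt (ln (p n)%:R / (L n)%:R) in
        (\forall n \near \oo, D n (w0 n)) ->
        (* curvature of the realised designs *)
        (\forall n \near \oo, forall l, exists2 kappa_l : R,
           kappa0 <= kappa_l & restricted_eigenvalue (X n l) kappa_l) ->
        (\forall n \near \oo, cstar * rate n <= lam n <= c2 * rate n) ->
        (forall n, random_matrix (Ohat n)) ->
        (forall n, measurable (E n)) ->
        P (E n) @[n --> \oo] --> 1%E ->
        (forall n w, E n w ->
           is_minimizer (X n) (fun l => y n l w) sigma (lam n) (Ohat n w)) ->
        bigOP P (fun n w => frob (Ohat n w - Omega n))
          (fun n => Num.sqrt
             ((p n + s n)%:R * ln (p n)%:R / (L n)%:R))].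
Proof.
have rho0 : 0 <= 2 / clo by rewrite divr_ge0// ltW.
have [C Cge1 design] := @design_event R `|m12| (2 / clo) cop_hi tau_beta tau_eps
  (normr_ge0 _) rho0 (ltW cop_hi_gt0).
have [g0 g00 scoreP] := score_event K Cge1.
have C0' : 0 < C by exact: lt_le_trans Cge1.
pose X n w l := Z n l w *m Sigmah n l.
pose good n := [/\ (0 < p n)%N, (0 < L n)%N &
  forall l, (N n l)%:R <= 2 / clo * (p n)%:R].
have exD n : {D : set TD | measurable D /\ (good n ->
    (PD (~` D) <= (C / Num.sqrt (p n)%:R)%:E)%E /\
    forall w, D w ->
      (forall a, \sum_l variance_proxy (X n w) tau_beta tau_eps l a ^+ 2
         <= 2 * C * (L n)%:R) /\
      (forall l a, variance_proxy (X n w) tau_beta tau_eps l a ^+ 2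
         <= C * (1 + (L n)%:R / Num.sqrt (p n)%:R)))}.
  (* The default [setT] keeps [D n] measurable for the finitely many [n] that may fail to be
     good. *)
  apply: cid; have [[pn Ln Nn]|ngood] := pselect (good n); last first.
    by exists setT; split => // /ngood.
  have m12' l i j : ('E_PD[fun w => (`|Z n l w i j| ^+ 12)%R] <= `|m12|%:E)%E.
    by apply: le_trans (Z_m12 n l i j) _; rewrite lee_fin ler_norm.
  have Sc l : lambda_max (Sigma n l) <= cop_hi by exact: le_trans (Sigma_hi n l) (cShi_sup l).
  have [D [mD PDD DP]] := design _ TD PD (p n) (L n) (N n) (Z n) (Sigma n) (Sigmah n)
    pn Ln Nn (Z_meas n) (Z_iid n) (Z_mean n) m12' (Sigma_pd n)
    (Sigmah_pd n) (Sigmah_sqrt n) Sc.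
  by exists D.
pose D n := sval (exD n).
have mD n : measurable (D n) by rewrite /D; case: (exD n) => ? [].
have PDD n : good n -> (PD (~` D n) <= (C / Num.sqrt (p n)%:R)%:E)%E.
  by rewrite /D; case: (exD n) => ? [_ /= h] /h[].
have DP n w : good n -> D n w ->
      (forall a, \sum_l variance_proxy (X n w) tau_beta tau_eps l a ^+ 2
         <= 2 * C * (L n)%:R) /\
      (forall l a, variance_proxy (X n w) tau_beta tau_eps l a ^+ 2
         <= C * (1 + (L n)%:R / Num.sqrt (p n)%:R)).
  by rewrite /D; case: (exD n) => ? [_ /= h] /h[_]; exact.
have L1 : \forall n \near \oo, 1 <= (L n)%:R :> R := near_natr_ge 1 L_oo.
have goodn : \forall n \near \oo, good n.
  (* Within [clo / 2] of [gamma l >= clo], the ratio [p / N] is at least [clo / 2], whence the bound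
     [2 / clo]. *)
  have clo2 : 0 < clo / 2 by rewrite divr_gt0.
  apply: filterS2 (ratio_cvg _ clo2) L1 => n rn L1n.
  split; [exact: p_gt0|by move: L1n; rewrite ler1n|move=> l].
  have /andP[cg _] := gamma_bd l.
  have [N0|N0] := posnP (N n l); first by rewrite N0 mulr_ge0.
  have NR : 0 < (N n l)%:R :> R by rewrite ltr0n.
  have : clo / 2 <= (p n)%:R / (N n l)%:R.
    have := rn l; rewrite ler_norml => /andP[+ _]; lra.
  rewrite ler_pdivlMr// => h.
  by rewrite mulrAC ler_pdivlMr// mulrC; lra.
(* [basic_inequality] asks for [lam] at least four times the bound [g0 * rate] on the score. *)
exists (4 * g0), D; split => //; first by rewrite mulr_gt0.
  apply/probability_cvg1P => // e e0.
  apply: filterS2 goodn (near_natr_ge ((C / e) ^+ 2) p_oo) => n gn pn.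
  apply: le_trans (PDD n gn) _; rewrite lee_fin.
  have pR : 0 < (p n)%:R :> R by rewrite ltr0n.
  rewrite ler_pdivrMr ?sqrtr_gt0// mulrC -ler_pdivrMr//.
  by apply: le_trans (ler_wsqrtr pn); rewrite sqrtr_sqr ger0_norm// divr_ge0// ltW.
move=> w0 lam c2 Ohat E X0 y rate Dw RE lamP mO mE PE Emin eta eta0.
(* The factor in [basic_inequality] once [lam] is replaced by its upper bound [c2 * rate]. *)
exists (2 * c2 / kappa0).
have eta2 : 0 < eta / 2 by rewrite divr_gt0.
move/(probability_cvg1P P mE) : PE => /(_ _ eta2) PE.
(* The 2 makes [ln p] positive; [4 / eta] brings the failure probability [2 / p] of the score bound
   below [eta / 2]. *)
have pbig := near_natr_ge (Num.max 2 (4 / eta)) p_oo.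
near=> n.
have gn : good n by near: n.
have Dn : D n (w0 n) by near: n.
have p2 : Num.max 2 (4 / eta) <= (p n)%:R :> R by near: n.
have p1 : (1 < p n)%N by rewrite -(ler_nat R); apply: le_trans p2; rewrite le_max lexx.
have pe : 4 / eta <= (p n)%:R by apply: le_trans p2; rewrite le_max lexx orbT.
have PEn : (P (~` E n) <= (eta / 2)%:E)%E by near: n.
have lnKL : ln (p n)%:R <= K * (L n)%:R by near: n.
have lamn : 4 * g0 * rate n <= lam n <= c2 * rate n by near: n.
have REn : forall l, exists2 k, kappa0 <= k & restricted_eigenvalue (X0 n l) k by near: n.
have [pn Ln _] := gn.
have [sumv maxv] := DP n (w0 n) gn Dn.
have [B [mB PB sB]] := scoreP _ T P (p n) (L n) (N n) (X0 n) (Omega n) (beta n) (eps n)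
  sigma tau_beta tau_eps p1 Ln lnKL (beta_meas n) (eps_meas n)
  (beta_eps_indep n) (beta_mean n) (beta_cov n)
  (eps_mean n) (eps_cov n) (beta_subg n) (eps_subg n) sumv maxv.
have r0 : 0 <= rate n by exact: sqrtr_ge0.
have /andP[lam1 lam2] := lamn.
have lam0 : 0 <= lam n by apply: le_trans lam1; rewrite !mulr_ge0// ltW.
have pR : 0 < (p n)%:R :> R by rewrite ltr0n.
have leS : [set w | 2 * c2 / kappa0 * Num.sqrt ((p n + s n)%:R * ln (p n)%:R / (L n)%:R)
      < `|frob (Ohat n w - Omega n)|] `<=` B `|` ~` E n.
  move=> w /= big; have [Bw|nBw] := pselect (B w); [by left|right => En].
  have g4 : 4 * (g0 * rate n) <= lam n by rewrite mulrA.
  have := basic_inequality Ln lam0 kappa0_gt0 (Omega_pd n) (Emin n w En)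
    REn (sB w nBw) g4 (Omega_sparse n).
  move=> frob_le; move: big; apply/negP; rewrite -leNgt ger0_norm ?frob_ge0//.
  apply: le_trans frob_le _; rewrite -[(p n + s n)%:R * _ / _]mulrA sqrtrM ?ler0n// -/(rate n).
  have -> : 2 * lam n * Num.sqrt (p n + s n)%:R / kappa0 =
      2 / kappa0 * Num.sqrt (p n + s n)%:R * lam n by ring.
  have -> : 2 * c2 / kappa0 * (Num.sqrt (p n + s n)%:R * rate n) =
      2 / kappa0 * Num.sqrt (p n + s n)%:R * (c2 * rate n) by ring.
  by apply: ler_wpM2l => //; rewrite mulr_ge0 ?sqrtr_ge0// divr_ge0// ltW.
have mS : measurable [set w | 2 * c2 / kappa0 *
      Num.sqrt ((p n + s n)%:R * ln (p n)%:R / (L n)%:R) < `|frob (Ohat n w - Omega n)|].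
  set M := _ * _; rewrite (_ : [set w | _] =
    (fun w => `|frob (Ohat n w - Omega n)|) @^-1` `]M, +oo[%classic); last first.
    by apply/seteqP; split => w /=; rewrite in_itv/= andbT.
  have mf : measurable_fun setT (fun w => `|frob (Ohat n w - Omega n)|).
    apply: measurableT_comp => //; apply: measurable_frob => i j.
    rewrite (_ : (fun w => _) = fun w => Ohat n w i j - Omega n i j); last first.
      by apply/funext => w; rewrite !mxE.
    by apply: measurable_funB => //; exact: mO.
  by rewrite -[_ @^-1` _]setTI; exact: mf.
apply: le_trans (le_measure _ _ _ leS) _; rewrite ?inE//.
  by apply: measurableU => //; exact: measurableC.
apply: le_trans (measureU2 _ _ _) _ => //; first exact: measurableC.
rewrite [eta]splitr EFinD; apply: leeD => //.
apply: le_trans PB _; rewrite lee_fin ler_pdivrMr//.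
move: pe; rewrite ler_pdivrMr// => pe; lra.
Unshelve. all: by end_near. Qed.
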